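(* Let $p>1$. For $i=1,2$ let $V^i\in\mathcal V^p$, let $g^i$ be a generator, let $\xi^i\in\mathbb L^p(\mathcal F_T)$ and $L^i\in\mathcal S$ with $L^i_T\le\xi^i$, and let $(Y^i,Z^i,K^i)\in\mathcal S^p\times\mathrm M^p\times\mathcal V^{+,p}$ be a solution of the reflected BSDE $(\xi^i,g^i+dV^i,L^i)$. Suppose $\xi^1\le\xi^2$, $dV^1\le dV^2$, $L^1\le L^2$, and that at least one of the following holds: (a) $g^1$ satisfies the one-sided Osgood condition in $y$ and the uniform continuity condition in $z$, and $d\mathbb P\times dt$-a.e. $\mathbf 1_{\{Y^1_t>Y^2_t\}}\big(g^1(t,Y^2_t,Z^2_t)-g^2(t,Y^2_t,Z^2_t)\big)\le0$; (b) $g^2$ satisfies the one-sided Osgood condition in $y$ and the uniform continuity condition in $z$, and $d\mathbb P\times dt$-a.e. $\mathbf 1_{\{Y^1_t>Y^2_t\}}\big(g^1(t,Y^1_t,Z^1_t)-g^2(t,Y^1_t,Z^1_t)\big)\le0$. Then $\mathbb P$-a.s. $Y^1_t\le Y^2_t$ for each $t\in[0,T]$.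
   Context: Setting: $T>0$ and an integer $d\ge1$ are fixed. $(\Omega,\mathcal F,\mathbb P)$ is a complete probability space carrying a standard $d$-dimensional Brownian motion $B$, $(\mathcal F_t)$ is the completed filtration generated by $B$, and $\mathcal F=\mathcal F_T$. (In)equalities between random elements hold $\mathbb P$-a.s. A generator is a random function $g:\Omega\times[0,T]\times\mathbb R\times\mathbb R^d\to\mathbb R$ such that $g(\cdot,y,z)$ is $(\mathcal F_t)$-progressively measurable for each $(y,z)$. $\mathbb R_+=[0,\infty)$; $\operatorname{sgn}$ is the sign function. $dV^1\le dV^2$ means that $V^2-V^1$ is nondecreasing; $L^1\le L^2$ means $L^1_t\le L^2_t$ for all $t$. Spaces: $\mathbb L^p(\mathcal F_T)$: $\mathcal F_T$-measurable $\xi$ with $\mathbb E|\xi|^p<\infty$. $\mathcal S$: continuous progressively measurable processes; $\mathcal S^p$: $Y\in\mathcal S$ with $\mathbb E[\sup_{t\in[0,T]}|Y_t|^p]<\infty$. $\mathrm M^p$: progressively measurable $\mathbb R^d$-valued $Z$ with $\mathbb E[(\int_0^T|Z_t|^2dt)^{p/2}]<\infty$. $\mathcal V^p$: continuous progressively measurable finite variation processes $V$ whose total variation $|V|_T$ on $[0,T]$ satisfies $\mathbb E[|V|_T^p]<\infty$; $\mathcal V^{+,p}$: the increasing processes in $\mathcal V^p$. A solution of the reflected BSDE $(\xi,g+dV,L)$ is a triple $(Y,Z,K)$ of progressively measurable processes with $t\mapsto|g(t,Y_t,Z_t)|\in L^1(0,T)$, $t\mapsto|Z_t|\in L^2(0,T)$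 a.s., and $$Y_t=\xi+\int_t^Tg(s,Y_s,Z_s)ds+\int_t^TdV_s+\int_t^TdK_s-\int_t^TZ_sdB_s,\quad Y_t\ge L_t,\quad t\in[0,T],$$ where $K$ is nondecreasing, continuous, $K_0=0$ and $\int_0^T(Y_t-L_t)dK_t=0$. Conditions on a generator $g$: - One-sided Osgood condition in $y$: there is a nondecreasing concave $\rho:\mathbb R_+\to\mathbb R_+$ with $\rho(0)=0$, $\rho(u)>0$ for $u>0$, $\int_{0^+}\frac{du}{\rho(u)}=+\infty$, such that $d\mathbb P\times dt$-a.e., for all $y_1,y_2\in\mathbb R$, $z\in\mathbb R^d$: $(g(t,y_1,z)-g(t,y_2,z))\operatorname{sgn}(y_1-y_2)\le\rho(|y_1-y_2|)$. - Uniform continuity condition in $z$: there is a nondecreasing continuous $\phi:\mathbb R_+\to\mathbb R_+$ with $\phi(0)=0$ such that $d\mathbb P\times dt$-a.e., for all $y$, $z_1,z_2$: $|g(t,y,z_1)-g(t,y,z_2)|\le\phi(|z_1-z_2|)$. (Standing convention, without loss of generality: $\rho$ and $\phi$ have linear growth, $\rho(x),\phi(x)\le A(x+1)$ for some $A>0$.) *)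

(* Defs.v *)
From HB Require Import structures.
From mathcomp Require Import all_boot all_order all_algebra.
From mathcomp Require Import all_classical all_reals all_analysis.

Set Implicit Arguments.
Unset Strict Implicit.
Unset Printing Implicit Defensive.
Import Order.TTheory GRing.Theory Num.Theory.
Import numFieldNormedType.Exports.

Local Open Scope classical_set_scope.
Local Open Scope ring_scope.

(* The norm of the library on 'rV[R]_n is the sup norm. *)
Definition enorm (R : realType) (n : nat) (z : 'rV[R]_n) : R :=
  Num.sqrt (\sum_(i < n) z ord0 i ^+ 2).

Section processes.
Context {d : measure_display} {Omega : measurableType d} {R : realType}.
Variables (P : probability Omega R) (T : R).

(* A filtration is represented by generators: the sigma-algebra at time t is
   <<s G t >>, that is, the one carried by g_sigma_algebraType (G t). *)
Variable G : R -> set (set Omega).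

Definition adapted_at (t : R) (X : Omega -> R) : Prop :=
  measurable_fun setT (X : g_sigma_algebraType (G t) -> R).

Definition progressive (X : R -> Omega -> R) : Prop :=
  forall t, t \in `[0, T] ->
    measurable_fun (`[0, t]%classic `*` setT)
      (fun q : measurableTypeR R * g_sigma_algebraType (G t) => X q.1 q.2).

Definition progressive_rV (n : nat) (Z : R -> Omega -> 'rV[R]_n) : Prop :=
  forall i, progressive (fun t w => Z t w ord0 i).

Definition generator (n : nat) (g : R -> Omega -> R -> 'rV[R]_n -> R) : Prop :=
  forall y z, progressive (fun t w => g t w y z).

Definition as_continuous (X : R -> Omega -> R) : Prop :=
  {ae P, forall w, {within `[0, T], continuous (X ^~ w)}}.

Definition as_nondecreasing (X : R -> Omega -> R) : Prop :=
  {ae P, forall w, {in `[0, T] &, nondecreasing (X ^~ w)}}.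

Definition Lp_rv (p : R) (xi : Omega -> R) : Prop :=
  adapted_at T xi /\ (\int[P]_w (`|xi w| `^ p)%:E < +oo)%E.

Definition S_space (X : R -> Omega -> R) : Prop :=
  progressive X /\ as_continuous X.

Definition Sp_space (p : R) (Y : R -> Omega -> R) : Prop :=
  S_space Y /\
  (\int[P]_w ereal_sup [set (`|Y t w| `^ p)%:E | t in `[0%R, T]] < +oo)%E.

Definition Mp_space (n : nat) (p : R) (Z : R -> Omega -> 'rV[R]_n) : Prop :=
  progressive_rV Z /\
  (\int[P]_w poweR (\int[lebesgue_measure]_(t in `[0%R, T])
                      (enorm (Z t w) ^+ 2)%:E) (p / 2) < +oo)%E.

Definition Vp_space (p : R) (V : R -> Omega -> R) : Prop :=
  [/\ S_space V,
      {ae P, forall w, (total_variation 0%R T (V ^~ w) < +oo)%E} &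
      (\int[P]_w poweR (total_variation 0%R T (V ^~ w)) p < +oo)%E].

Definition Vplusp_space (p : R) (K : R -> Omega -> R) : Prop :=
  Vp_space p K /\ as_nondecreasing K.

Definition cvg_in_prob0 (X : nat -> Omega -> \bar R) : Prop :=
  forall e : R, 0 < e -> P [set w | (e%:E <= X j w)%E] @[j --> \oo] --> 0%E.

End processes.

Section brownian_motion.
Context {d : measure_display} {Omega : measurableType d} {R : realType}.
Variables (P : probability Omega R) (T : R) (n : nat).
Variable B : R -> Omega -> 'rV[R]_n.

Definition past (t : R) : set (set Omega) :=
  [set A | exists s i C, [/\ s \in `[0, t], measurable (C : set R) &
                             A = [set w | C (B s w ord0 i)]]].

(* Taking A = setT, the last clause says that the law of B_t - B_s is
   N(0, (t - s) I_n). *)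
Definition brownian_motion : Prop :=
  [/\ forall t i, t \in `[0, T] -> measurable_fun setT (fun w => B t w ord0 i),
      {ae P, forall w, B 0 w = 0},
      forall i, as_continuous P T (fun t w => B t w ord0 i) &
      forall s t, 0 <= s -> s < t -> t <= T ->
      forall A, <<s past s >> A ->
      forall C : 'I_n -> set R, (forall i, measurable (C i)) ->
        P (A `&` [set w | forall i, C i (B t w ord0 i - B s w ord0 i)]) =
        (P A * \prod_(i < n) normal_prob 0 (Num.sqrt (t - s)) (C i))%E].

Definition brownian_gen (t : R) : set (set Omega) :=
  past t `|` P.-negligible.

(* The process sum_k coef_k 1_]time_k, time_{k+1}] *)
Record simple_process := SimpleProcess {
  sp_size : nat ;
  sp_time : nat -> R ;
  sp_coef : nat -> Omega -> 'rV[R]_n }.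

Definition sp_valid (H : simple_process) : Prop :=
  [/\ forall k, (k <= sp_size H)%N -> sp_time H k \in `[0, T],
      forall k, (k < sp_size H)%N -> sp_time H k <= sp_time H k.+1,
      forall k, (k < sp_size H)%N ->
        exists c : R, forall w, enorm (sp_coef H k w) <= c &
      forall k i, (k < sp_size H)%N ->
        adapted_at brownian_gen (sp_time H k) (fun w => sp_coef H k w ord0 i)].

Definition sp_val (H : simple_process) (t : R) (w : Omega) : 'rV[R]_n :=
  \sum_(k < sp_size H)
    (sp_time H k < t <= sp_time H k.+1)%R%:R *: sp_coef H k w.

Definition sp_int (H : simple_process) (t : R) (w : Omega) : R :=
  \sum_(k < sp_size H) \sum_(i < n) sp_coef H k w ord0 i *
    (B (Num.min (sp_time H k.+1) t) w ord0 i -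
     B (Num.min (sp_time H k) t) w ord0 i).

(* I is (a version of) the Ito integral process of Z, for Z progressively
   measurable with \int_0^T |Z_t|^2 dt < +oo a.s.: the continuous adapted
   process which is the limit, uniformly on [0, T] in probability, of the
   integrals of any simple processes converging to Z in L^2(0, T) in
   probability. The limit does not depend on the approximating sequence, and
   is determined up to indistinguishability. *)
Definition ito_integral (Z : R -> Omega -> 'rV[R]_n) (I : R -> Omega -> R) :
    Prop :=
  S_space P T brownian_gen I /\
  exists H : nat -> simple_process,
    [/\ forall j, sp_valid (H j),
        cvg_in_prob0 P (fun j w =>
          \int[lebesgue_measure]_(t in `[0%R, T])
            (enorm (sp_val (H j) t w - Z t w) ^+ 2)%:E)%E &
        cvg_in_prob0 P (fun j w =>
          ereal_sup [set `|sp_int (H j) t w - I t w|%:E | t in `[0%R, T]])].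

(* \int_0^T X_t dk_t = 0 in the sense of Lebesgue-Stieltjes, for k continuous
   nondecreasing on [0, T]; F extends k to the real line, and the integral over
   ]0, T] only depends on the values of k on [0, T]. *)
Definition stieltjes_int_eq0 (X k : R -> R) : Prop :=
  exists F : cumulative R R,
    (forall t, t \in `[0, T] -> F t = k t) /\
    (\int[lebesgue_stieltjes_measure F]_(t in `]0%R, T]) (X t)%:E = 0)%E.

Record rbsde_solution (xi : Omega -> R)
    (g : R -> Omega -> R -> 'rV[R]_n -> R) (V L : R -> Omega -> R)
    (Y : R -> Omega -> R) (Z : R -> Omega -> 'rV[R]_n) (K : R -> Omega -> R) :
    Prop := {
  rbsde_Y_prog : progressive T brownian_gen Y ;
  rbsde_Z_prog : progressive_rV T brownian_gen Z ;
  rbsde_K_prog : progressive T brownian_gen K ;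
  rbsde_g_L1 : {ae P, forall w, lebesgue_measure.-integrable `[0, T]
    (fun t => (g t w (Y t w) (Z t w))%:E)} ;
  rbsde_Z_L2 : {ae P, forall w,
    (\int[lebesgue_measure]_(t in `[0%R, T]) (enorm (Z t w) ^+ 2)%:E < +oo)%E} ;
  rbsde_eq : exists2 I, ito_integral Z I &
    {ae P, forall w, forall t, t \in `[0, T] ->
      Y t w = xi w
        + \int[lebesgue_measure]_(s in `[t, T]) g s w (Y s w) (Z s w)
        + (V T w - V t w) + (K T w - K t w) - (I T w - I t w)} ;
  rbsde_barrier : {ae P, forall w, forall t, t \in `[0, T] -> L t w <= Y t w} ;
  rbsde_K_nd : as_nondecreasing P T K ;
  rbsde_K_cont : as_continuous P T K ;
  rbsde_K0 : {ae P, forall w, K 0 w = 0} ;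
  rbsde_skorokhod : {ae P, forall w,
    stieltjes_int_eq0 (fun t => Y t w - L t w) (K ^~ w)} }.

(* Linear growth of rho and phi in the two conditions below is not imposed:
   concavity gives it for rho, and phi x may be replaced by
   min (phi x) ((x + 1) * phi 1). *)
Definition osgood_y (g : R -> Omega -> R -> 'rV[R]_n -> R) : Prop :=
  exists rho : R -> R,
    [/\ {in `[0, +oo[ &, nondecreasing rho},
        convex_function (`[0, +oo[%classic : set R^o) (fun u => - rho u),
        rho 0 = 0 /\ (forall u, 0 < u -> 0 < rho u),
        forall e, 0 < e ->
          (\int[lebesgue_measure]_(u in `]0%R, e]) ((rho u)^-1)%:E = +oo)%E &
        {ae (P \x lebesgue_measure)%E, forall q : Omega * R,
          q.2 \in `[0, T] -> forall y1 y2 z,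
          (g q.2 q.1 y1 z - g q.2 q.1 y2 z) * Num.sg (y1 - y2)
            <= rho `|y1 - y2|}].

Definition unif_continuous_z (g : R -> Omega -> R -> 'rV[R]_n -> R) : Prop :=
  exists phi : R -> R,
    [/\ {in `[0, +oo[ &, nondecreasing phi},
        {within `[0, +oo[, continuous phi},
        phi 0 = 0 &
        {ae (P \x lebesgue_measure)%E, forall q : Omega * R,
          q.2 \in `[0, T] -> forall y z1 z2,
          `|g q.2 q.1 y z1 - g q.2 q.1 y z2| <= phi (enorm (z1 - z2))}].

End brownian_motion.

(* Main.v *)
Require Import Defs.
From HB Require Import structures.
From mathcomp Require Import all_boot all_order all_algebra.
From mathcomp Require Import all_classical all_reals all_analysis.
From mathcomp Require Import measurable_realfun ring lra.

Set Implicit Arguments.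
Unset Strict Implicit.
Unset Printing Implicit Defensive.
Import Order.TTheory GRing.Theory Num.Theory.
Import numFieldNormedType.Exports.
Local Open Scope classical_set_scope.
Local Open Scope ring_scope.

(** Let X = Y1 - Y2. While X > 0 the process K1 is flat, and chaining the
modulus phi through small steps shows that, for each eps > 0, the drift of X is
at least -(rho(X) + eps + C |Z1 - Z2|) with C depending on eps. Concavity gives
rho(x) <= rho(b) + (rho(b) / b) (x - b)^+, so if X <= a at time t1 and
f(t) = a + (rho(b) + eps) (t1 - t) stays below b, then X - f has, where it is
positive, a drift bounded below by a linear expression -(m x + C |z|), and the
claim X <= f on [t0, t1] is a comparison for linear drifts.

The linear comparison uses a function Phi, null on the negative axis and of
growth at most p, with x Phi' <= 3 Phi and Phi'^2 <= c Phi Phi'': the second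
order term of Phi absorbs Phi' C |z|, so that e^(L t) Phi(X - f) does not
decrease in mean for L large. This is obtained by a Taylor expansion along grids
on which the stochastic integrands are simple: the martingale transforms,
stopped when the path is large, are centered and bounded in L^2, the pathwise
errors vanish almost surely along a subsequence, and Fatou's lemma concludes.

Finally X <= b_i propagates from X <= b_(i+1) over a time b_i / (4 rho(b_i)),
where b_i = d0 2^(-i). The Osgood condition makes the sum of these times
infinite, so X <= d0 on [0, T] for every d0 > 0. *)

(** The exponent [p] may be less than 2 while the drift carries [C |Z1 - Z2|]. Squares of X need not
    be integrable, and the positive part of X has no second order term on its positive side to pay
    for [C |Z1 - Z2|]. Hence a function that is cubic near 0, so of class C^2, and of order
    [min(p, 2)] at infinity. From [Phi'^2 <= c Phi Phi''] one gets [C Phi' z <= Phi'' z^2 / 2 + (C^2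
    c / 2) Phi], whence the rate [L = 3 m + C^2 c / 2]. C and L may explode as eps tends to 0,
    without harm: the linear comparison starts from a terminal value at most 0 and returns exactly
    [X - f <= 0], so no constant survives. Therefore eps can be taken equal to [rho(b)] at each
    level: f then grows, backwards in time, at rate [2 rho(b_i)], and covering
    [b_i - b_(i+1) = b_i / 2] takes the time [b_i / (4 rho(b_i))]. The Ito integral is given only as
    a limit of integrals of simple processes, which is why Taylor's formula is applied along grids
    that contain the jump times of these processes. *)

Section real_integrable.
Context d (T : measurableType d) (R : realType) (mu : {measure set T -> \bar R}).
Implicit Types (D : set T) (f g : T -> R).

Lemma integrableZ_EFin D (k : R) f : measurable D ->
  mu.-integrable D (EFin \o f) -> mu.-integrable D (EFin \o (fun x => k * f x)).
Proof. by move=> mD fi; exact: (integrableZl mD k fi). Qed.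

Lemma integrableD_EFin D f g : measurable D ->
  mu.-integrable D (EFin \o f) -> mu.-integrable D (EFin \o g) ->
  mu.-integrable D (EFin \o (fun x => f x + g x)).
Proof. by move=> mD fi gi; exact: (integrableD mD fi gi). Qed.

Lemma integrableB_EFin D f g : measurable D ->
  mu.-integrable D (EFin \o f) -> mu.-integrable D (EFin \o g) ->
  mu.-integrable D (EFin \o (fun x => f x - g x)).
Proof. by move=> mD fi gi; exact: (integrableB mD fi gi). Qed.

Lemma le_integrable_EFin D f g : measurable D -> measurable_fun D f ->
  (forall x, D x -> `|f x| <= g x) ->
  mu.-integrable D (EFin \o g) -> mu.-integrable D (EFin \o f).
Proof.
move=> mD mf fg; apply: le_integrable => //; first exact/measurable_EFinP.
by move=> x Dx /=; rewrite lee_fin (le_trans (fg _ Dx))// ler_norm.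
Qed.

End real_integrable.

Section real_integrable_sum.
Context d (T : measurableType d) (R : realType) (mu : {measure set T -> \bar R}).
Variables (D : set T) (mD : measurable D) (I : Type) (f : I -> T -> R).
Hypothesis fi : forall i, mu.-integrable D (EFin \o f i).

Lemma integrable_sum_EFin (s : seq I) :
  mu.-integrable D (EFin \o (fun x => \sum_(i <- s) f i x)).
Proof.
elim: s => [|i s IHs].
  rewrite (_ : _ \o _ = cst 0%E); first exact: integrable0.
  by apply/funext => x /=; rewrite big_nil.
rewrite (_ : _ \o _ = EFin \o (fun x => f i x + \sum_(j <- s) f j x)).
  exact: integrableD_EFin.
by apply/funext => x /=; rewrite big_cons.
Qed.

Lemma Rintegral_sum (s : seq I) :
  \int[mu]_(x in D) (\sum_(i <- s) f i x) = \sum_(i <- s) \int[mu]_(x in D) f i x.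
Proof.
elim: s => [|i s IHs].
  rewrite big_nil (@eq_Rintegral _ _ _ _ _ (cst 0)); last by move=> x _; rewrite big_nil.
  by rewrite /Rintegral integral0.
rewrite big_cons -IHs -RintegralD//; last exact: integrable_sum_EFin.
by apply: eq_Rintegral => x _; rewrite big_cons.
Qed.

End real_integrable_sum.

(** * Cauchy-Schwarz inequality for finite sums *)

Section cauchy_schwarz.
Context (R : realType) (n : nat).
Implicit Types x y : 'I_n -> R.

Lemma sum_sqr_ge0 x : 0 <= \sum_(i < n) x i ^+ 2.
Proof. by apply: sumr_ge0 => i _; exact: sqr_ge0. Qed.

(** Multiplied by the first sum, the gap between the two sides becomes a sum of squares; only the
    case where that sum vanishes is left. *)
Lemma cauchy_schwarz x y :
  (\sum_(i < n) x i * y i) ^+ 2 <= (\sum_(i < n) x i ^+ 2) * (\sum_(i < n) y i ^+ 2).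
Proof.
set a := \sum_(i < n) x i ^+ 2; set c := \sum_(i < n) y i ^+ 2; set b := \sum_(i < n) _.
have a0 : 0 <= a := sum_sqr_ge0 x.
have H : 0 <= a * (a * c - b ^+ 2).
  have -> : a * (a * c - b ^+ 2) = \sum_(i < n) (b * x i - a * y i) ^+ 2.
    rewrite (eq_bigr (fun i => b ^+ 2 * x i ^+ 2 - (2 * a * b) * (x i * y i) + a ^+ 2 * y i ^+ 2)).
      by rewrite big_split sumrB -!mulr_sumr/= -/a -/b -/c; ring.
    by move=> i _; ring.
  exact: sum_sqr_ge0.
have [az|az] := eqVneq a 0.
  have x0 i : x i = 0.
    have /psumr_eq0P : forall i, true -> 0 <= x i ^+ 2 by move=> j _; exact: sqr_ge0.
    by move=> /(_ az i isT) /eqP; rewrite sqrf_eq0 => /eqP.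
  rewrite /b big1 ?expr0n ?mulr_ge0 ?sum_sqr_ge0//=.
  by move=> i _; rewrite x0 mul0r.
by move: H; rewrite pmulr_rge0 ?lt_def ?az// subr_ge0.
Qed.

Lemma sqr_sum_le x : (\sum_(i < n) x i) ^+ 2 <= n%:R * \sum_(i < n) x i ^+ 2.
Proof.
have := cauchy_schwarz (fun=> 1) x.
rewrite (eq_bigr x) => [/le_trans->//|i _]; last by rewrite mul1r.
by rewrite (eq_bigr (fun=> 1)) ?sumr_const ?card_ord// => i _; rewrite expr1n.
Qed.

End cauchy_schwarz.

(** * Moments of the normal law *)

Section density.
Context d (T : measurableType d) (R : realType).
Variables (mu nu : {measure set T -> \bar R}) (p : T -> R).
Hypothesis mp : measurable_fun setT p.
Hypothesis p0 : forall x, 0 <= p x.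
Hypothesis nuE : forall V, measurable V -> nu V = (\int[mu]_(x in V) (p x)%:E)%E.

Let mpE : measurable_fun setT (EFin \o p).
Proof. exact/measurable_EFinP. Qed.

Import HBNNSimple.

Let density_nnsfun (f : {nnsfun T >-> R}) :
  (\int[nu]_x (f x)%:E = \int[mu]_x ((f x)%:E * (p x)%:E))%E.
Proof.
under [LHS]eq_integral do rewrite fimfunE -fsumEFin//.
rewrite [LHS]ge0_integral_fsum//; last 2 first.
  - by move=> r; exact/measurable_EFinP/measurableT_comp.
  - by move=> n x _; rewrite EFinM nnfun_muleindic_ge0.
under [RHS]eq_integral.
  move=> x xD; rewrite fimfunE -fsumEFin// ge0_mule_fsuml; last first.
    by move=> r; rewrite EFinM nnfun_muleindic_ge0.
  over.
rewrite [RHS]ge0_integral_fsum//; last 2 first.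
  - move=> r; apply: emeasurable_funM => //.
    by apply/measurable_EFinP; do 2 apply/measurableT_comp => //.
  - move=> n x _; rewrite mule_ge0//; last by rewrite lee_fin.
    by rewrite EFinM nnfun_muleindic_ge0.
apply: eq_fsbigr => r _.
have mr : measurable (f @^-1` [set r]) by exact: measurable_sfunP.
have [r0|r0] := leP 0 r; last first.
  have fr0 : f @^-1` [set r] = set0.
    rewrite -subset0 => x /= fxr.
    by have : 0 <= f x by []; rewrite fxr leNgt r0.
  rewrite fr0; under eq_integral do rewrite indic0 mulr0.
  under [RHS]eq_integral do rewrite indic0 mulr0 mul0e.
  by rewrite !integral0.
under eq_integral do rewrite EFinM.
under [RHS]eq_integral do rewrite EFinM -muleA.
have m1 : measurable_fun setT (EFin \o \1_(f @^-1` [set r]) : T -> \bar R).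
  exact/measurable_EFinP.
rewrite ge0_integralZl//.
rewrite ge0_integralZl//; last 2 first.
- exact: emeasurable_funM.
- by move=> x _; rewrite mule_ge0 ?lee_fin.
congr (_ * _)%E; rewrite integral_indic// setIT nuE// [LHS]integral_mkcond.
by apply: eq_integral => x _; rewrite patchE indicE; case: ifPn; rewrite ?mul1e ?mul0e.
Qed.

(** Monotone convergence along the same approximating simple functions on both sides reduces the
    claim to [density_nnsfun]. *)
Lemma ge0_integral_density (f : T -> \bar R) : measurable_fun setT f ->
  (forall x, 0 <= f x)%E ->
  (\int[nu]_x f x = \int[mu]_x (f x * (p x)%:E))%E.
Proof.
move=> mf f0.
pose f_ := nnsfun_approx measurableT mf.
transitivity (lim (\int[nu]_x (f_ n x)%:E @[n --> \oo])%E).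
  rewrite -monotone_convergence//=.
  - apply: eq_integral => ? /[!inE] xD; apply/esym/cvg_lim => //=.
    exact: cvg_nnsfun_approx.
  - by move=> n; exact/measurable_EFinP/measurable_funTS.
  - by move=> n ? _; rewrite lee_fin.
  - by move=> ? _ ? ? mn; rewrite lee_fin; exact/lefP/nd_nnsfun_approx.
transitivity (lim (\int[mu]_x ((f_ n x)%:E * (p x)%:E) @[n --> \oo])%E).
  by apply: congr_lim; apply/funext => n; exact: density_nnsfun.
rewrite -monotone_convergence//=.
- apply: eq_integral => x /[!inE] xD; apply/cvg_lim => //=.
  by apply: cvgeZr => //; exact: cvg_nnsfun_approx.
- by move=> n; apply: emeasurable_funM => //; exact/measurable_EFinP.
- by move=> n ? _; rewrite mule_ge0 ?lee_fin.
- by move=> x _ a b ab; apply: lee_wpmul2r; rewrite lee_fin//; exact/lefP/nd_nnsfun_approx.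
Qed.
End density.

Section normal_moments.
Context (R : realType).

(** Completing the square: [exp (l x)] times the centered density is a constant times the density
    centered at [l * s ^+ 2]. All the moments below are drawn from this formula. *)
Lemma normal_mgf (s l : R) : s != 0 ->
  (\int[normal_prob 0 s]_x (expR (l * x))%:E = (expR (l ^+ 2 * s ^+ 2 / 2))%:E)%E.
Proof.
move=> s0.
rewrite (@ge0_integral_density _ _ _ lebesgue_measure _ (normal_pdf 0 s))//.
- transitivity (\int[lebesgue_measure]_x
     ((expR (l ^+ 2 * s ^+ 2 / 2))%:E * (normal_pdf (l * s ^+ 2) s x)%:E))%E.
    apply: eq_integral => x _; rewrite -!EFinM; congr EFin.
    rewrite !normal_pdfE// mulrCA [RHS]mulrCA; congr (_ * _).
    rewrite /normal_fun -!expRD; congr expR; field; exact: s0.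
  rewrite ge0_integralZl//.
  + by rewrite integral_normal_pdf mule1.
  + apply/measurable_EFinP; exact: measurable_normal_pdf.
  + by move=> x _; rewrite lee_fin normal_pdf_ge0.
- exact: measurable_normal_pdf.
- by move=> x; rewrite normal_pdf_ge0.
- apply/measurable_EFinP; apply: measurableT_comp => //; exact: measurable_funM.
Qed.

Lemma cosh_ge (y : R) (k : nat) :
  `|y| ^+ k.+1 / k.+1`!%:R + 1 <= expR y + expR (- y).
Proof.
have h : `|y| ^+ k.+1 / k.+1`!%:R + 1 <= expR `|y| by rewrite addrC expR_ge1Dxn.
apply: (le_trans h); have [y0|y0] := leP 0 y.
  by rewrite (ger0_norm y0) lerDl expR_ge0.
by rewrite (ltr0_norm y0) lerDr expR_ge0.
Qed.

(** With [a = exp (z / 2)] and [z >= 0], the left side is half the square of [a - a^-1], and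
    [a - a^-1 = a (1 - exp (- z)) <= a z]. *)
Lemma cosh_le (z : R) : (expR z + expR (- z)) / 2 - 1 <= z ^+ 2 / 2 * expR `|z|.
Proof.
wlog z0 : z / 0 <= z.
  move=> H; have [z0|z0] := leP 0 z; first exact: H.
  have := H (- z); rewrite normrN sqrrN opprK oppr_ge0 => /(_ (ltW z0)); lra.
rewrite ger0_norm//.
pose a := expR (z / 2).
have a0 : 0 < a by exact: expR_gt0.
have ea : expR z = a ^+ 2 by rewrite -expRM_natl; congr expR; field.
have eb : expR (- z) = a ^- 2 by rewrite expRN ea.
have h1 : a ^- 2 >= 1 - z by rewrite -eb; exact: expR_ge1Dx.
have h2 : a - a^-1 <= a * z.
  have -> : a - a^-1 = a * (1 - a ^- 2) by field; lra.
  by rewrite ler_pM2l//; lra.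
have h3 : 0 <= a - a^-1.
  have a1 : 1 <= a by rewrite -expR0 ler_expR; lra.
  by rewrite subr_ge0 (le_trans _ a1)// invf_le1.
have h4 : (a - a^-1) ^+ 2 <= (a * z) ^+ 2 by rewrite lerXn2r// nnegrE// (le_trans h3).
rewrite ea eb; have <- : (a - a^-1) ^+ 2 / 2 = (a ^+ 2 + a ^- 2) / 2 - 1 by field; lra.
have -> : z ^+ 2 / 2 * a ^+ 2 = (a * z) ^+ 2 / 2 by field.
by rewrite ler_pM2r.
Qed.

Lemma expRB1_le (y : R) : 0 <= y -> expR y - 1 <= y * expR y.
Proof.
move=> y0; have h : 1 - y <= expR (- y) by exact: expR_ge1Dx.
have : (1 - y) * expR y <= 1.
  by rewrite -[leRHS](expRxMexpNx_1 y) mulrC ler_pM2l// expR_gt0.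
by lra.
Qed.

(** Replaces differentiation under the integral sign: the moments are read off from inequalities
    between exponential moments of order l, as l tends to 0. *)
Lemma le_of_small (a b C : R) : (forall l, 0 < l -> l <= 1 -> a <= b + l * C) -> a <= b.
Proof.
move=> H; apply/ler_addgt0Pr => e e0.
have C0 : 0 < `|C| + 1 by rewrite ltr_wpDl.
pose l := Num.min 1 (e / (`|C| + 1)).
have l0 : 0 < l by rewrite lt_min ltr01 divr_gt0.
have l1 : l <= 1 by rewrite ge_min lexx.
apply: (le_trans (H l l0 l1)); rewrite lerD2l.
apply: (@le_trans _ _ (l * (`|C| + 1))).
  by rewrite ler_pM2l// (le_trans (ler_norm _))// lerDl.
by rewrite -ler_pdivlMr// ge_min lexx orbT.
Qed.

Variable s : R.
Hypothesis s0 : s != 0.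
Local Notation nu := (normal_prob 0 s).

Let var2_ge0 (l : R) : 0 <= l ^+ 2 * s ^+ 2 / 2.
Proof. have := mulr_ge0 (sqr_ge0 l) (sqr_ge0 s); lra. Qed.

Lemma integrable_normal_expR (l : R) : nu.-integrable setT (fun x => (expR (l * x))%:E).
Proof.
apply/integrableP; split.
  by apply/measurable_EFinP; apply: measurableT_comp => //; exact: measurable_funM.
under eq_integral do rewrite gee0_abs ?lee_fin ?expR_ge0//.
by rewrite normal_mgf// ltry.
Qed.

Lemma Rintegral_normal_expR (l : R) :
  \int[nu]_x (expR (l * x)) = expR (l ^+ 2 * s ^+ 2 / 2).
Proof. by rewrite /Rintegral normal_mgf. Qed.

Lemma integrable_normal_exp2 (l : R) : nu.-integrable setT
  (EFin \o (fun x => expR (l * x) + expR (- (l * x)))).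
Proof.
have -> : (EFin \o (fun x => expR (l * x) + expR (- (l * x)))) =
    (fun x => (expR (l * x))%:E + (expR ((- l) * x))%:E)%E.
  by apply/funext => x /=; rewrite EFinD mulNr.
by apply: integrableD => //; exact: integrable_normal_expR.
Qed.

Lemma Rintegral_normal_exp2 (l : R) :
  \int[nu]_x (expR (l * x) + expR (- (l * x))) = 2 * expR (l ^+ 2 * s ^+ 2 / 2).
Proof.
under eq_Rintegral do rewrite -mulNr.
rewrite RintegralD//; try exact: integrable_normal_expR.
by rewrite !Rintegral_normal_expR sqrrN; ring.
Qed.

Lemma integrable_normalX (k : nat) : nu.-integrable setT (fun x => (x ^+ k)%:E).
Proof.
case: k => [|k].
  by apply: (@eq_integrable _ _ _ _ _ _ (EFin \o cst 1)) => //; exact: finite_measure_integrable_cst.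
have ie := integrableZl measurableT ((k.+1)`!%:R) (integrable_normal_exp2 1).
apply: (le_integrable measurableT _ _ ie) => //.
- by apply/measurable_EFinP; exact: exprn_measurable.
- move=> x _; rewrite /= lee_fin normrX mul1r.
  rewrite [leRHS]ger0_norm; last by rewrite mulr_ge0// addr_ge0 ?expR_ge0.
  rewrite mulrC -ler_pdivrMr ?ltr0n ?fact_gt0//.
  by apply: le_trans (cosh_ge x k); rewrite lerDl.
Qed.

(** Integrating [1 + l x <= exp (l x)] bounds l times the mean by a quantity of order [l ^+ 2]; both
    signs of l are used. *)
Lemma Rintegral_normal_id : \int[nu]_x x = 0.
Proof.
have ix : nu.-integrable setT (EFin \o (fun x => x)).
  exact: (integrable_normalX 1).
have i1 : nu.-integrable setT (EFin \o cst 1) by exact: finite_measure_integrable_cst.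
have H l : l * (\int[nu]_x x) <= l ^+ 2 * s ^+ 2 / 2 * expR (l ^+ 2 * s ^+ 2 / 2).
  apply: le_trans (expRB1_le (var2_ge0 l)).
  rewrite -Rintegral_normal_expR lerBrDr -RintegralZl//.
  have -> : 1 = \int[nu]_x (cst 1 x) :> R.
    by rewrite Rintegral_cst// mul1r [X in fine X]probability_setT.
  rewrite -RintegralD//; last by apply: (integrableZl _ _ ix).
  apply: le_Rintegral => //.
  - by apply: integrableD_EFin => //; exact: integrableZ_EFin.
  - exact: integrable_normal_expR.
  - by move=> x _; rewrite addrC expR_ge1Dx.
have H2 (e l : R) : `|e| = 1 -> 0 < l -> l <= 1 ->
    e * (\int[nu]_x x) <= 0 + l * (s ^+ 2 / 2 * expR (s ^+ 2 / 2)).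
  move=> e1 l0 l1; have := H (e * l).
  have -> : (e * l) ^+ 2 = l ^+ 2 by rewrite exprMn -(real_normK (num_real e)) e1 expr1n mul1r.
  rewrite mulrAC mulrC -ler_pdivlMl// add0r => /le_trans; apply.
  have -> : l^-1 * (l ^+ 2 * s ^+ 2 / 2 * expR (l ^+ 2 * s ^+ 2 / 2)) =
     l * (s ^+ 2 / 2 * expR (l ^+ 2 * s ^+ 2 / 2)) by field; rewrite gt_eqF.
  rewrite ler_pM2l// ler_wpM2l ?divr_ge0 ?sqr_ge0// ler_expR.
  rewrite ler_pM2r// ler_piMl ?sqr_ge0// expr_le1// ltW//.
apply/eqP; rewrite eq_le; apply/andP; split.
  by rewrite -[leLHS]mul1r; apply: le_of_small => l; apply: H2; rewrite normr1.
rewrite -oppr_le0 -mulN1r; apply: le_of_small => l; apply: H2; by rewrite normrN1.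
Qed.

(** For [z >= 0], [exp z + exp (- z) - 2] equals [exp (- z) (exp z - 1)^2], which is at least
    [(1 - z) z^2]. *)
Lemma cosh_ge_sqr (z : R) : z ^+ 2 <= expR z + expR (- z) - 2 + `|z| ^+ 3.
Proof.
wlog z0 : z / 0 <= z.
  move=> H; have [z0|z0] := leP 0 z; first exact: H.
  have := H (- z); rewrite normrN sqrrN opprK oppr_ge0 => /(_ (ltW z0)); lra.
rewrite ger0_norm//.
have h1 : expR z - 1 >= z by rewrite lerBrDl; exact: expR_ge1Dx.
have h2 : 1 - z <= expR (- z) by exact: expR_ge1Dx.
have e0 : 0 < expR z by exact: expR_gt0.
have -> : expR z + expR (- z) - 2 = expR (- z) * (expR z - 1) ^+ 2.
  by rewrite expRN; field; rewrite gt_eqF.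
have : (expR z - 1) ^+ 2 >= z ^+ 2 by rewrite lerXn2r// nnegrE (le_trans z0).
have f0 : 0 < expR (- z) by exact: expR_gt0.
set E := expR (- z) in h2 f0 *; set F := (expR z - 1) ^+ 2; move=> zF.
have : z ^+ 2 * E <= F * E by rewrite ler_pM2r.
have : z ^+ 2 * (1 - z) <= z ^+ 2 * E by rewrite ler_wpM2l// sqr_ge0.
lra.
Qed.

(** For [0 < l <= 1], [(l x)^2] agrees with [exp (l x) + exp (- l x) - 2] up to a cubic error whose
    mean is of order [l ^+ 3]; dividing by [l ^+ 2] and letting l tend to 0 leaves [s ^+ 2]. *)
Lemma Rintegral_normal_sqr : \int[nu]_x (x ^+ 2) = s ^+ 2.
Proof.
have ix := integrable_normalX 2.
have i1 r : nu.-integrable setT (EFin \o cst r) by exact: finite_measure_integrable_cst.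
have c1 r : \int[nu]_x (cst r x) = r :> R.
  by rewrite Rintegral_cst// [X in fine X]probability_setT mulr1.
have ie := integrable_normal_exp2.
apply/eqP; rewrite eq_le; apply/andP; split.
- pose E := expR (s ^+ 2 / 2).
  (* [12 * E] bounds the mean of [6 (exp x + exp (- x))], which dominates the cubic error; the other
     term is what [exp y - 1] leaves after [y]. *)
  apply: (@le_of_small _ _ (s ^+ 2 * (s ^+ 2 / 2 * E) + 12 * E)) => /= l l0 l1.
  set y := l ^+ 2 * s ^+ 2 / 2.
  have y0 : 0 <= y := var2_ge0 l.
  have yl : y <= l * (s ^+ 2 / 2).
    rewrite /y -mulrA ler_wpM2r ?divr_ge0 ?sqr_ge0//.
    by rewrite expr2 ler_piMl// ltW.
  have ys : y <= s ^+ 2 / 2.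
    by apply: (le_trans yl); rewrite ler_piMl// divr_ge0 ?sqr_ge0.
  have eyE : expR y <= E by rewrite ler_expR.
  have H : l ^+ 2 * \int[nu]_x (x ^+ 2) + 2 <= 2 * expR y + (6 * l ^+ 3) * (2 * E).
    have -> : E = expR (1 ^+ 2 * s ^+ 2 / 2) by rewrite expr1n mul1r.
    rewrite -!Rintegral_normal_exp2 -!RintegralZl// -[X in _ + X <= _](c1 2) -!RintegralD//;
      [|exact: integrableZ_EFin..].
    apply: le_Rintegral => //; [by apply: integrableD_EFin => //; exact: integrableZ_EFin|by apply: integrableD_EFin => //; exact: integrableZ_EFin|].
    move=> x _ /=; rewrite -exprMn.
    have := cosh_ge_sqr (l * x); have := cosh_ge x 2.
    rewrite mul1r (_ : 3`!%:R = 6%:R :> R)// => h3.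
    have : `|l * x| ^+ 3 <= 6 * l ^+ 3 * (expR x + expR (- x)).
      have l3 : 0 < l ^+ 3 by rewrite exprn_gt0.
      rewrite normrM (gtr0_norm l0) exprMn.
      have : l ^+ 3 * `|x| ^+ 3 <= l ^+ 3 * (6 * (expR x + expR (- x))).
        by rewrite ler_pM2l//; lra.
      lra.
    lra.
  have l20 : 0 < l ^+ 2 by rewrite exprn_gt0.
  rewrite -(ler_pM2l l20).
  have h5 := expRB1_le y0.
  have h6 : y * expR y <= l ^+ 2 * s ^+ 2 / 2 + l ^+ 3 * (s ^+ 2 / 2 * (s ^+ 2 / 2 * E)).
    have : y * (1 + y * expR y) <= y * (1 + l * (s ^+ 2 / 2) * E).
      by rewrite ler_wpM2l// lerD2l ler_pM// expR_ge0.
    have : y * expR y <= y * (1 + y * expR y).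
      by rewrite ler_wpM2l// -lerBlDl.
    have -> : y * (1 + l * (s ^+ 2 / 2) * E) = y + l ^+ 3 * (s ^+ 2 / 2 * (s ^+ 2 / 2 * E)).
      by rewrite /y; ring.
    by rewrite -/y; lra.
  have -> : l ^+ 2 * (s ^+ 2 + l * (s ^+ 2 * (s ^+ 2 / 2 * E) + 12 * E)) =
    l ^+ 2 * s ^+ 2 + 2 * (l ^+ 3 * (s ^+ 2 / 2 * (s ^+ 2 / 2 * E))) + 6 * l ^+ 3 * (2 * E).
    by field.
  lra.
(* The error is now [|x|^3 exp |l x|], which is at most [6 exp (2 |x|)]: hence the exponential
   moment of order 2. *)
- pose E := expR (2 ^+ 2 * s ^+ 2 / 2).
  apply: (@le_of_small _ _ (12 * E)) => /= l l0 l1.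
  set y := l ^+ 2 * s ^+ 2 / 2.
  have H : 2^-1 * (2 * expR y) <= 2^-1 * l ^+ 2 * \int[nu]_x (x ^+ 2) + 1
     + 3 * l ^+ 3 * (2 * E).
    rewrite -!Rintegral_normal_exp2 -!RintegralZl// -[X in _ + X + _](c1 1) -!RintegralD//;
      try exact: integrableZ_EFin; last by apply: integrableD_EFin => //; exact: integrableZ_EFin.
    apply: le_Rintegral => //; [exact: integrableZ_EFin|
       by apply: integrableD_EFin => //; [apply: integrableD_EFin => //; exact: integrableZ_EFin|exact: integrableZ_EFin]|].
    move=> x _ /=.
    have h1 := cosh_le (l * x).
    have h2 : expR `|l * x| - 1 <= `|l * x| * expR `|l * x| by exact: expRB1_le.
    have h3 : `|x| ^+ 3 * expR `|l * x| <= 6 * (expR (2 * x) + expR (- (2 * x))).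
      have e1 : expR `|l * x| <= expR `|x|.
        by rewrite ler_expR normrM (gtr0_norm l0) ler_piMl.
      have e2 : `|x| ^+ 3 / 6 + 1 <= expR `|x| by rewrite addrC (expR_ge1Dxn 2).
      have e3 : expR `|x| * expR `|x| <= expR (2 * x) + expR (- (2 * x)).
        have -> : expR `|x| * expR `|x| = expR (2 * `|x|).
          by rewrite -expRD; congr expR; ring.
        have [x0|x0] := leP 0 x.
          by rewrite (ger0_norm x0) lerDl expR_ge0.
        by rewrite (ltr0_norm x0) -mulrN lerDr expR_ge0.
      have a0 := expR_gt0 `|x|.
      apply: (@le_trans _ _ (6 * (expR `|x| * expR `|x|))); last by rewrite ler_pM2l.
      rewrite mulrA ler_pM ?expR_ge0 ?exprn_ge0//; lra.
    have h4 : (l * x) ^+ 2 / 2 * expR `|l * x| <= (l * x) ^+ 2 / 2 + l ^+ 3 / 2 * (`|x| ^+ 3 * expR `|l * x|).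
      have -> : l ^+ 3 / 2 * (`|x| ^+ 3 * expR `|l * x|) = (l * x) ^+ 2 / 2 * (`|l * x| * expR `|l * x|).
        rewrite normrM (gtr0_norm l0) !exprMn -(real_normK (num_real x)); ring.
      rewrite -{2}[_ / 2]mulr1 -mulrDr ler_wpM2l ?divr_ge0 ?sqr_ge0//.
      by rewrite -lerBlDl.
    have h5 : l ^+ 3 / 2 * (`|x| ^+ 3 * expR `|l * x|) <= l ^+ 3 / 2 * (6 * (expR (2 * x) + expR (- (2 * x)))).
      by rewrite ler_wpM2l// divr_ge0 ?exprn_ge0// ltW.
    by rewrite exprMn in h1 h4; lra.
  have l20 : 0 < l ^+ 2 by rewrite exprn_gt0.
  have h2 : 1 + y <= expR y by exact: expR_ge1Dx.
  rewrite -(ler_pM2l l20).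
  have -> : l ^+ 2 * s ^+ 2 = 2 * y by rewrite /y; field.
  have -> : l ^+ 2 * (\int[nu]_x (x ^+ 2) + l * (12 * E)) =
    2 * (2^-1 * l ^+ 2 * \int[nu]_x (x ^+ 2) + 3 * l ^+ 3 * (2 * E)) by field.
  lra.
Qed.

(** Choosing the order [l = s^-1] makes the exponential bound scale like [s ^+ 4]; 24 is [4!] and
    [2 exp (1/2)] is the resulting exponential moment. *)
Lemma Rintegral_normal4_le : \int[nu]_x (x ^+ 4) <= 48 * expR 2^-1 * s ^+ 4.
Proof.
have e4 : 48 * expR 2^-1 * s ^+ 4 = (24 * s ^+ 4) * (2 * expR (s^-1 ^+ 2 * s ^+ 2 / 2)).
  by rewrite exprVn mulVf ?expf_neq0// mul1r; ring.
rewrite e4 -Rintegral_normal_exp2 -RintegralZl//; last exact: integrable_normal_exp2.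
apply: le_Rintegral => //.
- exact: integrable_normalX.
- by apply: (integrableZl _ _ (integrable_normal_exp2 _)).
- move=> x _ /=; have := cosh_ge (s^-1 * x) 3; rewrite (_ : 4`!%:R = 24%:R :> R)//.
  have e0 : 0 < s ^+ 4 by rewrite exprn_even_gt0.
  rewrite -normrX ger0_norm ?exprn_even_ge0//.
  have -> : x ^+ 4 = s ^+ 4 * (s^-1 * x) ^+ 4 by field.
  set a := _ ^+ 4; set b := _ + expR _ => h.
  have : s ^+ 4 * a <= s ^+ 4 * (24 * b) by rewrite ler_pM2l//; lra.
  lra.
Qed.

End normal_moments.

(** * Brownian increments *)

Section independence.
Context d (T : measurableType d) (R : realType) (P : probability T R).

(** Independence identifies the law of the pair with the product of the laws; Tonelli then gives
    integrability and Fubini the value. *)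
Lemma independent_expectationM (X Y : T -> R) :
  measurable_fun setT X -> measurable_fun setT Y ->
  (forall A C, measurable A -> measurable C ->
    P (X @^-1` A `&` Y @^-1` C) = (P (X @^-1` A) * P (Y @^-1` C))%E) ->
  P.-integrable setT (EFin \o X) -> P.-integrable setT (EFin \o Y) ->
  P.-integrable setT (EFin \o (fun w => X w * Y w)) /\
  \int[P]_w (X w * Y w) = (\int[P]_w X w) * (\int[P]_w Y w).
Proof.
move=> mX mY XY iX iY.
pose X' : {mfun T >-> R} := HB.pack X (isMeasurableFun.Build _ _ _ _ _ mX).
pose Y' : {mfun T >-> R} := HB.pack Y (isMeasurableFun.Build _ _ _ _ _ mY).
have mXY : measurable_fun setT (fun w => (X w, Y w)) by exact: measurable_fun_pair.
pose Z : {mfun T >-> (R * R)%type} := HB.pack (fun w => (X w, Y w)) (isMeasurableFun.Build _ _ _ _ _ mXY).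
pose X'' : {RV P >-> R} := X'. pose Y'' : {RV P >-> R} := Y'.
pose Z'' : {RV P >-> (R * R)%type} := Z.
have lawE D : measurable D ->
  (distribution P X' \x distribution P Y')%E D = distribution P Z D.
  by move=> mD; apply: product_measure_unique => // A B mA mB; exact: XY.
pose f (q : R * R) : R := q.1 * q.2.
have mf : measurable_fun setT (EFin \o f).
  apply/measurable_EFinP.
  by apply: measurable_funM; [exact: measurable_fst|exact: measurable_snd].
have mfa : measurable_fun setT (abse \o (EFin \o f)) by exact: measurableT_comp.
have mE : measurable_fun [set: R] (@EFin R) by exact/measurable_EFinP.
have mabs : measurable_fun [set: R] (abse \o @EFin R) by exact: measurableT_comp.
have eX : (\int[distribution P X']_x `|x%:E| = \int[P]_w `|(X w)%:E|)%E.
  exact: (ge0_integral_distribution X'' mabs (fun y => abse_ge0 _)).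
have eY : (\int[distribution P Y']_x `|x%:E| = \int[P]_w `|(Y w)%:E|)%E.
  exact: (ge0_integral_distribution Y'' mabs (fun y => abse_ge0 _)).
have [/measurable_EFinP _ fX] := integrableP _ _ _ iX.
have [/measurable_EFinP _ fY] := integrableP _ _ _ iY.
have IXY : P.-integrable setT (EFin \o (fun w => X w * Y w)).
  apply/integrableP; split; first by apply/measurable_EFinP; exact: measurable_funM.
  have -> : (\int[P]_w `|(EFin \o (fun w => X w * Y w)%R) w| = \int[distribution P Z]_q (abse \o (EFin \o f)) q)%E.
    exact/esym/(ge0_integral_distribution Z'' mfa (fun y => abse_ge0 _)).
  rewrite (eq_measure_integral (distribution P X' \x distribution P Y')%E); last first.
    by move=> A mA _; exact/esym/lawE.
  rewrite fubini_tonelli1//; last by move=> x; exact: abse_ge0.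
  rewrite /fubini_F.
  have -> : (\int[distribution P X']_x \int[distribution P Y']_y (abse \o (EFin \o f)) (x, y) =
     \int[distribution P X']_x (`|x%:E| * \int[P]_w `|(Y w)%:E|))%E.
    apply: eq_integral => x _; rewrite -eY -ge0_integralZl//=.
      by apply: eq_integral => y _; rewrite /f /= normrM EFinM.
  rewrite ge0_integralZr//; last exact: integral_ge0.
  rewrite eX lte_mul_pinfty//; first exact: integral_ge0.
  by rewrite ge0_fin_numE//; exact: integral_ge0.
split=> //.
have iZ : (distribution P Z).-integrable setT (EFin \o f).
  by apply: integrable_pushforward.
have iZ' : (distribution P X' \x distribution P Y')%E.-integrable setT (EFin \o f).
  apply/integrableP; split => //.
  rewrite (eq_measure_integral (distribution P Z)); first by have [] := integrableP _ _ _ iZ.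
  by move=> A mA _; exact: lawE.
have jX : (distribution P X').-integrable setT EFin.
  by apply: integrable_pushforward.
have jY : (distribution P Y').-integrable setT EFin.
  by apply: integrable_pushforward.
have EX : (\int[P]_w (X w)%:E = \int[distribution P X']_x x%:E)%E.
  by rewrite (integral_distribution (X := X'')).
have EY : (\int[P]_w (Y w)%:E = \int[distribution P Y']_x x%:E)%E.
  by rewrite (integral_distribution (X := Y'')).
have fEY : (\int[distribution P Y']_x x%:E)%E \is a fin_num by exact: integrable_fin_num.
have fEX : (\int[distribution P X']_x x%:E)%E \is a fin_num by exact: integrable_fin_num.
rewrite /Rintegral EX EY -fineM//; congr fine.
transitivity (\int[distribution P Z]_q (EFin \o f) q)%E.
  by rewrite (integral_distribution (X := Z'')).
rewrite (eq_measure_integral (distribution P X' \x distribution P Y')%E); last first.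
  by move=> A mA _; exact/esym/lawE.
rewrite -integral12_prod_meas1// /fubini_F.
transitivity (\int[distribution P X']_x (x%:E * \int[distribution P Y']_y y%:E))%E.
  apply: eq_integral => x _; rewrite -integralZl//.
by rewrite -{1}(fineK fEY) integralZr// fineK.
Qed.

End independence.

Section sigma_algebra_facts.
Context d (T : measurableType d) (R : realType) (P : probability T R).

Lemma negligible_diff_eq (A A' : set T) : measurable A -> measurable A' ->
  P.-negligible ((A `\` A') `|` (A' `\` A)) -> P A = P A'.
Proof.
move=> mA mA' N.
have n1 : P (A `\` A') = 0%E.
  by apply: measure_negligible; [exact: measurableD|apply: negligibleS N; exact: subsetUl].
have n2 : P (A' `\` A) = 0%E.
  by apply: measure_negligible; [exact: measurableD|apply: negligibleS N; exact: subsetUr].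
have e1 := measureDI P mA mA'; have e2 := measureDI P mA' mA.
rewrite e1 e2; congr (_ + _)%E; last by rewrite setIC.
by transitivity (0%E : \bar R).
Qed.

(** The sets that differ from a set of [<<s G >>] by a negligible set form a sigma-algebra. This
    carries independence, postulated for the raw past only, over to the completed filtration. *)
Lemma sigma_algebra_negligibleU (G : set (set T)) A :
  <<s G `|` P.-negligible >> A ->
  exists2 A', <<s G >> A' & P.-negligible ((A `\` A') `|` (A' `\` A)).
Proof.
pose S := [set A | exists2 A', <<s G >> A' & P.-negligible ((A `\` A') `|` (A' `\` A))].
suff sub : <<s G `|` P.-negligible >> `<=` S by move=> /sub.
apply: smallest_sub; last first.
  move=> X [GX|NX]; first by exists X; [exact: sub_sigma_algebra|rewrite !setDv setU0; exact: negligible_set0].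
  exists set0; first by have [] := smallest_sigma_algebra setT G.
  by rewrite setD0 set0D setU0.
have [s0 sC sU] := smallest_sigma_algebra setT G.
split.
- by exists set0 => //; rewrite !setDv setU0; exact: negligible_set0.
- move=> X [X' GX' N]; exists (setT `\` X'); first exact: sC.
  apply: negligibleS N => w; rewrite /= => -[[[_ h1] h2]|[[_ h1] h2]].
    by right; split => //; apply: contrapT => h3; apply: h2; split.
  by left; split => //; apply: contrapT => h3; apply: h2; split.
- move=> F SF.
  have /choice [F' HF'] : forall k, exists A', <<s G >> A' /\ P.-negligible ((F k `\` A') `|` (A' `\` F k)).
    by move=> k; have [A' h1 h2] := SF k; exists A'.
  exists (\bigcup_k F' k); first by apply: sU => k; have [] := HF' k.
  apply: (negligibleS _ (negligible_bigcup (fun k => (HF' k).2))) => w.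
  move=> -[[[k _ Fk] nF]|[[k _ Fk] nF]]; exists k => //.
    by left; split => // h; apply: nF; exists k.
  by right; split => // h; apply: nF; exists k.
Qed.

(** [D |-> P (A]&[D)] and [D |-> P A * P D] are finite measures that agree on a pi-system containing
    [setT]. *)
Lemma independent_generated (A : set T) (G : set (set T)) :
  measurable A -> G `<=` measurable -> setI_closed G -> G setT ->
  (forall D, G D -> P (A `&` D) = (P A * P D)%E) ->
  forall D, <<s G >> D -> P (A `&` D) = (P A * P D)%E.
Proof.
move=> mA Gm GI GT H D GD.
have fA : 0 <= fine (P A) by rewrite fine_ge0.
pose m1 := mrestr P mA.
pose m2 := mscale (NngNum fA) P.
have m12 D' : G D' -> m1 D' = m2 D'.
  by move=> GD'; rewrite /m1 /m2 /mrestr /mscale/= setIC H// fineK// fin_num_measure.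
suff : m1 D = m2 D by rewrite /m1 /m2 /mrestr /mscale/= setIC fineK// fin_num_measure.
apply: (g_sigma_algebra_measure_unique G Gm (fun=> setT)) => //.
  by rewrite -subTset => w _; exists 0%N.
by move=> _; change (P (setT `&` A) < +oo)%E; rewrite -ge0_fin_numE// fin_num_measure//; exact: measurableI.
Qed.

End sigma_algebra_facts.

Section brownian_increments.
Context (R : realType) (T : R) (n : nat) d (Omega : measurableType d).
Context (P : probability Omega R) (B : R -> Omega -> 'rV[R]_n).
Hypotheses (cP : measure_is_complete P) (hB : brownian_motion P T B).
Local Notation F t := (<<s brownian_gen P B t >>).
Local Notation adapted t X := (adapted_at (brownian_gen P B) t X).

Lemma past_le s t : s <= t -> past B s `<=` past B t.
Proof.
move=> st A [r [i [C [rs mC ->]]]]; exists r, i, C; split => //.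
by move: rs; rewrite !in_itv/= => /andP[-> /le_trans]; apply.
Qed.

Lemma past_measurable t : t <= T -> past B t `<=` measurable.
Proof.
move=> tT A [r [i [C [rs mC ->]]]].
have [mB _ _ _] := hB.
have := mB r i; rewrite in_itv/=; move: rs; rewrite in_itv/= => /andP[-> rt].
by rewrite (le_trans rt tT)// => /(_ isT measurableT _ mC); rewrite setTI.
Qed.

(** Completeness of [P] enters here: it makes the negligible generators measurable. *)
Lemma brownian_sigma_measurable t : t <= T -> F t `<=` measurable.
Proof.
move=> tT; apply: smallest_sub; first exact: sigma_algebra_measurable.
by move=> A [/past_measurable|/cP]//; exact.
Qed.

Lemma brownian_sigma_le s t : s <= t -> F s `<=` F t.
Proof.
move=> st; apply: sub_smallest2r; first exact: smallest_sigma_algebra.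
by move=> A [/(past_le st)|]; [left|right].
Qed.

Lemma adapted_preimage t X C : adapted t X -> measurable C -> F t (X @^-1` C).
Proof. by move=> /(_ measurableT C) aX /aX; rewrite setTI. Qed.

Lemma adaptedP t X : (forall C, measurable C -> F t (X @^-1` C)) -> adapted t X.
Proof. by move=> H _ C mC; rewrite setTI; exact: H. Qed.

Lemma adapted_measurable t X : t <= T -> adapted t X -> measurable_fun setT X.
Proof.
move=> tT aX _ C mC; rewrite setTI.
exact: (brownian_sigma_measurable tT (adapted_preimage aX mC)).
Qed.

Lemma adapted_le s t X : s <= t -> adapted s X -> adapted t X.
Proof.
move=> st aX; apply: adaptedP => C mC.
exact: (brownian_sigma_le st (adapted_preimage aX mC)).
Qed.

Lemma adapted_brownian s t i : 0 <= s -> s <= t -> adapted t (fun w => B s w ord0 i).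
Proof.
move=> s0 st; apply: adaptedP => C mC; apply: sub_sigma_algebra; left.
by exists s, i, C; split => //; rewrite in_itv/= s0.
Qed.

Definition increment s t i w := B t w ord0 i - B s w ord0 i.

(** A pi-system generating the sigma-algebra of the vector of increments; rectangles are the events
    on which [brownian_motion] speaks. *)
Definition increment_rect s t : set (set Omega) :=
  [set D | exists2 C : 'I_n -> set R, (forall i, measurable (C i)) &
     D = [set w | forall i, C i (increment s t i w)]].

Section one_increment.
Variables s t : R.
Hypotheses (s0 : 0 <= s) (st : s < t) (tT : t <= T).
Local Notation W := (increment s t).

Lemma measurable_increment i : measurable_fun setT (W i).
Proof.
have [mB _ _ _] := hB.
apply: measurable_funB; apply: mB; rewrite in_itv/=.
  by rewrite tT andbT (le_trans s0)// ltW.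
by rewrite s0 (le_trans (ltW st)).
Qed.

Lemma increment_rect_measurable : increment_rect s t `<=` measurable.
Proof.
move=> D [C mC ->].
have -> : [set w | forall i, C i (W i w)] = \bigcap_(i in [set: 'I_n]) (W i @^-1` C i).
  by apply/seteqP; split => w /= h i => [_|]; exact: h.
apply: fin_bigcap_measurable => // i _.
by have := measurable_increment i measurableT (mC i); rewrite setTI.
Qed.

Lemma increment_rectI : setI_closed (increment_rect s t).
Proof.
move=> _ _ [C mC ->] [C' mC' ->]; exists (fun i => C i `&` C' i).
  by move=> i; exact: measurableI.
apply/seteqP; split => w /=; first by move=> [h h'] i; split.
by move=> h; split => i; have [] := h i.
Qed.

(** [D] is reduced to a rectangle by the pi-system argument, [A] to an event of the raw past up to a
    negligible set. *)
Lemma increment_independent_of A D : F s A -> <<s increment_rect s t >> D ->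
  P (A `&` D) = (P A * P D)%E.
Proof.
have sT : s <= T by exact: le_trans (ltW st) tT.
move=> FA; have mA := brownian_sigma_measurable sT FA.
move: D; apply: independent_generated => //.
- exact: increment_rect_measurable.
- exact: increment_rectI.
- by exists (fun=> setT) => //; apply/seteqP; split.
move=> D rD; have mD := increment_rect_measurable rD.
have [A' FA' N] := sigma_algebra_negligibleU FA.
have mA' : measurable A'.
  apply: (smallest_sub _ (past_measurable sT) FA').
  exact: sigma_algebra_measurable.
have [_ _ _ indep] := hB.
have [C mC ->] := rD.
rewrite (negligible_diff_eq mA mA' N).
transitivity (P (A' `&` [set w | forall i, C i (W i w)])).
  apply: negligible_diff_eq; rewrite -?D; try exact: measurableI.
    by apply: measurableI => //; apply: increment_rect_measurable; exists C.
    by apply: measurableI => //; apply: increment_rect_measurable; exists C.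
  apply: negligibleS N => w /= [[[h1 h2] h3]|[[h1 h2] h3]].
    by left; split => // h; apply: h3.
  by right; split => // h; apply: h3.
rewrite (indep s t s0 st tT A' FA' C mC); congr (_ * _)%E.
(* With the whole space as past event, the same clause says that the product of normal probabilities
   is the probability of the rectangle. *)
have := indep s t s0 st tT setT _ C mC.
rewrite setTI probability_setT mul1e => ->//.
exact: (@measurableT _ (g_sigma_algebraType (past B s))).
Qed.

Lemma increment_law i C : measurable C ->
  P (W i @^-1` C) = normal_prob 0 (Num.sqrt (t - s)) C.
Proof.
move=> mC; have [_ _ _ indep] := hB.
have := indep s t s0 st tT setT _ (fun j => if j == i then C else setT).
rewrite setTI probability_setT mul1e (bigD1 i)//= eqxx big1 ?mule1; last first.
  by move=> j /negbTE ->; rewrite [LHS]probability_setT.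
move=> <-.
- congr (P _); apply/seteqP; split => w /=.
    by move=> h j; case: eqP => [->|].
  by move=> /(_ i); rewrite eqxx.
- exact: (@measurableT _ (g_sigma_algebraType (past B s))).
- by move=> j; case: eqP.
Qed.

Lemma increment_indep i j C C' : i != j -> measurable C -> measurable C' ->
  P (W i @^-1` C `&` W j @^-1` C') = (P (W i @^-1` C) * P (W j @^-1` C'))%E.
Proof.
move=> ij mC mC'; have [_ _ _ indep] := hB.
rewrite !increment_law//.
have := indep s t s0 st tT setT _ (fun k => if k == i then C else if k == j then C' else setT).
rewrite setTI probability_setT mul1e (bigD1 i)//= eqxx (bigD1 j)/=; last by rewrite eq_sym.
rewrite eq_sym (negbTE ij) eqxx big1 ?mule1; last first.
  by move=> k /andP[/negbTE -> /negbTE ->]; rewrite [LHS]probability_setT.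
move=> <-.
- congr (P _); apply/seteqP; split => w /=.
    by move=> [h h'] k; case: eqP => [->//|_]; case: eqP => [->|].
  by move=> h; split; [have := h i; rewrite eqxx|have := h j; rewrite eq_sym (negbTE ij) eqxx].
- exact: (@measurableT _ (g_sigma_algebraType (past B s))).
- by move=> k; case: eqP => // _; case: eqP.
Qed.

End one_increment.
End brownian_increments.

Section increment_moments.
Context (R : realType) (T : R) (n : nat) d (Omega : measurableType d).
Context (P : probability Omega R) (B : R -> Omega -> 'rV[R]_n).
Hypotheses (cP : measure_is_complete P) (hB : brownian_motion P T B).
Local Notation adapted t X := (adapted_at (brownian_gen P B) t X).

Section strict.
Variables s t : R.
Hypotheses (s0 : 0 <= s) (st : s < t) (tT : t <= T).
Local Notation W := (increment B s t).
Local Notation N := (normal_prob 0 (Num.sqrt (t - s))).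

Let sqrt_neq0 : Num.sqrt (t - s) != 0.
Proof. by rewrite gt_eqF// sqrtr_gt0 subr_gt0. Qed.

Let mW i : measurable_fun setT (W i).
Proof. exact: (measurable_increment hB s0 st tT). Qed.

Lemma Rintegral_increment i (f : R -> R) : measurable_fun setT f ->
  N.-integrable setT (EFin \o f) ->
  P.-integrable setT (EFin \o (f \o W i)) /\
  \int[P]_w f (W i w) = \int[N]_x f x.
Proof.
move=> mf Nf.
have mWi : measurable_fun setT (W i : Omega -> measurableTypeR R) by exact: mW.
pose X : {mfun Omega >-> measurableTypeR R} :=
  HB.pack (W i) (isMeasurableFun.Build _ _ _ _ _ mWi).
pose X' : {RV P >-> measurableTypeR R} := X.
have mfE : measurable_fun setT (EFin \o (f : measurableTypeR R -> R)) by exact/measurable_EFinP.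
have mfa : measurable_fun setT (abse \o (EFin \o (f : measurableTypeR R -> R))) by exact: measurableT_comp.
have lawE D : measurable D -> D `<=` setT -> distribution P X D = N D.
  by move=> mD _; exact: (increment_law hB s0 st tT).
have If : P.-integrable setT (EFin \o (f \o W i)).
  apply/integrableP; split.
    by apply/measurable_EFinP; exact: measurableT_comp.
  have -> : (\int[P]_w `|(EFin \o (f \o W i)) w| =
      \int[distribution P X]_x (abse \o (EFin \o f)) x)%E.
    exact/esym/(ge0_integral_distribution X' mfa (fun y => abse_ge0 _)).
  rewrite (eq_measure_integral N)//.
  by have /integrableP[] := Nf.
split => //; rewrite /Rintegral; congr fine.
rewrite [RHS](eq_measure_integral (distribution P X)); last first.
  by move=> D mD DT; exact/esym/lawE.
by rewrite (integral_distribution (X := X')).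
Qed.

Lemma integrable_incrementX k i : P.-integrable setT (EFin \o (fun w => W i w ^+ k)).
Proof.
have [] := @Rintegral_increment i (fun x => x ^+ k) _ (integrable_normalX sqrt_neq0 k) => //.
Qed.

Let integrable_increment i : P.-integrable setT (EFin \o W i).
Proof. exact: (integrable_incrementX 1). Qed.

Lemma Rintegral_increment1 i : \int[P]_w W i w = 0.
Proof.
have [] := @Rintegral_increment i (fun x => x) _ (integrable_normalX sqrt_neq0 1) => //.
by move=> _ ->; rewrite Rintegral_normal_id.
Qed.

Lemma Rintegral_increment2 i : \int[P]_w (W i w ^+ 2) = t - s.
Proof.
have [] := @Rintegral_increment i (fun x => x ^+ 2) _ (integrable_normalX sqrt_neq0 2) => //.
by move=> _ ->; rewrite Rintegral_normal_sqr// sqr_sqrtr// subr_ge0 ltW.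
Qed.

Lemma Rintegral_increment4_le i :
  \int[P]_w (W i w ^+ 4) <= 48 * expR 2^-1 * (t - s) ^+ 2.
Proof.
have [] := @Rintegral_increment i (fun x => x ^+ 4) _ (integrable_normalX sqrt_neq0 4) => //.
move=> _ ->; apply: le_trans (Rintegral_normal4_le sqrt_neq0) _.
by rewrite (_ : 4 = 2 * 2)%N// exprM sqr_sqrtr// subr_ge0 ltW.
Qed.

Lemma Rintegral_incrementM i j :
  P.-integrable setT (EFin \o (fun w => W i w * W j w)) /\
  \int[P]_w (W i w * W j w) = (i == j)%:R * (t - s).
Proof.
have [->|ij] := eqVneq i j.
  split; first exact: (integrable_incrementX 2).
  by rewrite mul1r -(Rintegral_increment2 j).
have [H1 H2] := independent_expectationM (mW i) (mW j)
  (fun A C mA mC => increment_indep hB s0 st tT ij mA mC)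
  (integrable_increment i) (integrable_increment j).
by split => //; rewrite H2 Rintegral_increment1 !mul0r.
Qed.

Local Notation rectT := (g_sigma_algebraType (increment_rect B s t)).

Lemma rect_measurable_increment i : measurable_fun setT (W i : rectT -> R).
Proof.
move=> _ C mC; rewrite setTI; apply: sub_sigma_algebra.
exists (fun j => if j == i then C else setT); first by move=> j; case: eqP.
apply/seteqP; split => w /=; first by move=> h j; case: eqP => [->|].
by move=> /(_ i); rewrite eqxx.
Qed.

(** Takes the place of conditioning on the past at time [s]: a factor known at time [s] splits off a
    function of the increment. *)
Lemma adapted_indep_increment (X Y : Omega -> R) :
  adapted s X -> measurable_fun setT (Y : rectT -> R) ->
  P.-integrable setT (EFin \o X) -> P.-integrable setT (EFin \o Y) ->
  P.-integrable setT (EFin \o (fun w => X w * Y w)) /\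
  \int[P]_w (X w * Y w) = (\int[P]_w X w) * (\int[P]_w Y w).
Proof.
move=> aX mY iX iY; apply: independent_expectationM => //.
- by have /integrableP[/measurable_EFinP] := iX.
- by have /integrableP[/measurable_EFinP] := iY.
move=> A C mA mC; apply: (increment_independent_of cP hB s0 st tT).
  exact: (adapted_preimage aX).
by have := mY measurableT C mC; rewrite setTI.
Qed.

Lemma sum_sqr_increment :
  P.-integrable setT (EFin \o (fun w => \sum_(i < n) W i w ^+ 2)) /\
  \int[P]_w (\sum_(i < n) W i w ^+ 2) = n%:R * (t - s).
Proof.
split; first by apply: (integrable_sum_EFin measurableT) => i; exact: integrable_incrementX.
rewrite Rintegral_sum//; last by move=> i; exact: integrable_incrementX.
rewrite (eq_bigr (fun=> t - s)) => [|i _]; last exact: Rintegral_increment2.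
by rewrite sumr_const card_ord mulr_natl.
Qed.

Lemma sum_sqr_increment2 :
  P.-integrable setT (EFin \o (fun w => (\sum_(i < n) W i w ^+ 2) ^+ 2)) /\
  \int[P]_w ((\sum_(i < n) W i w ^+ 2) ^+ 2) <=
     n%:R ^+ 2 * (48 * expR 2^-1) * (t - s) ^+ 2.
Proof.
have i4 : P.-integrable setT (EFin \o (fun w => n%:R * \sum_(i < n) (W i w ^+ 2) ^+ 2)).
  apply: integrableZ_EFin => //; apply: (integrable_sum_EFin measurableT) => i.
  have -> : EFin \o (fun w => (W i w ^+ 2) ^+ 2) = EFin \o (fun w => W i w ^+ 4).
    by apply/funext => w /=; rewrite -exprM.
  exact: integrable_incrementX.
have I : P.-integrable setT (EFin \o (fun w => (\sum_(i < n) W i w ^+ 2) ^+ 2)).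
  apply: le_integrable_EFin i4 => //.
    apply: measurable_funX; apply: measurable_sum => i; apply: measurable_funX; exact: mW.
  by move=> w _; rewrite ger0_norm ?sqr_ge0// sqr_sum_le.
split => //.
apply: (@le_trans _ _ (\int[P]_w (n%:R * \sum_(i < n) (W i w ^+ 2) ^+ 2))).
  by apply: le_Rintegral => // w _; exact: sqr_sum_le.
under eq_Rintegral do under eq_bigr do rewrite -exprM.
rewrite RintegralZl//; last first.
  by apply: (integrable_sum_EFin measurableT) => i; exact: integrable_incrementX.
rewrite Rintegral_sum//; last by move=> i; exact: integrable_incrementX.
rewrite expr2 -!mulrA ler_wpM2l// mulr_natl -[n in _ *+ n]card_ord -sumr_const.
by apply: ler_sum => i _; rewrite mulrA; exact: Rintegral_increment4_le.
Qed.

End strict.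
End increment_moments.

(** * Discrete martingale transforms *)

Section martingale_transform.
Context (R : realType) (T : R) (n : nat) d (Omega : measurableType d).
Context (P : probability Omega R) (B : R -> Omega -> 'rV[R]_n).
Hypotheses (cP : measure_is_complete P) (hB : brownian_motion P T B).
Local Notation adapted t X := (adapted_at (brownian_gen P B) t X).

Definition dotW s t (h : 'I_n -> Omega -> R) w := \sum_(i < n) h i w * increment B s t i w.
(** The bracket of the step, that is, the compensator of [dotW ^+ 2]. *)
Definition quadW (s t : R) (h : 'I_n -> Omega -> R) w := (\sum_(i < n) h i w ^+ 2) * (t - s).

(* One step of the compensated second-order Taylor expansion along h dB. *)
Definition mart_step s t (a b : Omega -> R) h w :=
  a w * dotW s t h w + b w * (dotW s t h w ^+ 2 - quadW s t h w).

Section step.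
Variables (s t : R) (a b : Omega -> R) (h : 'I_n -> Omega -> R) (c ch : R).
Hypotheses (s0 : 0 <= s) (st : s <= t) (tT : t <= T).
Hypotheses (aa : adapted s a) (ab : adapted s b) (ah : forall i, adapted s (h i)).
Hypotheses (ca : forall w, `|a w| <= c) (cb : forall w, `|b w| <= c).
Hypothesis hch : forall i w, `|h i w| <= ch.
Local Notation W := (increment B s t).
Local Notation m := (mart_step s t a b h).

Let sT : s <= T. Proof. exact: le_trans tT. Qed.

(** Grids may repeat points, and the normal moments require a positive deviation; empty cells are
    set apart by this lemma. *)
Lemma mart_step0 : s = t -> m = fun=> 0.
Proof.
move=> <-; apply/funext => w; rewrite /mart_step /quadW subrr mulr0 subr0.
have -> : dotW s s h w = 0.
  by rewrite /dotW big1// => i _; rewrite /increment subrr mulr0.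
by rewrite mulr0 expr0n mulr0 addr0.
Qed.

Lemma integrable_adapted_mul X Y k : adapted s X -> adapted s Y -> (forall w, `|Y w| <= k) ->
  P.-integrable setT (EFin \o X) -> P.-integrable setT (EFin \o (fun w => X w * Y w)).
Proof.
move=> aX aY Yk iX.
apply: (@le_integrable_EFin _ _ _ _ _ _ (fun w => k * `|X w|)) => //.
- by apply: measurable_funM; exact: (adapted_measurable cP hB sT).
- by move=> w _; rewrite normrM mulrC ler_wpM2r.
- by apply: integrableZ_EFin => //; exact: (integrable_norm iX).
Qed.

(** Expanding the step over coordinates gives products of a factor known at time [s] with [W i] or
    with [W i * W j - (i == j)%:R * (t - s)], both centered. [X = 1] yields centering of the step,
    and [X] a sum of earlier steps yields orthogonality. *)
Lemma mart_step_orth X : adapted s X -> P.-integrable setT (EFin \o X) ->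
  P.-integrable setT (EFin \o (fun w => X w * m w)) /\ \int[P]_w (X w * m w) = 0.
Proof.
move=> aX iX.
move: st; rewrite le_eqVlt => /orP[/eqP /mart_step0 ->|lst].
  have -> : (fun w => X w * 0) = cst 0 by apply/funext => w; rewrite mulr0.
  split; first by apply: finite_measure_integrable_cst.
  by rewrite Rintegral_cst// mul0r.
pose Xa i w := X w * (a w * h i w).
pose Xb i j w := X w * (b w * (h i w * h j w)).
have c0 (w : Omega) : 0 <= c by rewrite (le_trans _ (ca w)).
have ch0 (i : 'I_n) (w : Omega) : 0 <= ch by rewrite (le_trans _ (hch i w)).
have aXa i : adapted s (Xa i).
  by apply: measurable_funM => //; apply: measurable_funM => //; exact: ah.
have aXb i j : adapted s (Xb i j).
  apply: measurable_funM => //; apply: measurable_funM => //.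
  by apply: measurable_funM; exact: ah.
have iXa i : P.-integrable setT (EFin \o Xa i).
  apply: (@integrable_adapted_mul _ _ (c * ch)) => //.
    by apply: measurable_funM => //; exact: ah.
  by move=> w; rewrite normrM ler_pM.
have iXb i j : P.-integrable setT (EFin \o Xb i j).
  apply: (@integrable_adapted_mul _ _ (c * (ch * ch))) => //.
    by apply: measurable_funM => //; apply: measurable_funM; exact: ah.
  by move=> w; rewrite !normrM ler_pM ?ler_pM.
pose f1 i w := Xa i w * W i w.
pose f2 i j w := Xb i j w * (W i w * W j w - (i == j)%:R * (t - s)).
have mE : (fun w => X w * m w) = fun w => \sum_(i < n) f1 i w + \sum_(i < n) \sum_(j < n) f2 i j w.
  apply/funext => w; rewrite /mart_step mulrDr; congr (_ + _).
    by rewrite /dotW /f1 /Xa !mulr_sumr; apply: eq_bigr => i _; ring.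
  have -> : dotW s t h w ^+ 2 = \sum_(i < n) \sum_(j < n) (h i w * h j w) * (W i w * W j w).
    rewrite expr2 /dotW mulr_suml; apply: eq_bigr => i _; rewrite mulr_sumr.
    by apply: eq_bigr => j _; ring.
  have -> : quadW s t h w = \sum_(i < n) \sum_(j < n) (h i w * h j w) * ((i == j)%:R * (t - s)).
    rewrite /quadW mulr_suml; apply: eq_bigr => i _; rewrite (bigD1 i)//= eqxx big1 ?addr0.
      by rewrite mul1r expr2.
    by move=> j; rewrite eq_sym => /negbTE ->; rewrite mul0r mulr0.
  rewrite -sumrB !mulr_sumr; apply: eq_bigr => i _; rewrite -sumrB !mulr_sumr.
  by apply: eq_bigr => j _; rewrite /f2 /Xb; ring.
have H1 i : P.-integrable setT (EFin \o f1 i) /\ \int[P]_w f1 i w = 0.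
  have [] := adapted_indep_increment cP hB s0 lst tT (aXa i)
    (rect_measurable_increment (s:=s) (t:=t) (B:=B) i) (iXa i)
    (integrable_incrementX hB s0 lst tT 1 i).
  by move=> h1 h2; split => //; rewrite h2 (Rintegral_increment1 hB s0 lst tT) mulr0.
have H2 i j : P.-integrable setT (EFin \o f2 i j) /\ \int[P]_w f2 i j w = 0.
  have [iW EW] := Rintegral_incrementM hB s0 lst tT i j.
  have icst r : P.-integrable setT (EFin \o cst r) by exact: finite_measure_integrable_cst.
  have [] := adapted_indep_increment cP hB s0 lst tT (aXb i j) _ (iXb i j)
    (integrableB_EFin measurableT iW (icst ((i == j)%:R * (t - s)))).
    apply: measurable_funB => //; apply: measurable_funM; exact: rect_measurable_increment.
  move=> h1 h2; split => //; rewrite h2 RintegralB// EW Rintegral_cst// [X in fine X]probability_setT.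
  by rewrite mulr1 subrr mulr0.
have i2 i : P.-integrable setT (EFin \o (fun w => \sum_(j < n) f2 i j w)).
  by apply: (integrable_sum_EFin measurableT) => j; have [] := H2 i j.
have i1 : P.-integrable setT (EFin \o (fun w => \sum_(i < n) f1 i w)).
  by apply: (integrable_sum_EFin measurableT) => i; have [] := H1 i.
have i22 : P.-integrable setT (EFin \o (fun w => \sum_(i < n) \sum_(j < n) f2 i j w)).
  exact: (integrable_sum_EFin measurableT).
rewrite mE; split; first exact: integrableD_EFin.
rewrite RintegralD// Rintegral_sum//; last by move=> i; have [] := H1 i.
rewrite Rintegral_sum// !big1 ?addr0// => i _; last by have [] := H1 i.
rewrite Rintegral_sum//; last by move=> j; have [] := H2 i j.
by rewrite big1// => j _; have [] := H2 i j.
Qed.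

Lemma quadW_ge0 w : 0 <= quadW s t h w.
Proof. by rewrite mulr_ge0 ?subr_ge0// sum_sqr_ge0. Qed.

Lemma quadW_le w : quadW s t h w <= n%:R * ch ^+ 2 * (t - s).
Proof.
rewrite /quadW ler_wpM2r ?subr_ge0// mulr_natl -[n in _ *+ n]card_ord -sumr_const.
by apply: ler_sum => i _; rewrite -(real_normK (num_real (h i w))) lerXn2r// nnegrE (le_trans _ (hch i w)).
Qed.

Lemma adapted_quadW : adapted s (quadW s t h).
Proof.
apply: measurable_funM => //; apply: measurable_sum => i; apply: measurable_funX; exact: ah.
Qed.

Lemma integrable_quadW k : P.-integrable setT (EFin \o (fun w => quadW s t h w ^+ k)).
Proof.
apply: (@le_integrable_EFin _ _ _ _ _ _ (cst ((n%:R * ch ^+ 2 * (t - s)) ^+ k))) => //.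
- apply: (adapted_measurable cP hB sT).
  by apply: measurable_funX; exact: adapted_quadW.
- by move=> w _; rewrite normrX ger0_norm ?quadW_ge0// lerXn2r// ?nnegrE ?quadW_ge0 ?quadW_le// (le_trans (quadW_ge0 w)) ?quadW_le.
- exact: finite_measure_integrable_cst.
Qed.

Lemma measurable_mart_step : measurable_fun setT m.
Proof.
move: st; rewrite le_eqVlt => /orP[/eqP /mart_step0 ->|lst]; first exact: measurable_cst.
have mu : measurable_fun setT (dotW s t h).
  apply: measurable_sum => i; apply: measurable_funM.
    exact: (adapted_measurable cP hB sT).
  exact: (measurable_increment hB s0 lst tT).
apply: measurable_funD; apply: measurable_funM => //; try exact: (adapted_measurable cP hB sT).
apply: measurable_funB; first exact: measurable_funX.
by apply: (adapted_measurable cP hB sT); exact: adapted_quadW.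
Qed.

Lemma adapted_mart_step : adapted t m.
Proof.
have adt X : adapted s X -> adapted t X by exact: (adapted_le (B := B) st).
have aW i : adapted t (W i).
  have t0 : 0 <= t by exact: le_trans st.
  by apply: measurable_funB; apply: adapted_brownian.
have au : adapted t (dotW s t h).
  by apply: measurable_sum => i; apply: measurable_funM; [apply: adt|exact: aW].
apply: measurable_funD; apply: measurable_funM => //; try exact: adt.
by apply: measurable_funB; [exact: measurable_funX|apply: adt; exact: adapted_quadW].
Qed.

(** The 4 comes from using [(x + y)^2 <= 2 x^2 + 2 y^2] twice, [n^2 48 exp (1/2)] from the fourth
    moment of the increment, and the 1 from the squared compensator. *)
Definition mart_cst : R := 4 * (n%:R ^+ 2 * (48 * expR 2^-1) + 1).

(** By Cauchy-Schwarz [dotW ^+ 2] is at most [h2 * S], where [h2] is known at time [s] and [S]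
    depends on the increment alone, so the means of all terms of the bound factorize. *)
Lemma mart_step_sqr :
  P.-integrable setT (EFin \o (fun w => m w ^+ 2)) /\
  \int[P]_w (m w ^+ 2) <= c ^+ 2 * (2 * n%:R * \int[P]_w quadW s t h w
      + mart_cst * \int[P]_w (quadW s t h w ^+ 2)).
Proof.
have c00 : 0 <= c ^+ 2 by exact: sqr_ge0.
have mm := measurable_mart_step.
have q1 : 0 <= \int[P]_w quadW s t h w by apply: Rintegral_ge0 => w _; exact: quadW_ge0.
have q2 : 0 <= \int[P]_w (quadW s t h w ^+ 2) by apply: Rintegral_ge0 => w _; exact: sqr_ge0.
have mc0 : 0 <= mart_cst by rewrite mulr_ge0// addr_ge0// mulr_ge0 ?sqr_ge0// mulr_ge0// expR_ge0.
move: st; rewrite le_eqVlt => /orP[/eqP /mart_step0 ->|lst].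
  have -> : (fun w : Omega => 0 ^+ 2 : R) = cst 0 by apply/funext => w; rewrite expr0n.
  split; first by apply: finite_measure_integrable_cst.
  by rewrite Rintegral_cst// mul0r mulr_ge0// addr_ge0// mulr_ge0// mulr_ge0.
pose S w := \sum_(i < n) W i w ^+ 2.
have [iS ES] := sum_sqr_increment hB s0 lst tT.
have [iS2 ES2] := sum_sqr_increment2 hB s0 lst tT.
pose h2 w := \sum_(i < n) h i w ^+ 2.
have ah2 : adapted s h2.
  by apply: measurable_sum => i; apply: measurable_funX; exact: ah.
have q E : quadW s t h E = h2 E * (t - s) by [].
have ts0 : 0 < t - s by rewrite subr_gt0.
have h2E : h2 = (fun w => (t - s)^-1 * quadW s t h w).
  by apply/funext => w; rewrite q mulrCA mulVf ?mulr1// gt_eqF.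
have ih2 : P.-integrable setT (EFin \o h2).
  by rewrite h2E; apply: integrableZ_EFin => //; have := integrable_quadW 1.
have ih22 : P.-integrable setT (EFin \o (fun w => h2 w ^+ 2)).
  rewrite (_ : (fun w => h2 w ^+ 2) = (fun w => (t - s)^-1 ^+ 2 * quadW s t h w ^+ 2)).
    by apply: integrableZ_EFin => //; exact: integrable_quadW.
  by apply/funext => w; rewrite h2E exprMn.
have rS : measurable_fun setT (S : g_sigma_algebraType (increment_rect B s t) -> R).
  by apply: measurable_sum => i; apply: measurable_funX; exact: rect_measurable_increment.
have [iA EA] := adapted_indep_increment cP hB s0 lst tT ah2 rS ih2 iS.
have [iB EB] := adapted_indep_increment cP hB s0 lst tT (measurable_funX 2 ah2) (measurable_funX 2 rS) ih22 iS2.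
have iq2 := integrable_quadW 2.
pose G w := c ^+ 2 * (2 * (h2 w * S w)) + c ^+ 2 * (4 * (h2 w ^+ 2 * S w ^+ 2) + 4 * quadW s t h w ^+ 2).
have iG1 : P.-integrable setT (EFin \o (fun w => c ^+ 2 * (2 * (h2 w * S w)))).
  by do 2 apply: integrableZ_EFin => //.
have iG2 : P.-integrable setT (EFin \o (fun w => 4 * (h2 w ^+ 2 * S w ^+ 2) + 4 * quadW s t h w ^+ 2)).
  by apply: integrableD_EFin => //; apply: integrableZ_EFin.
have iG2' : P.-integrable setT (EFin \o (fun w => c ^+ 2 * (4 * (h2 w ^+ 2 * S w ^+ 2) + 4 * quadW s t h w ^+ 2))).
  exact: integrableZ_EFin.
have iG : P.-integrable setT (EFin \o G) by exact: integrableD_EFin.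
have mG w : m w ^+ 2 <= G w.
  rewrite /mart_step; set u := dotW s t h w; set qq := quadW s t h w.
  have u2 : u ^+ 2 <= h2 w * S w by exact: cauchy_schwarz.
  have u4 : u ^+ 4 <= h2 w ^+ 2 * S w ^+ 2.
    rewrite (_ : 4 = 2 * 2)%N// exprM -exprMn lerXn2r// nnegrE ?sqr_ge0//.
    by rewrite mulr_ge0// sum_sqr_ge0.
  have a2 : a w ^+ 2 <= c ^+ 2.
    by rewrite -(real_normK (num_real (a w))) lerXn2r// nnegrE (le_trans _ (ca w)).
  have b2 : b w ^+ 2 <= c ^+ 2.
    by rewrite -(real_normK (num_real (b w))) lerXn2r// nnegrE (le_trans _ (cb w)).
  have -> : (a w * u + b w * (u ^+ 2 - qq)) ^+ 2 =
    2 * (a w ^+ 2 * u ^+ 2 + b w ^+ 2 * (u ^+ 2 - qq) ^+ 2) - (a w * u - b w * (u ^+ 2 - qq)) ^+ 2 by ring.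
  have e1 : a w ^+ 2 * u ^+ 2 <= c ^+ 2 * (h2 w * S w) by rewrite ler_pM// sqr_ge0.
  have e2 : (u ^+ 2 - qq) ^+ 2 <= 2 * (h2 w ^+ 2 * S w ^+ 2) + 2 * qq ^+ 2.
    have -> : (u ^+ 2 - qq) ^+ 2 = 2 * u ^+ 4 + 2 * qq ^+ 2 - (u ^+ 2 + qq) ^+ 2 by ring.
    by have := sqr_ge0 (u ^+ 2 + qq); lra.
  have e3 : b w ^+ 2 * (u ^+ 2 - qq) ^+ 2 <= c ^+ 2 * (2 * (h2 w ^+ 2 * S w ^+ 2) + 2 * qq ^+ 2).
    by rewrite ler_pM// sqr_ge0.
  rewrite /G -/qq; have := sqr_ge0 (a w * u - b w * (u ^+ 2 - qq)); lra.
have im : P.-integrable setT (EFin \o (fun w => m w ^+ 2)).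
  apply: le_integrable_EFin iG => //; first exact: measurable_funX.
  by move=> w _; rewrite ger0_norm ?sqr_ge0.
split => //.
apply: (@le_trans _ _ (\int[P]_w G w)); first by apply: le_Rintegral => // w _; exact: mG.
have i1 : P.-integrable setT (EFin \o (fun w => 4 * (h2 w ^+ 2 * S w ^+ 2))) by exact: integrableZ_EFin.
have i2 : P.-integrable setT (EFin \o (fun w => 4 * quadW s t h w ^+ 2)) by exact: integrableZ_EFin.
have i3 : P.-integrable setT (EFin \o (fun w => 2 * (h2 w * S w))) by exact: integrableZ_EFin.
have -> : \int[P]_w G w = c ^+ 2 * (2 * (\int[P]_w h2 w * (n%:R * (t - s)))) +
    c ^+ 2 * (4 * (\int[P]_w (h2 w ^+ 2) * \int[P]_w (S w ^+ 2)) + 4 * \int[P]_w (quadW s t h w ^+ 2)).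
  by rewrite /G RintegralD// !RintegralZl// RintegralD// !RintegralZl// EA EB ES.
have Eq1 : \int[P]_w quadW s t h w = (\int[P]_w h2 w) * (t - s).
  by rewrite -RintegralZr.
have Eq2 : \int[P]_w (quadW s t h w ^+ 2) = (\int[P]_w (h2 w ^+ 2)) * (t - s) ^+ 2.
  by rewrite -RintegralZr//; apply: eq_Rintegral => w _; rewrite q exprMn.
rewrite -mulrDr ler_wpM2l// Eq1 Eq2.
have h220 : 0 <= \int[P]_w (h2 w ^+ 2) by apply: Rintegral_ge0 => w _; exact: sqr_ge0.
have := ler_wpM2l h220 ES2.
rewrite /mart_cst; lra.
Qed.

End step.

Section sum.
Variables (s : nat -> R) (a b : nat -> Omega -> R) (h : nat -> 'I_n -> Omega -> R).
Variables (c : R) (ch : nat -> R).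
Local Notation m k := (mart_step (s k) (s k.+1) (a k) (b k) (h k)).
Local Notation q k := (quadW (s k) (s k.+1) (h k)).

(** The coefficients share the bound [c], which enters the final estimate; the integrands have a
    bound [ch k] for each step, which serves integrability only. *)
Definition transform_upto N : Prop :=
  [/\ forall k, (k < N)%N -> [/\ 0 <= s k, s k <= s k.+1 & s k.+1 <= T],
      forall k, (k < N)%N -> adapted (s k) (a k) /\ adapted (s k) (b k),
      forall k, (k < N)%N -> forall i, adapted (s k) (h k i),
      forall k, (k < N)%N -> forall w, `|a k w| <= c /\ `|b k w| <= c &
      forall k, (k < N)%N -> forall i w, `|h k i w| <= ch k].

(** Pythagoras: at each step the cross term with the past sum vanishes by [mart_step_orth]. *)
Lemma transform_sum N : transform_upto N ->
  let M w := \sum_(k < N) m k w in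
  [/\ (0 < N)%N -> adapted (s N) M,
      P.-integrable setT (EFin \o M), P.-integrable setT (EFin \o (fun w => M w ^+ 2)),
      \int[P]_w M w = 0 &
      \int[P]_w (M w ^+ 2) <= \sum_(k < N) c ^+ 2 *
        (2 * n%:R * \int[P]_w q k w + mart_cst * \int[P]_w (q k w ^+ 2))].
Proof.
elim: N => [|N IH].
  move=> _ /=; split => //.
  - rewrite (_ : _ \o _ = EFin \o cst 0); first exact: finite_measure_integrable_cst.
    by apply/funext => w /=; rewrite big_ord0.
  - rewrite (_ : _ \o _ = EFin \o cst 0); first exact: finite_measure_integrable_cst.
    by apply/funext => w /=; rewrite big_ord0 expr0n.
  - under eq_Rintegral do rewrite big_ord0.
    by rewrite Rintegral_cst// mul0r.
  - under eq_Rintegral do rewrite big_ord0 expr0n.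
    by rewrite Rintegral_cst// mul0r big_ord0.
move=> [H1 H2 H3 H4 H5] /=.
have [|aM iM iM2 EM EM2] := IH.
  by split=> k kN; [apply: H1|apply: H2|apply: H3|apply: H4|apply: H5]; exact: ltnW.
have [s0 ss sT] := H1 N (ltnSn _).
have [aa ab] := H2 N (ltnSn _).
have hc := H4 N (ltnSn _).
have ah := H3 N (ltnSn _).
have hh := H5 N (ltnSn _).
have ca w := (hc w).1; have cb w := (hc w).2.
pose M w := \sum_(k < N) m k w.
have aM' : adapted (s N) M.
  have [N0|N0] := posnP N; last exact: aM.
  have -> : M = cst 0 by apply/funext => w; rewrite /M N0 big_ord0.
  exact: measurable_cst.
have MS w : \sum_(k < N.+1) m k w = M w + m N w by rewrite big_ord_recr.
have [iX EX] := mart_step_orth s0 ss sT aa ab ah ca cb hh aM' iM.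
have a1 : adapted (s N) (cst 1 : Omega -> R) by exact: measurable_cst.
have i1 : P.-integrable setT (EFin \o (cst 1 : Omega -> R)) by exact: finite_measure_integrable_cst.
have [im Em] := mart_step_orth s0 ss sT aa ab ah ca cb hh a1 i1.
have [im2 Em2] := mart_step_sqr s0 ss sT aa ab ah ca cb hh.
have m1 : (fun w => cst 1 w * m N w) = m N by apply/funext => w; rewrite mul1r.
rewrite m1 in im Em.
have MSE : (fun w => \sum_(k < N.+1) m k w) = (fun w => M w + m N w) by exact/funext.
have MSE2 : (fun w => (\sum_(k < N.+1) m k w) ^+ 2) = (fun w => M w ^+ 2 + (2 * (M w * m N w) + m N w ^+ 2)).
  by apply/funext => w; rewrite MS; ring.
have i3 : P.-integrable setT (EFin \o (fun w => 2 * (M w * m N w))) by exact: integrableZ_EFin.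
have i4 : P.-integrable setT (EFin \o (fun w => 2 * (M w * m N w) + m N w ^+ 2)) by exact: integrableD_EFin.
split.
- move=> _; rewrite MSE; apply: measurable_funD.
    exact: (adapted_le (B := B) ss aM').
  exact: (adapted_mart_step s0 ss).
- by rewrite MSE; exact: integrableD_EFin.
- by rewrite MSE2; exact: integrableD_EFin.
- by rewrite MSE RintegralD// EM Em addr0.
- rewrite MSE2 RintegralD// RintegralD// RintegralZl// EX mulr0 add0r big_ord_recr/=.
  exact: lerD.
Qed.

(** Every bracket is at most the total [K], so the squared brackets sum to at most [K] times the
    total. The resulting bound does not see the number of steps nor the sizes [ch], so it is uniform
    along the sequence of grids. *)
Lemma transform_sum_bound N (K : R) : 0 <= K -> transform_upto N ->
  (forall w, \sum_(k < N) q k w <= K) ->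
  let M w := \sum_(k < N) m k w in
  [/\ measurable_fun setT M, P.-integrable setT (EFin \o M),
      P.-integrable setT (EFin \o (fun w => M w ^+ 2)),
      \int[P]_w M w = 0 &
      \int[P]_w (M w ^+ 2) <= c ^+ 2 * (2 * n%:R + mart_cst * K) * K].
Proof.
move=> K0 HN qK /=; have [_ iM iM2 EM EM2] := transform_sum HN.
split=> //; first by have /integrableP[/measurable_EFinP] := iM.
apply: (le_trans EM2); have [H1 H2 H3 H4 H5] := HN.
have q0 k : (k < N)%N -> forall w, 0 <= q k w.
  by move=> kN w; have [_ ss _] := H1 k kN; exact: quadW_ge0.
have iq k j : (k < N)%N -> P.-integrable setT (EFin \o (fun w => q k w ^+ j)).
  move=> kN; have [s0 ss sT] := H1 k kN.
  exact: (integrable_quadW ss sT (H3 k kN) (H5 k kN)).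
have iq1 k : (k < N)%N -> P.-integrable setT (EFin \o q k) by move=> kN; exact: (iq k 1%N).
have qk k : (k < N)%N -> forall w, q k w <= K.
  move=> kN w; apply: le_trans (qK w).
  rewrite (bigD1 (Ordinal kN))//= lerDl sumr_ge0// => i _; exact: q0.
have mc0 : 0 <= mart_cst by rewrite mulr_ge0// addr_ge0// mulr_ge0 ?sqr_ge0// mulr_ge0// expR_ge0.
have qq k : (k < N)%N -> \int[P]_w (q k w ^+ 2) <= K * \int[P]_w q k w.
  move=> kN; rewrite -RintegralZl//; last exact: iq1.
  apply: le_Rintegral => //; [exact: iq|by apply: integrableZ_EFin => //; exact: iq1|].
  by move=> w _; rewrite expr2 ler_wpM2r ?q0 ?qk.
apply: (@le_trans _ _ (\sum_(k < N) c ^+ 2 * ((2 * n%:R + mart_cst * K) * \int[P]_w q k w))).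
  apply: ler_sum => k _; rewrite ler_wpM2l ?sqr_ge0//.
  by have := ler_wpM2l mc0 (qq k (ltn_ord k)); lra.
rewrite -mulr_sumr -mulr_sumr mulrA ler_wpM2l//.
  by rewrite mulr_ge0 ?sqr_ge0// addr_ge0 ?mulr_ge0.
rewrite -(Rintegral_sum measurableT (fun k : 'I_N => iq1 k (ltn_ord k))).
apply: (@le_trans _ _ (\int[P]_w (cst K w))).
  apply: le_Rintegral => //; first exact: (integrable_sum_EFin measurableT (fun k : 'I_N => iq1 k (ltn_ord k))).
  exact: finite_measure_integrable_cst.
by rewrite Rintegral_cst// [X in fine X]probability_setT mulr1.
Qed.

End sum.
End martingale_transform.

(** * The Lyapunov function *)

Section is_derive_real.
Context (R : realType).
Implicit Types (f g : R -> R) (x a b : R).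

Lemma is_derive_conv f x a b : is_derive x 1 f a -> a = b -> is_derive x 1 f b.
Proof. by move=> fa <-. Qed.

Lemma is_deriveM1 f g x a b : is_derive x 1 f a -> is_derive x 1 g b ->
  is_derive x 1 (fun y => f y * g y) (a * g x + f x * b).
Proof.
move=> fa gb; have h := is_deriveM fa gb; apply: (is_derive_conv h).
by rewrite addrC; congr (_ + _); rewrite [LHS]mulrC.
Qed.

Lemma is_deriveZ1 k f x a : is_derive x 1 f a -> is_derive x 1 (fun y => k * f y) (k * a).
Proof. by move=> fa; exact: is_deriveZ. Qed.

Lemma is_deriveD1 f g x a b : is_derive x 1 f a -> is_derive x 1 g b ->
  is_derive x 1 (fun y => f y + g y) (a + b).
Proof. by move=> fa gb; exact: is_deriveD. Qed.

(** Extension by 0 to the negative axis: the quadratic bound forces the derivative at the junction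
    to be 0. *)
Lemma is_derive_max0 f (df : R -> R) (C : R) : f 0 = 0 -> df 0 = 0 ->
  (forall y : R, 0 < y -> is_derive y 1 f (df y)) ->
  (forall y : R, 0 <= y -> y <= 1 -> `|f y| <= C * y ^+ 2) ->
  forall x, is_derive x 1 (fun y => f (Num.max y 0)) (df (Num.max x 0)).
Proof.
move=> f0 df0 fd fC x.
have [x0|x0|->] := ltgtP x 0.
- rewrite df0; have h := is_derive_cst (0 : R) x (1 : R).
  apply: (near_eq_is_derive _ h).
  by near do rewrite /= max_r ?f0//; near=> y; apply: ltW; near: y; exact: lt_nbhsl.
- have h := fd x x0; apply: (near_eq_is_derive _ h).
  by near=> y; rewrite max_l//; apply: ltW; near: y; exact: lt_nbhsr.
- rewrite df0; pose F y := f (Num.max y 0).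
  have FC h : `|h| < 1 -> `|F h| <= `|C| * h ^+ 2.
    move=> h1; rewrite /F; have [h0|h0] := leP h 0.
      by rewrite f0 normr0 mulr_ge0// sqr_ge0.
    apply: (le_trans (fC _ (ltW h0) _)).
      by rewrite (le_trans (ler_norm h))// ltW.
    by rewrite ler_wpM2r ?sqr_ge0 ?ler_norm.
  have cvF : h^-1 *: ((F \o shift 0) (h *: 1) - F 0) @[h --> (0:R)^'] --> (0:R).
    apply/cvgr0Pnorm_lt => e e0; near=> h.
    have h0 : h != 0 by near: h; exact: nbhs_dnbhs_neq.
    have h1 : `|h| < 1 by near: h; apply: dnbhs0_lt.
    have h2 : `|h| < e / (`|C| + 1) by near: h; apply: dnbhs0_lt; rewrite divr_gt0// ltr_wpDl.
    rewrite /= addr0 [h *: 1]mulr1 {2}/F maxxx f0 subr0 normrM normfV.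
    rewrite mulrC ltr_pdivrMr ?normr_gt0//.
    apply: (le_lt_trans (FC h h1)); rewrite -(real_normK (num_real h)) expr2 mulrA ltr_pM2r ?normr_gt0//.
    move: h2; rewrite ltr_pdivlMr ?ltr_wpDl// => h2.
    apply: le_lt_trans h2; rewrite mulrC ler_wpM2l//. lra.
  by apply: DeriveDef; [apply/cvg_ex; exists 0|apply/cvg_lim].
Unshelve. all: by end_near. Qed.
End is_derive_real.

Section lyapunov.
Context (R : realType) (r : R).
Hypotheses (r1 : 1 <= r) (r2 : r < 2).
(** The function is [psi y = y^3 (1 + y)^(- r)]: cubic at 0, so that its extension by 0 is of class
    C^2, and of order [3 - r] at infinity. With [p] as a separate factor, its derivatives are
    polynomials in [y], [g] and [p], hence in [t = y p], which lies in [[0, 1]]. *)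
Let g (y : R) := (1 + y) `^ (- r).
Let p (y : R) := (1 + y)^-1.
Let psi y := y ^+ 3 * g y.
Let psi1 y := 3 * (y ^+ 2 * g y) + (- r) * (y ^+ 3 * (g y * p y)).
Let psi2 y := 6 * (y * g y) + (- (6 * r)) * (y ^+ 2 * (g y * p y))
   + (r * (r + 1)) * (y ^+ 3 * (g y * p y ^+ 2)).

Let is_derive_pow (k : nat) (y : R) : is_derive y 1 (fun z => z ^+ k.+1) (k.+1%:R * y ^+ k).
Proof.
elim: k => [|k IHk].
  by apply: (is_derive_conv (is_derive_id y (1 : R))); rewrite mulr1.
apply: (is_derive_conv (is_deriveM1 (is_derive_id y (1 : R)) IHk)).
by rewrite mul1r mulrCA -exprS -[in RHS]natr1; ring.
Qed.

Let is_derive_add1 (y : R) : is_derive y 1 (fun z : R => 1 + z) 1.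
Proof.
have h0 := is_derive_id y (1 : R); have h1 := is_derive_cst (1 : R) y (1 : R).
by have h := is_deriveD1 h1 h0; apply: (is_derive_conv h); rewrite add0r.
Qed.

Let is_derive_p (y : R) : -1 < y -> is_derive y 1 p (- p y ^+ 2).
Proof.
move=> y1; have y0 : 1 + y != 0 by rewrite gt_eqF//; lra.
have h := is_deriveV (f := fun z => 1 + z) y0 (is_derive_add1 y); apply: (is_derive_conv h).
by rewrite [LHS]mulr1 /p exprVn.
Qed.

Let is_derive_g (y : R) : -1 < y -> is_derive y 1 g (- r * (g y * p y)).
Proof.
move=> y1; have y0 : 0 < 1 + y by lra.
have h1 : is_derive (1 + y) 1 (fun x => x `^ (- r)) (- r * (1 + y) `^ (- r - 1)).
  apply: DeriveDef; first by apply: derivable_powR; rewrite in_itv/= y0.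
  by rewrite -derive1E powR_derive1// in_itv/= y0.
have h := is_derive1_comp (g := fun z => 1 + z) h1 (is_derive_add1 y); apply: (is_derive_conv h).
rewrite mulr1; congr (_ * _); rewrite /g /p powRD ?(gt_eqF y0) ?implybT//.
by rewrite powR_inv1// ltW.
Qed.

Let is_derive_psi (y : R) : -1 < y -> is_derive y 1 psi (psi1 y).
Proof.
move=> y1; have h := is_deriveM1 (is_derive_pow 2 y) (is_derive_g y1); apply: (is_derive_conv h).
by rewrite /psi1; ring.
Qed.

Let is_derive_psi1 (y : R) : -1 < y -> is_derive y 1 psi1 (psi2 y).
Proof.
move=> y1; have hg := is_derive_g y1; have hp := is_derive_p y1.
have h1 := is_deriveZ1 3 (is_deriveM1 (is_derive_pow 1 y) hg).
have h2 := is_deriveZ1 (- r) (is_deriveM1 (is_derive_pow 2 y) (is_deriveM1 hg hp)).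
have h := is_deriveD1 h1 h2; apply: (is_derive_conv h).
by rewrite /psi2; ring.
Qed.

Let derivable_psi2 (y : R) : -1 < y -> derivable psi2 y 1.
Proof.
move=> y1; have hg := is_derive_g y1; have hp := is_derive_p y1.
have hpp := is_deriveM1 hp hp.
have h1 := is_deriveZ1 6 (is_deriveM1 (is_derive_id y (1 : R)) hg).
have h2 := is_deriveZ1 (- (6 * r)) (is_deriveM1 (is_derive_pow 1 y) (is_deriveM1 hg hp)).
have h3 := is_deriveZ1 (r * (r + 1)) (is_deriveM1 (is_derive_pow 2 y) (is_deriveM1 hg hpp)).
by have [+ _] := is_deriveD1 (is_deriveD1 h1 h2) h3.
Qed.

Let g_gt0 (y : R) : 0 <= y -> 0 < g y.
Proof. by move=> y0; rewrite powR_gt0// ltr_pwDl. Qed.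

Let g_le1 (y : R) : 0 <= y -> g y <= 1.
Proof.
move=> y0; rewrite /g powRN invf_le1 ?powR_gt0 ?ltr_pwDl//.
rewrite -[leLHS](powRr0 (1 + y)) ler_powR//; first by rewrite lerDl.
by move: r1; lra.
Qed.

Let t_itv (y : R) : 0 <= y -> 0 <= y * p y /\ y * p y <= 1.
Proof.
move=> y0; have y1 : 0 < 1 + y by lra.
split; first by rewrite divr_ge0// ltW.
by rewrite ler_pdivrMr//; lra.
Qed.

Let psi1E y : psi1 y = y ^+ 2 * g y * (3 - r * (y * p y)).
Proof. by rewrite /psi1; ring. Qed.

Let psi2E y : psi2 y = y * g y * (6 - 6 * r * (y * p y) + r * (r + 1) * (y * p y) ^+ 2).
Proof. by rewrite /psi2; ring. Qed.

Let psi1_bounds (y : R) : 0 <= y -> 0 <= psi1 y /\ psi1 y <= 3 * (y ^+ 2 * g y).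
Proof.
move=> y0; have [t0 t1] := t_itv y0; have g0 := ltW (g_gt0 y0).
rewrite psi1E; set t := y * p y in t0 t1 *.
have rt : 0 <= r * t by rewrite mulr_ge0//; move: r1; lra.
have rt3 : r * t <= 3 by have : r * t <= r * 1; [rewrite ler_wpM2l//; move: r1; lra|move: r2; lra].
split; first by rewrite mulr_ge0 ?mulr_ge0 ?sqr_ge0//; lra.
rewrite mulrC ler_wpM2r ?mulr_ge0 ?sqr_ge0//; lra.
Qed.

(** The value at [t = 1] of the quadratic factor in [psi2E]; it is positive because [r < 2]. *)
Let kappa := (2 - r) * (3 - r).

Let kappa_gt0 : 0 < kappa.
Proof. by rewrite mulr_gt0//; move: r1 r2; lra. Qed.

(** The quadratic factor minus [kappa] is [(1 - t) r (6 - (r + 1) (1 + t))], and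
    [(r + 1) (1 + t) <= 6]. *)
Let psi2_ge (y : R) : 0 <= y -> kappa * (y * g y) <= psi2 y.
Proof.
move=> y0; have [t0 t1] := t_itv y0; have g0 := ltW (g_gt0 y0).
rewrite psi2E mulrC; set t := y * p y in t0 t1 *; rewrite ler_wpM2l ?mulr_ge0//.
have H1 : 0 <= (1 - t) * (r * (6 - (r + 1) * (1 + t))).
  rewrite mulr_ge0 ?subr_ge0// mulr_ge0//; first by move: r1; lra.
  have : (r + 1) * (1 + t) <= 3 * 2 by rewrite ler_pM//; move: r1 r2; lra.
  by lra.
rewrite /kappa; lra.
Qed.

(** [c = 9 / kappa] because [psi1 <= 3 y^2 g] while [psi psi2 >= kappa y^4 g^2]. *)
Lemma lyapunov_function_le2 : exists (Phi Phi1 Phi2 : R -> R) (c : R),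
  [/\ forall x : R, is_derive x 1 Phi (Phi1 x), forall x : R, is_derive x 1 Phi1 (Phi2 x),
      continuous Phi2, forall x, [/\ 0 <= Phi x, 0 <= Phi1 x & 0 <= Phi2 x] &
    [/\ forall x : R, x <= 0 -> Phi x = 0 /\ Phi1 x = 0, forall x : R, 0 < x -> 0 < Phi x,
      forall x, x * Phi1 x <= 3 * Phi x,
      0 <= c /\ forall x, Phi1 x ^+ 2 <= c * (Phi x * Phi2 x) &
      forall x, Phi x <= (1 + Num.max x 0) `^ (3 - r)]].
Proof.
pose m0 (x : R) := Num.max x 0.
have m00 x : 0 <= m0 x by rewrite le_max lexx orbT.
exists (psi \o m0), (psi1 \o m0), (psi2 \o m0), (9 / kappa); split.
- apply: (@is_derive_max0 _ psi psi1 1) => //.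
  + by rewrite /psi expr0n mul0r.
  + by rewrite psi1E expr0n !mul0r.
  + by move=> y y0; apply: is_derive_psi; lra.
  + move=> y y0 y1; rewrite mul1r /psi ger0_norm ?mulr_ge0 ?exprn_ge0// ?(ltW (g_gt0 y0))//.
    rewrite exprS mulrAC ler_piMl ?sqr_ge0//.
    by rewrite -[leRHS]mulr1 ler_pM// ?g_le1// ltW// g_gt0.
- apply: (@is_derive_max0 _ psi1 psi2 3) => //.
  + by rewrite psi1E expr0n !mul0r.
  + by rewrite psi2E !mul0r.
  + by move=> y y0; apply: is_derive_psi1; lra.
  + move=> y y0 y1; have [h1 h2] := psi1_bounds y0; rewrite ger0_norm//.
    apply: (le_trans h2); rewrite ler_wpM2l// -[leRHS]mulr1 ler_wpM2l ?sqr_ge0 ?g_le1//.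
- move=> x; apply: continuous_comp.
    exact: (continuous_max (@cvg_id _ _) (@cvg_cst _ _ _ _ _)).
  apply: differentiable_continuous; apply/derivable1_diffP; apply: derivable_psi2.
  by apply: lt_le_trans (m00 x); lra.
- move=> x /=; have [h1 h2] := psi1_bounds (m00 x); have g0 := g_gt0 (m00 x).
  split => //; first by rewrite mulr_ge0 ?exprn_ge0// ltW.
  by apply: le_trans (psi2_ge (m00 x)); rewrite mulr_ge0 ?(ltW kappa_gt0)// mulr_ge0// ltW.
- split.
  + by move=> x x0; rewrite /= /m0 (max_idPr x0) /psi psi1E !expr0n !mul0r.
  + by move=> x x0; rewrite /= /m0 (max_idPl (ltW x0)) /psi mulr_gt0 ?exprn_gt0// g_gt0// ltW.
  + move=> x /=; have [h1 h2] := psi1_bounds (m00 x).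
    apply: (@le_trans _ _ (m0 x * psi1 (m0 x))); first by rewrite ler_wpM2r// le_max lexx.
    by have := ler_wpM2l (m00 x) h2; rewrite /psi; lra.
  + split; first by rewrite divr_ge0// ltW.
    move=> x /=; have y0 := m00 x; set y := m0 x in y0 *.
    have [h1 h2] := psi1_bounds y0; have h3 := psi2_ge y0; have g0 := ltW (g_gt0 y0).
    have H1 : psi1 y ^+ 2 <= (3 * (y ^+ 2 * g y)) ^+ 2.
      by rewrite lerXn2r// nnegrE (le_trans h1).
    apply: (le_trans H1).
    have H2 : psi y * (kappa * (y * g y)) <= psi y * psi2 y.
      by rewrite ler_wpM2l// mulr_ge0 ?exprn_ge0.
    have -> : (3 * (y ^+ 2 * g y)) ^+ 2 = 9 / kappa * (psi y * (kappa * (y * g y))).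
      by rewrite /psi; field; rewrite gt_eqF.
    by rewrite ler_wpM2l// divr_ge0// ltW.
  + move=> x /=; have y0 := m00 x; set y := m0 x in y0 *.
    have y1 : 0 < 1 + y by lra.
    rewrite -/(m0 x) -/y powRD ?(gt_eqF y1) ?implybT// powR_mulrn ?(ltW y1)// /psi /g.
    rewrite ler_wpM2r ?powR_ge0// lerXn2r// ?nnegrE; lra.
Qed.

End lyapunov.

(** The growth exponent [3 - r] is q capped at 2: the cap gives [r >= 1], and [1 < q] gives [r < 2],
    without which [kappa] would not be positive. *)
Lemma lyapunov_function (R : realType) (q : R) : 1 < q ->
  exists (Phi Phi1 Phi2 : R -> R) (c : R),
  [/\ forall x : R, is_derive x 1 Phi (Phi1 x), forall x : R, is_derive x 1 Phi1 (Phi2 x),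
      continuous Phi2, forall x, [/\ 0 <= Phi x, 0 <= Phi1 x & 0 <= Phi2 x] &
    [/\ forall x : R, x <= 0 -> Phi x = 0 /\ Phi1 x = 0, forall x : R, 0 < x -> 0 < Phi x,
      forall x, x * Phi1 x <= 3 * Phi x,
      0 <= c /\ forall x, Phi1 x ^+ 2 <= c * (Phi x * Phi2 x) &
      forall x, Phi x <= (1 + Num.max x 0) `^ q]].
Proof.
move=> q1; pose r := 3 - Num.min q 2.
have m2 : Num.min q 2 <= 2 by rewrite ge_min lexx orbT.
have m1 : 1 < Num.min q 2 by rewrite lt_min q1; lra.
have r1 : 1 <= r by rewrite /r; lra.
have r2 : r < 2 by rewrite /r; lra.
have [Phi [Phi1 [Phi2 [c [H1 H2 H3 H4 [H5 H6 H7 H8 H9]]]]]] := lyapunov_function_le2 r1 r2.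
exists Phi, Phi1, Phi2, c; split => //; split => // x.
apply: (le_trans (H9 x)); rewrite ler_powR//; first by rewrite lerDl le_max lexx orbT.
by rewrite /r subKr ge_min lexx.
Qed.

(** * Uniform continuity on segments and a one-sided Taylor bound *)

Section real_analysis.
Context (R : realType).
Implicit Types (f : R -> R) (a b : R).

Lemma within_continuous_itvP f a b : {within `[a, b], continuous f} <->
  forall x, a <= x <= b -> forall e, 0 < e -> exists2 d, 0 < d &
    forall y, a <= y <= b -> `|x - y| < d -> `|f x - f y| < e.
Proof.
split=> [/subspace_continuousP H x xab e e0|H].
  have /cvgrPdist_lt/(_ e e0) : f @ within `[a, b]%classic (nbhs x) --> f x.
    by apply: H; rewrite /= in_itv.
  rewrite near_withinE => /nbhs_ballP[d /= d0 Hd]; exists d => // y yab xy.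
  by apply: Hd => //=; rewrite in_itv.
apply/subspace_continuousP => x; rewrite /= in_itv/= => xab.
apply/cvgrPdist_lt => e e0; rewrite near_withinE.
have [d d0 Hd] := H x xab e e0; apply/nbhs_ballP; exists d => //= y xy.
by rewrite in_itv/= => yab; exact: Hd.
Qed.

(** Heine's theorem, from compactness in its near-covering form: around each point the modulus is
    halved, so that it serves all nearby points. *)
Lemma heine_itv f a b : {within `[a, b], continuous f} ->
  forall e, 0 < e -> exists2 d, 0 < d &
    forall x y, a <= x <= b -> a <= y <= b -> `|x - y| < d -> `|f x - f y| < e.
Proof.
move=> /within_continuous_itvP cf e e0.
pose Q d x := forall y, a <= y <= b -> `|x - y| < d -> a <= x <= b -> `|f x - f y| < e.
have /compact_near_coveringP/(_ R (0 : R)^'+ Q _) := @segment_compact R a b.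
have e20 : 0 < e / 2 by rewrite divr_gt0.
case=> [x /=|d /= d0 H].
  rewrite in_itv/= => xab; have [d d0 Hd] := cf x xab _ e20.
  exists (ball x (d / 2), [set r | r < d / 2]) => /=.
    split; first by apply: nbhsx_ballx; rewrite divr_gt0.
    by apply: nbhs_right_lt; rewrite divr_gt0.
  move=> [z r] /= [xz rd] y yab zy zab.
  have h1 := Hd z zab; have h2 := Hd y yab.
  move: xz; rewrite /ball/= => xz.
  have : `|f x - f z| < e / 2 by apply: h1; lra.
  have : `|f x - f y| < e / 2.
    apply: h2; apply: (le_lt_trans (ler_distD z _ _)); lra.
  move=> h3 h4; apply: (le_lt_trans (ler_distD (f x) _ _)).
  rewrite distrC; lra.
have d20 : 0 < d / 2 by rewrite divr_gt0.
exists (d / 2) => // x y xab yab xy.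
apply: (H (d / 2) _ _ x) => //=; rewrite ?in_itv//.
by rewrite /ball/= sub0r normrN gtr0_norm//; lra.
Qed.

Lemma continuous_is_derive f (df : R -> R) : (forall x : R, is_derive x 1 f (df x)) ->
  continuous f.
Proof.
move=> h x; apply: differentiable_continuous; apply/derivable1_diffP.
by have [+ _] := h x.
Qed.

Lemma continuous_within f a b : continuous f -> {within `[a, b], continuous f}.
Proof. by move=> cf; exact: continuous_subspaceT. Qed.

Lemma within_continuous_bounded f a b : {within `[a, b], continuous f} ->
  exists2 K : R, 0 <= K & forall x, a <= x <= b -> `|f x| <= K.
Proof.
move=> cf; have [ab|ba] := leP a b; last first.
  by exists 0 => // x /andP[ax xb]; move: (le_trans ax xb); rewrite leNgt ba.
have cf' : {within `[a, b], continuous (fun x => `|f x|)}.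
  apply/within_continuous_itvP => x xab e e0.
  move/within_continuous_itvP : cf => /(_ x xab e e0)[d d0 Hd]; exists d => // y yab xy.
  exact: le_lt_trans (ler_dist_dist _ _) (Hd y yab xy).
have [c cab Hc] := EVT_max ab cf'.
exists `|f c| => // x xab; apply: Hc; by rewrite in_itv.
Qed.

(** [Phi2] is merely continuous, so the second order coefficient is lowered by [del] in exchange for
    a range of [u] that is uniform in [x]. The mean value theorem is applied to [Phi1], then to the
    remainder. *)
Lemma taylor2_ge (Phi Phi1 Phi2 : R -> R) :
  (forall x : R, is_derive x 1 Phi (Phi1 x)) -> (forall x : R, is_derive x 1 Phi1 (Phi2 x)) ->
  continuous Phi2 -> forall K del, 0 < del -> exists2 eta, 0 < eta &
    forall x u, `|x| <= K -> `|u| <= eta ->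
      Phi x + Phi1 x * u + (Phi2 x - del) / 2 * u ^+ 2 <= Phi (x + u).
Proof.
move=> d1 d2 c2 K del del0.
have [eta eta0 Heta] := heine_itv (continuous_within (a := - K - 1) (b := K + 1) c2) del0.
exists (Num.min (eta / 2) 1); first by rewrite lt_min divr_gt0 ?ltr01.
move=> x u xK; rewrite le_min => /andP[u_eta u1].
have H2 v : `|v| <= `|u| -> Phi2 x - del <= Phi2 (x + v).
  move=> vu; have : `|Phi2 x - Phi2 (x + v)| < del.
    move: xK; rewrite ler_norml => /andP[xK1 xK2].
    have : `|v| <= 1 by exact: le_trans u1.
    rewrite ler_norml => /andP[v1 v2].
    apply: Heta; [apply/andP; split; lra..|].
    by rewrite opprD addrA subrr sub0r normrN; lra.
  by rewrite ltr_norml => /andP[]; lra.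
have c1 := continuous_is_derive d2; have c0 := continuous_is_derive d1.
have mvt (f df : R -> R) (df' : forall y : R, is_derive y 1 f (df y)) p q : p < q ->
    exists2 z, p < z < q & f q - f p = df z * (q - p).
  move=> pq; have [z] := MVT pq (fun y _ => df' y) (continuous_within (continuous_is_derive df')).
  by rewrite in_itv/=; exists z.
have H1p v : 0 <= v -> v <= `|u| -> Phi1 x + (Phi2 x - del) * v <= Phi1 (x + v).
  rewrite le_eqVlt => /orP[/eqP <- _|v0 vu]; first by rewrite mulr0 !addr0.
  have xv : x < x + v by rewrite ltrDl.
  have [z /andP[z1 z2] E] := mvt _ _ d2 _ _ xv.
  have := H2 (z - x); rewrite (addrC x) subrK => Hz.
  have zxu : `|z - x| <= `|u| by rewrite ger0_norm; lra.
  have {Hz} := ler_wpM2r (ltW v0) (Hz zxu).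
  move: E; rewrite (addrC x v) addrK; lra.
have H1n v : 0 <= v -> v <= `|u| -> Phi1 (x - v) <= Phi1 x - (Phi2 x - del) * v.
  rewrite le_eqVlt => /orP[/eqP <- _|v0 vu]; first by rewrite mulr0 !subr0.
  have xv : x - v < x by rewrite ltrBlDr ltrDl.
  have [z /andP[z1 z2] E] := mvt _ _ d2 _ _ xv.
  have := H2 (z - x); rewrite (addrC x) subrK => Hz.
  have zxu : `|z - x| <= `|u| by rewrite ler0_norm; lra.
  have {Hz} := ler_wpM2r (ltW v0) (Hz zxu).
  move: E; rewrite opprB addrCA subrr addr0; lra.
(* The derivative of [G] has the sign of [v] on the range considered, so [G] is least at 0. *)
pose G (v : R) := Phi (x + v) - Phi1 x * v - (Phi2 x - del) / 2 * v ^+ 2.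
pose G1 (v : R) := Phi1 (x + v) - Phi1 x - (Phi2 x - del) * v.
have dG (v : R) : is_derive v 1 G (G1 v).
  have ha : is_derive v 1 (fun w : R => x + w) 1.
    have h := is_deriveD1 (is_derive_cst (x : R) v (1 : R)) (is_derive_id v (1 : R)).
    by apply: (is_derive_conv h); rewrite add0r.
  have h1 := is_derive1_comp (f := Phi) (d1 (x + v)) ha.
  have h2 := is_deriveZ1 (- Phi1 x) (is_derive_id v (1 : R)).
  have h3 := is_deriveZ1 (- ((Phi2 x - del) / 2)) (is_deriveM1 (is_derive_id v (1 : R)) (is_derive_id v (1 : R))).
  have h := is_deriveD1 (is_deriveD1 h1 h2) h3.
  have -> : G = (fun w => (Phi \o (fun w : R => x + w)) w + - Phi1 x * id w + - ((Phi2 x - del) / 2) * (id w * id w)).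
    by apply/funext => w; rewrite /G /=; ring.
  by apply: (is_derive_conv h); rewrite /G1; field.
suff : G 0 <= G u by rewrite /G addr0; lra.
have [u0|u0|->] := ltgtP u 0; last by [].
- have [z /andP[z1 z2] E] := mvt _ _ dG _ _ u0.
  have := H1n (- z); rewrite opprK oppr_ge0 => /(_ (ltW z2)).
  have zu : - z <= `|u| by rewrite ltr0_norm; lra.
  move=> /(_ zu) h; have : G1 z <= 0 by rewrite /G1; lra.
  have u0' : 0 <= 0 - u by lra.
  by move=> /(ler_wpM2r u0'); rewrite mul0r -E; lra.
- have [z /andP[z1 z2] E] := mvt _ _ dG _ _ u0.
  have := H1p z (ltW z1).
  have zu : z <= `|u| by rewrite gtr0_norm; lra.
  move=> /(_ zu) h; have : 0 <= G1 z by rewrite /G1; lra.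
  have u0' : 0 <= u - 0 by lra.
  by move=> /(ler_wpM2r u0'); rewrite mul0r -E; lra.
Qed.

End real_analysis.

(** * The inequality along a path *)

Section integral_facts.
Context (R : realType).
Local Notation mu := lebesgue_measure.
Implicit Types (f : R -> R) (a b c : R).

Lemma Rintegral_ge0_ae (D : set (measurableTypeR R)) f : measurable D -> mu.-integrable D (EFin \o f) ->
  {ae mu, forall r, D r -> 0 <= f r} -> 0 <= \int[mu]_(r in D) f r.
Proof.
move=> mD fi f0; have /integrableP[mf _] := fi.
rewrite /Rintegral (ae_eq_integral (fun r : measurableTypeR R => (Num.max (f r) 0)%:E))//.
- apply: fine_ge0; apply: integral_ge0 => r _.
  by rewrite lee_fin le_max lexx orbT.
- apply/measurable_EFinP; apply: measurable_maxr => //; exact/measurable_EFinP.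
- by apply: filterS f0 => r h Dr; rewrite max_l// h.
Qed.

Lemma integrable_itvS f a b a' b' : a <= a' -> b' <= b ->
  mu.-integrable `[a, b] (EFin \o f) -> mu.-integrable `[a', b'] (EFin \o f).
Proof.
move=> aa bb; apply: integrableS => //= x /=; rewrite !in_itv/= => /andP[h1 h2].
by rewrite (le_trans aa h1) (le_trans h2 bb).
Qed.

Lemma Rintegral_itv_cat f a b c : a <= b -> b <= c ->
  mu.-integrable `[a, c] (EFin \o f) ->
  \int[mu]_(r in `[a, c]) f r = \int[mu]_(r in `[a, b]) f r + \int[mu]_(r in `[b, c]) f r.
Proof.
move=> ab bc fi.
have H := @Rintegral_itvB _ f (BLeft a) (BRight c) b fi.
have e : \int[mu]_(x in `]b, c]) f x = \int[mu]_(x in `[b, c]) f x.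
  apply: Rintegral_itv_obnd_cbnd; apply: integrableS fi => //= x /=.
  by rewrite !in_itv/= => /andP[h1 ->]; rewrite andbT (le_trans ab)// ltW.
by rewrite -e -H ?bnd_simp// addrC subrK.
Qed.

Lemma sum_telescope_le (g : nat -> R) (m : nat) :
  \sum_(k < m) (g k.+1 - g k) = g m - g 0%N.
Proof.
elim: m => [|m IH]; first by rewrite big_ord0 subrr.
by rewrite big_ord_recr /= IH; ring.
Qed.

Lemma dist_norm_le (x y e K : R) : `|x - y| <= e -> e <= 1 -> `|y| <= K -> `|x| <= K + 1.
Proof. by rewrite !ler_norml => /andP[? ?] ? /andP[? ?]; apply/andP; split; lra. Qed.

Lemma dist_lt_of_le (x y a o d : R) : `|x - y| <= a * o -> 0 <= a <= 3 -> 0 < o -> o <= d / 4 ->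
  `|x - y| < d.
Proof.
move=> h /andP[a0 a3] o0 od; have : a * o <= 3 * o by rewrite ler_wpM2r// ltW.
lra.
Qed.

Lemma dist_ltD (x y e : R) : `|x - y| < e -> x <= y + e.
Proof. by rewrite ltr_norml => /andP[_]; lra. Qed.

Lemma mesh_dist_lt (s s' r r' e d : R) : s <= r <= s' -> s <= r' <= s' -> s' <= s + e -> 0 < e -> e <= d / 2 ->
  `|r - r'| < d.
Proof. by move=> /andP[? ?] /andP[? ?] ? ? ?; rewrite ltr_norml; apply/andP; split; lra. Qed.

Lemma dist3_le (x y z a b o : R) : `|x - y| <= a -> `|z - y| <= b -> a + b <= o -> `|x - z| <= o.
Proof.
move=> h1; rewrite distrC => h2 h3.
by apply: le_trans h3; apply: (le_trans (ler_distD y _ _)); rewrite lerD.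
Qed.

(** The bookkeeping that ends [path_inequality]. The error [e] is shared in thirds by the
    oscillation [tau], the Young parameter [tau'] and the quadratic error [eta3]; the 2 in [D1] pays
    for [tau] at both ends of the sum. *)
Lemma path_error_budget (W tau tau' e del Kk VV CK LC lt Cb D1 D2 eta3 SE Px0 Px Psg Psg' : R) :
  Psg <= Psg' + W * tau ->
  W * SE <= W * ((tau * LC + Cb * tau') * lt + CK + eta3 + 2 * tau * VV + del / 2 * Kk) ->
  W * eta3 <= e / 3 -> tau <= W * tau ->
  D1 = LC * lt + CK / tau + 2 * VV + 2 -> W * (D1 * tau) <= e / 3 -> D2 = Cb * lt -> W * (D2 * tau') <= e / 3 ->
  Px0 <= Px + tau -> 0 < tau ->
  Psg - Px + W * SE <= Psg' - Px0 + del / 2 * W * Kk + e.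
Proof.
move=> f1 f2 f3 f4 -> f5 -> f6 f7 t0.
have e1 : CK / tau * tau = CK by rewrite divfK// gt_eqF.
have e2 : W * (CK / tau * tau) = W * CK by rewrite e1.
lra.
Qed.

Lemma small_factor (D e : R) : 0 <= D -> 0 < e -> exists2 t, 0 < t <= 1 & D * t <= e.
Proof.
move=> D0 e0; exists (Num.min 1 (e / (D + 1))).
  by rewrite lt_min ltr01 divr_gt0 ?ltr_wpDl//= ge_min lexx.
apply: (@le_trans _ _ ((D + 1) * (e / (D + 1)))).
  by rewrite ler_pM ?lerDl// ?le_min ?ler01 ?divr_ge0 ?addr_ge0 ?(ltW e0)// ge_min lexx orbT.
by rewrite mulrC divfK// gt_eqF// ltr_wpDl.
Qed.

End integral_facts.

Section path_inequality.
Context (R : realType) (t0 t1 : R).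
Local Notation mu := lebesgue_measure.
Variables (Phi Phi1 Phi2 : R -> R) (c : R).
Hypothesis dPhi : forall x : R, is_derive x 1 Phi (Phi1 x).
Hypothesis dPhi1 : forall x : R, is_derive x 1 Phi1 (Phi2 x).
Hypothesis cPhi2 : continuous Phi2.
Hypothesis Phi_ge0 : forall x, [/\ 0 <= Phi x, 0 <= Phi1 x & 0 <= Phi2 x].
Hypothesis Phi_neg : forall x : R, x <= 0 -> Phi x = 0 /\ Phi1 x = 0.
Hypothesis xPhi1_le : forall x, x * Phi1 x <= 3 * Phi x.
Hypothesis c_ge0 : 0 <= c.
Hypothesis Phi1_sqr : forall x, Phi1 x ^+ 2 <= c * (Phi x * Phi2 x).

Variables (X A gam z kap k : R -> R) (m C : R).
Hypotheses (m0 : 0 <= m) (C0 : 0 <= C) (t01 : t0 <= t1).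
Hypothesis cX : {within `[t0, t1], continuous X}.
Hypothesis cA : {within `[t0, t1], continuous A}.
Hypothesis igam : mu.-integrable `[t0, t1] (EFin \o gam).
Hypothesis mz : measurable_fun `[t0, t1]%classic (z : measurableTypeR R -> R).
Hypothesis iz2 : mu.-integrable `[t0, t1] (EFin \o (fun r => z r ^+ 2)).
Hypothesis ndkap : forall s s', t0 <= s -> s <= s' -> s' <= t1 -> kap s <= kap s'.
Hypothesis ndk : forall s s', t0 <= s -> s <= s' -> s' <= t1 -> k s <= k s'.
Hypothesis AE : forall s s', t0 <= s -> s <= s' -> s' <= t1 ->
  A s' - A s = \int[mu]_(r in `[s, s']) gam r + (kap s' - kap s) - (k s' - k s).
Hypothesis kflat : forall s s', t0 <= s -> s <= s' -> s' <= t1 ->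
  (forall r, s <= r <= s' -> 0 < X r) -> k s' = k s.
Hypothesis gam_ge : {ae mu, forall r : measurableTypeR R, `[t0, t1]%classic r -> 0 < X r ->
  - gam r <= m * X r + C * z r}.

Lemma integrable_sqrB (s s' h : R) : t0 <= s -> s <= s' -> s' <= t1 ->
  mu.-integrable `[s, s'] (EFin \o (fun r => (h - z r) ^+ 2)).
Proof.
move=> s0 ss s1.
have mz' : measurable_fun `[s, s']%classic (z : measurableTypeR R -> R).
  apply: measurable_funS mz => //= r /=; rewrite !in_itv/= => /andP[h1 h2].
  by rewrite (le_trans s0 h1) (le_trans h2 s1).
have fin : (mu `[s, s']%classic < +oo)%E.
  by rewrite lebesgue_measure_itv; case: ifP => _; rewrite ?ltry.
have ic r : mu.-integrable `[s, s'] (EFin \o cst r).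
  by apply: measurable_bounded_integrable => //; exact: bounded_cst.
apply: (@le_integrable_EFin _ (measurableTypeR R) _ mu _ _ (fun r => cst (2 * h ^+ 2) r + 2 * z r ^+ 2)) => //.
- by apply: measurable_funX; apply: measurable_funB.
- move=> r _ /=; rewrite ger0_norm ?sqr_ge0//.
  have -> : (h - z r) ^+ 2 = 2 * h ^+ 2 + 2 * z r ^+ 2 - (h + z r) ^+ 2 by ring.
  by have := sqr_ge0 (h + z r); lra.
- apply: integrableD_EFin => //; apply: integrableZ_EFin => //.
  exact: (integrable_itvS s0 s1).
Qed.

(** Over one cell [Phi1 (X r)] is frozen at [a], at the cost of [tau], and [z r] at [h]. Where
    [X r <= 0] the function [Phi1] vanishes, so the drift bound is used only where it is assumed. *)
Lemma drift_integral_ge (s s' a h tau tau' E b : R) : t0 <= s -> s <= s' -> s' <= t1 ->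
  0 <= a -> 0 <= h -> 0 <= tau -> 0 < tau' -> 0 <= b ->
  (forall r, s <= r <= s' -> `|Phi1 (X r) - a| <= tau) ->
  (forall r, s <= r <= s' -> Phi1 (X r) <= b) ->
  (forall r, s <= r <= s' -> Phi (X r) <= E) ->
  - ((3 * m * E + C * (a + tau) * h + C * b * tau') * (s' - s)
     + C * b / tau' * \int[mu]_(r in `[s, s']) (h - z r) ^+ 2
     + tau * \int[mu]_(r in `[s, s']) `|gam r|)
  <= a * \int[mu]_(r in `[s, s']) gam r.
Proof.
move=> s0 ss s1 a0 h0 tau0 tau'0 b0 Ha Hb HE.
have mI : measurable (`[s, s']%classic : set R) by [].
have fin : (mu `[s, s']%classic < +oo)%E.
  by rewrite lebesgue_measure_itv; case: ifP => _; rewrite ?ltry.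
have ic r : mu.-integrable `[s, s'] (EFin \o cst r).
  by apply: measurable_bounded_integrable => //; exact: bounded_cst.
have ig := integrable_itvS s0 s1 igam.
have iag : mu.-integrable `[s, s'] (EFin \o (fun r => `|gam r|)) by exact: integrable_norm.
have iq := integrable_sqrB h s0 ss s1.
have [D DE] : {D | D = 3 * m * E + C * (a + tau) * h + C * b * tau'} by eexists.
have e1 : \int[mu]_(r in `[s, s']) (cst D r) = D * (s' - s).
  rewrite Rintegral_cst//; congr (D * _); transitivity (fine (mu `[s, s']%classic)) => //.
  rewrite lebesgue_measure_itv/= lte_fin.
  move: ss; rewrite le_eqVlt => /orP[/eqP ->|->]; first by rewrite ltxx subrr.
  by [].
have i1 : mu.-integrable `[s, s'] (EFin \o (fun r => a * gam r)) by exact: integrableZ_EFin.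
have i3 : mu.-integrable `[s, s'] (EFin \o (fun r => C * b / tau' * (h - z r) ^+ 2)) by exact: integrableZ_EFin.
have i4 : mu.-integrable `[s, s'] (EFin \o (fun r => tau * `|gam r|)) by exact: integrableZ_EFin.
have i34 : mu.-integrable `[s, s'] (EFin \o (fun r => C * b / tau' * (h - z r) ^+ 2 + tau * `|gam r|)) by exact: integrableD_EFin.
have i234 : mu.-integrable `[s, s'] (EFin \o (fun r => cst D r + (C * b / tau' * (h - z r) ^+ 2 + tau * `|gam r|))).
  by apply: integrableD_EFin.
suff H : 0 <= \int[mu]_(r in `[s, s']) (a * gam r +
   (cst D r + (C * b / tau' * (h - z r) ^+ 2 + tau * `|gam r|))).
  move: H; rewrite !RintegralD// !RintegralZl// e1 DE.
  move: (\int[mu]_(r in _) gam r) (\int[mu]_(r in _) ((h - z r) ^+ 2)) (\int[mu]_(r in _) `|gam r|).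
  by move=> I1 I2 I3; lra.
apply: Rintegral_ge0_ae => //; first exact: integrableD_EFin.
apply: filterS gam_ge => r Hr /=; rewrite in_itv/= => rss.
have [r1 r2] := andP rss.
have rt : `[t0, t1]%classic r by rewrite /= in_itv/= (le_trans s0)// (le_trans r2).
have [p0 p10 _] := Phi_ge0 (X r).
have E0 : Phi (X r) <= E := HE r rss.
have mE : m * Phi (X r) <= m * E by rewrite ler_wpM2l.
have g1 : - (tau * `|gam r|) <= (a - Phi1 (X r)) * gam r.
  rewrite lerNl -mulrN; apply: (le_trans (ler_norm _)); rewrite normrM normrN.
  by rewrite ler_wpM2r// distrC; exact: Ha.
(* Only the square of [h - z] is controlled by the approximation; the parameter [tau'] trades the
   first power for it. *)
have sq : `|h - z r| <= tau' + (h - z r) ^+ 2 / tau'.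
  rewrite -(real_normK (num_real (h - z r))); set y := `|h - z r|.
  have y0 : 0 <= y by exact: normr_ge0.
  have -> : tau' + y ^+ 2 / tau' = (tau' ^+ 2 + y ^+ 2) / tau' by field; rewrite gt_eqF.
  rewrite ler_pdivlMr//.
  have := sqr_ge0 (y - tau'); have : 0 <= y * tau' by rewrite mulr_ge0// ltW.
  lra.
have CB : 0 <= C * b by rewrite mulr_ge0.
have sqC := ler_wpM2l CB sq.
have CB2 : C * b / tau' * (h - z r) ^+ 2 = C * b * ((h - z r) ^+ 2 / tau') by ring.
rewrite CB2.
have main : - (3 * m * E + C * (a + tau) * h + C * b * `|h - z r|) <= Phi1 (X r) * gam r.
  have rhs0 : 0 <= 3 * m * E + C * (a + tau) * h + C * b * `|h - z r|.
    rewrite !addr_ge0 ?mulr_ge0 ?addr_ge0//.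
    exact: le_trans E0.
  have [X0|X0] := leP (X r) 0.
    by have [_ ->] := Phi_neg X0; rewrite mul0r oppr_le0.
  have := ler_wpM2l p10 (Hr rt X0).
  have xp := xPhi1_le (X r).
  have : Phi1 (X r) * (C * z r) <= C * (a + tau) * h + C * b * `|h - z r|.
    have zh : z r <= h + `|h - z r|.
      by rewrite addrC -lerBlDr distrC ler_norm.
    have h1 : Phi1 (X r) * (C * z r) <= Phi1 (X r) * C * h + Phi1 (X r) * C * `|h - z r|.
      by rewrite -mulrDr mulrA ler_wpM2l// mulr_ge0.
    have pa : Phi1 (X r) <= a + tau.
      by have := Ha r rss; rewrite ler_norml => /andP[_]; lra.
    have h2 : Phi1 (X r) * C * h <= C * (a + tau) * h.
      by rewrite ler_wpM2r// mulrC ler_wpM2l.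
    have h3 : Phi1 (X r) * C * `|h - z r| <= C * b * `|h - z r|.
      by rewrite ler_wpM2r// mulrC ler_wpM2l//; exact: Hb.
    lra.
  have : m * (X r * Phi1 (X r)) <= m * (3 * Phi (X r)) by rewrite ler_wpM2l.
  lra.
rewrite DE; lra.
Qed.

(** [3 * m] absorbs [m x Phi'] through [x Phi' <= 3 Phi]; the second term is what remains of
    [C z Phi'] once [Phi'' z^2 / 2] has been spent. *)
Definition lyapunov_rate := 3 * m + C ^+ 2 * c / 2.
Local Notation Lam := lyapunov_rate.
Definition lyapunov_weight (s : R) := expR (Lam * (s - t0)).
Local Notation w := lyapunov_weight.

Lemma lyapunov_rate_ge0 : 0 <= Lam.
Proof. by rewrite /Lam addr_ge0 ?mulr_ge0 ?sqr_ge0. Qed.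

Lemma lyapunov_weight_ge1 s : t0 <= s -> 1 <= w s.
Proof. by move=> s0; rewrite -expR0 ler_expR mulr_ge0 ?lyapunov_rate_ge0 ?subr_ge0. Qed.

Lemma lyapunov_weight_le s : s <= t1 -> w s <= w t1.
Proof. by move=> s1; rewrite ler_expR ler_wpM2l ?lyapunov_rate_ge0 ?lerB. Qed.

(** The left side is a weighted martingale step with integrand of norm [h]; on the right a
    telescoping difference and error terms that are summable over the grid. *)
Lemma path_step (s s' x x' u h del tau tau' b : R) : t0 <= s -> s <= s' -> s' <= t1 ->
  0 <= h -> 0 <= tau -> 0 < tau' -> 0 <= b ->
  x' = x + (A s' - A s + u) ->
  (forall r, s <= r <= s' -> `|Phi1 (X r) - Phi1 x| <= tau) ->
  (forall r, s <= r <= s' -> Phi1 (X r) <= b) ->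
  (forall r, s <= r <= s' -> Phi (X r) <= Phi x' + tau) ->
  Phi x <= Phi x' + tau ->
  Phi x + Phi1 x * (A s' - A s + u) + (Phi2 x - del) / 2 * (A s' - A s + u) ^+ 2 <= Phi x' ->
  `|(Phi2 x - del) / 2| * (`|A s' - A s| + 2 * `|u|) <= tau ->
  w s * (Phi1 x * u + (Phi2 x - del) / 2 * (u ^+ 2 - h ^+ 2 * (s' - s))) <=
  w s' * Phi x' - w s * Phi x + w s * (
    (tau * (Lam + C) + C * b * tau') * (s' - s) + C * tau * (h ^+ 2 * (s' - s))
    + C * b / tau' * \int[mu]_(r in `[s, s']) (h - z r) ^+ 2
    + 2 * tau * (\int[mu]_(r in `[s, s']) `|gam r| + (kap s' - kap s) + (k s' - k s))
    + del / 2 * (h ^+ 2 * (s' - s))).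
Proof.
move=> s0 ss s1 h0 tau0 tau'0 b0 x'E Ha Hb HE Hx HT Hc.
have [p0 a0 p2] := Phi_ge0 x.
have [q0 _ _] := Phi_ge0 x'.
have c00 := c_ge0; have m00 := m0; have C00 := C0.
have dr := drift_integral_ge s0 ss s1 a0 h0 tau0 tau'0 b0 Ha Hb HE.
move: dr; set I1 := \int[mu]_(r in `[s, s']) gam r.
set I2 := \int[mu]_(r in `[s, s']) _ ^+ 2; set I3 := \int[mu]_(r in `[s, s']) `|gam r| => dr.
set dA := A s' - A s in x'E HT Hc.
have dAE : dA = I1 + (kap s' - kap s) - (k s' - k s) by exact: AE.
have I3I1 : `|I1| <= I3.
  by apply: le_normr_Rintegral => //; exact: (integrable_itvS s0 s1 igam).
have dk0 : 0 <= kap s' - kap s by rewrite subr_ge0 ndkap.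
have dl0 : 0 <= k s' - k s by rewrite subr_ge0 ndk.
set dk := kap s' - kap s in dAE dk0 *; set dl := k s' - k s in dAE dl0 *.
have D0 : 0 <= s' - s by rewrite subr_ge0.
(* If [k] moves during the step, then by [kflat] X is nonpositive somewhere in it; there [Phi1] is
   0, so [Phi1 x] is at most the oscillation [tau]. *)
have dl_le : Phi1 x * dl <= tau * dl.
  have [dl00|dl00] := eqVneq dl 0; first by rewrite dl00 !mulr0.
  rewrite ler_wpM2r//.
  have [r rss Xr] : exists2 r, s <= r <= s' & X r <= 0.
    apply: contrapT => H; move/eqP: dl00; apply; apply/eqP.
    rewrite subr_eq0; apply/eqP; apply: kflat => // r rss.
    by rewrite ltNge; apply/negP => Xr; apply: H; exists r.
  have := Ha r rss; have [_ ->] := Phi_neg Xr.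
  by rewrite sub0r normrN ger0_norm.
have dA_le : `|dA| <= I3 + dk + dl.
  rewrite dAE; apply: (le_trans (ler_normB _ _)); rewrite (ger0_norm dl0) lerD2r.
  by apply: (le_trans (ler_normD _ _)); rewrite (ger0_norm dk0) lerD2r.
set b2 := (Phi2 x - del) / 2 in HT Hc *.
(* The part of the squared increment that involves [dA] is a small factor times the variation of A
   over the step. *)
have cross : - (tau * (I3 + dk + dl)) <= b2 * (dA ^+ 2 + 2 * (u * dA)).
  have : `|b2 * (dA ^+ 2 + 2 * (u * dA))| <= tau * (I3 + dk + dl).
    have -> : b2 * (dA ^+ 2 + 2 * (u * dA)) = (b2 * (dA + 2 * u)) * dA by ring.
    rewrite normrM ler_pM ?normr_ge0//; apply: le_trans Hc; rewrite normrM ler_wpM2l//.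
    by apply: (le_trans (ler_normD _ _)); rewrite normrM (ger0_norm (ler0n _ 2)).
  by rewrite ler_norml => /andP[].
(* The compensator of the second order term pays for the linear growth of the drift in z. Comparing
   squares avoids dividing by [Phi2 x], which may vanish. *)
have amgm : C * Phi1 x * h <= Phi2 x / 2 * h ^+ 2 + C ^+ 2 * c / 2 * Phi x.
  have H := Phi1_sqr x.
  have cP : 0 <= c * Phi x by rewrite mulr_ge0.
  have L0 : 0 <= Phi2 x * h ^+ 2 + C ^+ 2 * (c * Phi x) by rewrite addr_ge0 ?mulr_ge0 ?sqr_ge0.
  have : (2 * (C * Phi1 x * h)) ^+ 2 <= (Phi2 x * h ^+ 2 + C ^+ 2 * (c * Phi x)) ^+ 2.
    have e1 : (C * h) ^+ 2 * Phi1 x ^+ 2 <= (C * h) ^+ 2 * (c * (Phi x * Phi2 x)).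
      by rewrite ler_wpM2l ?sqr_ge0.
    have := sqr_ge0 (Phi2 x * h ^+ 2 - C ^+ 2 * (c * Phi x)); lra.
  rewrite ler_sqr ?nnegrE ?mulr_ge0//; lra.
have w0 : 0 < w s by exact: expR_gt0.
have w1 : w s * (1 + Lam * (s' - s)) <= w s'.
  have -> : w s' = w s * expR (Lam * (s' - s)).
    by rewrite /w -expRD; congr expR; ring.
  by rewrite ler_pM2l// expR_ge1Dx.
have w2 : w s * (1 + Lam * (s' - s)) * Phi x' <= w s' * Phi x' by rewrite ler_wpM2r.
suff H : Phi1 x * u + b2 * (u ^+ 2 - h ^+ 2 * (s' - s)) <=
   (1 + Lam * (s' - s)) * Phi x' - Phi x + (
    (tau * (Lam + C) + C * b * tau') * (s' - s) + C * tau * (h ^+ 2 * (s' - s))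
    + C * b / tau' * I2 + 2 * tau * (I3 + dk + dl) + del / 2 * (h ^+ 2 * (s' - s))).
  have := ler_wpM2l (ltW w0) H; lra.
(* [h] is exchanged for [1 + h ^+ 2], since lengths and brackets are what is bounded after
   summation. *)
have hD : tau * (h * (s' - s)) * C <= tau * ((1 + h ^+ 2) * (s' - s)) * C.
  rewrite ler_wpM2r// ler_wpM2l// ler_wpM2r//.
  have := sqr_ge0 (h - 1); have := sqr_ge0 h; lra.
have e1 := ler_wpM2r D0 amgm.
have e2 : (C ^+ 2 * c / 2 * (s' - s)) * Phi x <= (C ^+ 2 * c / 2 * (s' - s)) * (Phi x' + tau).
  by rewrite ler_wpM2l// mulr_ge0 ?divr_ge0 ?mulr_ge0 ?sqr_ge0.
have b2E : b2 * (h ^+ 2 * (s' - s)) = Phi2 x / 2 * h ^+ 2 * (s' - s) - del / 2 * (h ^+ 2 * (s' - s)).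
  by rewrite /b2; field.
have aE : Phi1 x * dA = Phi1 x * I1 + Phi1 x * dk - Phi1 x * dl by rewrite dAE; ring.
have adk : 0 <= Phi1 x * dk by rewrite mulr_ge0.
have tI3 : 0 <= tau * dk by rewrite mulr_ge0.
rewrite /Lam; clearbody b2 dA dk dl I1 I2 I3.
lra.
Qed.

(** [eta] depends on the path, so the inequality will hold for each path from some rank on, with no
    uniform rate. The index [sg] is free because the sum is to be stopped, and the bracket is
    controlled only up to it. *)
Lemma path_inequality (K del e : R) : 0 <= K -> 0 < del -> 0 < e -> exists2 eta : R, 0 < eta &
  forall (N : nat) (s x u h : nat -> R), s 0%N = t0 ->
    (forall k, (k <= N)%N -> t0 <= s k <= t1) ->
    (forall k, (k < N)%N -> s k <= s k.+1 <= s k + eta) ->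
    (forall k, (k <= N)%N -> `|x k - X (s k)| <= eta) ->
    (forall k, (k < N)%N -> x k.+1 = x k + (A (s k.+1) - A (s k) + u k)) ->
    (forall k, (k < N)%N -> 0 <= h k) ->
    \sum_(k < N) \int[mu]_(r in `[s k, s k.+1]) (h k - z r) ^+ 2 <= eta ->
  forall sg, (sg <= N)%N -> \sum_(k < sg) h k ^+ 2 * (s k.+1 - s k) <= K ->
  \sum_(k < sg) w (s k) * (Phi1 (x k) * u k +
      (Phi2 (x k) - del) / 2 * (u k ^+ 2 - h k ^+ 2 * (s k.+1 - s k))) <=
    w (s sg) * Phi (X (s sg)) - Phi (X t0) + del / 2 * w t1 * K + e.
Proof.
move=> K0 del0 e0.
have cPhi := continuous_is_derive dPhi; have cPhi1 := continuous_is_derive dPhi1.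
have [KX KX0 HKX] := within_continuous_bounded cX.
have C00 := C0; have m00 := m0; have c00 := c_ge0; have t010 := t01.
have L0 := lyapunov_rate_ge0.
(* The margin 1 accommodates the approximate path [x], which stays within [eta <= 1] of X. *)
pose KK := KX + 1.
have [b b0 Hb] := within_continuous_bounded (continuous_within (a := - KK) (b := KK) cPhi1).
have [B2 B20 HB2] : exists2 B2 : R, 0 <= B2 & forall x, `|x| <= KK -> `|(Phi2 x - del) / 2| <= B2.
  have [B2 B20 HB2] := within_continuous_bounded (continuous_within (a := - KK) (b := KK) cPhi2).
  exists ((B2 + del) / 2) => [|x xK]; first by rewrite divr_ge0// addr_ge0// ltW.
  have : - KK <= x <= KK by rewrite -ler_norml.
  move=> /HB2; rewrite !ler_norml => /andP[h1 h2]; apply/andP; split; lra.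
pose W := w t1.
have W1 : 1 <= W by exact: lyapunov_weight_ge1.
have W0 : 0 <= W by lra.
pose Gam s := \int[mu]_(r in `[t0, s]) `|gam r|.
have GamE s s' : t0 <= s -> s <= s' -> s' <= t1 ->
    \int[mu]_(r in `[s, s']) `|gam r| = Gam s' - Gam s.
  move=> s0 ss s1; rewrite /Gam (@Rintegral_itv_cat _ _ t0 s s')//; first by ring.
  by apply: integrable_norm => //; exact: integrable_itvS igam.
pose VV := (Gam t1 - Gam t0) + (kap t1 - kap t0) + (k t1 - k t0).
have VV_ge s : t0 <= s -> s <= t1 -> (Gam s - Gam t0) + (kap s - kap t0) + (k s - k t0) <= VV.
  move=> s0 s1; rewrite /VV !lerD ?lerB ?ndkap ?ndk// -subr_ge0.
  rewrite -GamE//; apply: fine_ge0; apply: integral_ge0 => r _.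
  by rewrite lee_fin.
have VV0 : 0 <= VV by have := VV_ge _ (lexx t0) t01; rewrite !subrr !add0r.
clearbody VV.
pose D1 := (Lam + C) * (t1 - t0) + C * K + 2 * VV + 2.
have D10 : 0 <= D1.
  have h1 : 0 <= (Lam + C) * (t1 - t0) by rewrite mulr_ge0 ?subr_ge0// addr_ge0.
  have h2 : 0 <= C * K by rewrite mulr_ge0.
  by rewrite /D1; lra.
have e30 : 0 < e / 3 by rewrite divr_gt0.
have [tau /andP[tau0 tau1] Htau] := small_factor (mulr_ge0 W0 D10) e30.
pose D2 := C * b * (t1 - t0).
have D20 : 0 <= D2 by rewrite /D2 !mulr_ge0 ?subr_ge0.
have [tau' /andP[tau'0 tau'1] Htau'] := small_factor (mulr_ge0 W0 D20) e30.
(* This factor multiplies the quadratic error, so [tau'] has to be fixed before [eta1]. *)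
pose D3 := C * b / tau'.
have D30 : 0 <= D3 by rewrite /D3 divr_ge0 ?mulr_ge0// ltW.
have [eta1 /andP[eta10 eta11] Heta1] := small_factor (mulr_ge0 W0 D30) e30.
have [d1 d10 Hd1] := heine_itv (continuous_within (a := - KK) (b := KK) cPhi) tau0.
have [d2 d20 Hd2] := heine_itv (continuous_within (a := - KK) (b := KK) cPhi1) tau0.
have [d3 d30 Hd3] := taylor2_ge dPhi dPhi1 cPhi2 KK del0.
(* In units of the oscillation [om] below, the step of A is at most 1 and that of [x] at most 3, so
   [u] is at most 4: the 9 is [1 + 2 * 4]. *)
have B90 : 0 <= B2 * 9 by rewrite mulr_ge0.
have [d4 /andP[d40 d41] Hd4] := small_factor B90 tau0.
pose om := Num.min (Num.min (d1 / 4) (d2 / 4)) (Num.min (d3 / 4) d4).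
have om0 : 0 < om by rewrite !lt_min d40 !divr_gt0.
have [om1 om2 om3 om4] : [/\ om <= d1 / 4, om <= d2 / 4, om <= d3 / 4 & om <= d4].
  by rewrite /om !ge_min !lexx !orbT.
clearbody om.
have [d5 d50 Hd5] := heine_itv cX om0.
have [d6 d60 Hd6] := heine_itv cA om0.
pose eta := Num.min (Num.min (Num.min om 1) eta1) (Num.min (d5 / 2) (d6 / 2)).
have eta0 : 0 < eta by rewrite !lt_min om0 ltr01 eta10 !divr_gt0.
have [eo e1 ee e5 e6] : [/\ eta <= om, eta <= 1, eta <= eta1, eta <= d5 / 2 & eta <= d6 / 2].
  by rewrite /eta !ge_min !lexx !orbT.
clearbody eta.
exists eta => // N s x u h s0E Hs Hmesh Hx Hxs Hh HI sg sgN HK.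
have xKK k0 : (k0 <= N)%N -> `|x k0| <= KK.
  by move=> kN; exact: (dist_norm_le (Hx _ kN) e1 (HKX _ (Hs _ kN))).
have XKK r : t0 <= r <= t1 -> `|X r| <= KK.
  by move=> /HKX h1; apply: (le_trans h1); rewrite lerDl.
have P1 p q a : `|p| <= KK -> `|q| <= KK -> `|p - q| <= a * om -> 0 <= a <= 3 -> Phi p <= Phi q + tau.
  rewrite (ler_norml p) (ler_norml q) => pK qK pq a3.
  exact/dist_ltD/Hd1/(dist_lt_of_le pq a3 om0 om1).
have P2 p q a : `|p| <= KK -> `|q| <= KK -> `|p - q| <= a * om -> 0 <= a <= 3 -> `|Phi1 p - Phi1 q| <= tau.
  rewrite (ler_norml p) (ler_norml q) => pK qK pq a3.
  exact/ltW/Hd2/(dist_lt_of_le pq a3 om0 om2).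
have a23 : 0 <= (2 : R) <= 3 by rewrite ler0n ler_nat.
have a33 : 0 <= (3 : R) <= 3 by rewrite ler0n lexx.
have a13 : 0 <= (1 : R) <= 3 by rewrite ler01 ler1n.
have om_2 : om + om = 2 * om by rewrite mulr_natl.
have om_3 : om + 2 * om = 3 * om by rewrite -[X in X + _]mul1r -mulrDl.
pose err k0 := (tau * (Lam + C) + C * b * tau') * (s k0.+1 - s k0) + C * tau * (h k0 ^+ 2 * (s k0.+1 - s k0))
    + C * b / tau' * \int[mu]_(r in `[s k0, s k0.+1]) (h k0 - z r) ^+ 2
    + 2 * tau * (\int[mu]_(r in `[s k0, s k0.+1]) `|gam r| + (kap (s k0.+1) - kap (s k0)) + (k (s k0.+1) - k (s k0)))
    + del / 2 * (h k0 ^+ 2 * (s k0.+1 - s k0)).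
have step k0 : (k0 < sg)%N ->
  w (s k0) * (Phi1 (x k0) * u k0 + (Phi2 (x k0) - del) / 2 * (u k0 ^+ 2 - h k0 ^+ 2 * (s k0.+1 - s k0)))
   <= (w (s k0.+1) * Phi (x k0.+1) - w (s k0) * Phi (x k0)) + w t1 * err k0.
  move=> ksg; have kN : (k0 < N)%N := leq_trans ksg sgN.
  have kN' := ltnW kN.
  have /andP[sk0 sk1] := Hs _ kN'; have /andP[sk0' sk1'] := Hs _ kN.
  have /andP[ss sse] := Hmesh _ kN.
  have xr r : s k0 <= r <= s k0.+1 -> t0 <= r <= t1.
    by case/andP => r1 r2; rewrite (le_trans sk0 r1) (le_trans r2 sk1').
  have l0 : s k0 <= s k0 <= s k0.+1 by rewrite lexx.
  have l1 : s k0 <= s k0.+1 <= s k0.+1 by rewrite lexx andbT.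
  have XX r r' : s k0 <= r <= s k0.+1 -> s k0 <= r' <= s k0.+1 -> `|X r - X r'| <= om.
    move=> rss rss'; apply/ltW/Hd5; [exact: xr|exact: xr|].
    exact: (mesh_dist_lt rss rss' sse eta0 e5).
  have Xr r : s k0 <= r <= s k0.+1 -> `|X r - x k0| <= 2 * om.
    move=> rss; apply: (dist3_le (XX _ _ rss l0) (Hx _ kN')).
    by rewrite -om_2 lerD2l.
  have Xr' r : s k0 <= r <= s k0.+1 -> `|X r - x k0.+1| <= 2 * om.
    move=> rss; apply: (dist3_le (XX _ _ rss l1) (Hx _ kN)).
    by rewrite -om_2 lerD2l.
  have xx : `|x k0.+1 - x k0| <= 3 * om.
    apply: (dist3_le (Hx _ kN) (_ : `|x k0 - X (s k0.+1)| <= 2 * om)).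
      by rewrite distrC; exact: Xr.
    by rewrite -om_3 lerD2r.
  have dA : `|A (s k0.+1) - A (s k0)| <= om.
    by apply/ltW/Hd6; [exact: xr|exact: xr|exact: (mesh_dist_lt l1 l0 sse eta0 e6)].
  have dAu : A (s k0.+1) - A (s k0) + u k0 = x k0.+1 - x k0.
    by rewrite Hxs// (addrC (x k0)) addrK.
  have um : `|u k0| <= 3 * om + om.
    have -> : u k0 = (x k0.+1 - x k0) - (A (s k0.+1) - A (s k0)).
      by rewrite -dAu addrC addKr.
    by apply: (le_trans (ler_normB _ _)); rewrite lerD.
  have := @path_step (s k0) (s k0.+1) (x k0) (x k0.+1) (u k0) (h k0) del tau tau' b.
  move=> /(_ sk0 ss sk1' (Hh _ kN) (ltW tau0) tau'0 b0 (Hxs _ kN)) H.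
  apply: (le_trans (H _ _ _ _ _ _)).
  - by move=> r rss; apply: (P2 _ _ 2) => //; [exact/XKK/xr|exact: xKK|exact: Xr].
  - move=> r rss; apply: (le_trans (ler_norm _)); apply: Hb.
    by rewrite -ler_norml; exact/XKK/xr.
  - by move=> r rss; apply: (P1 _ _ 2) => //; [exact/XKK/xr|exact: xKK|exact: Xr'].
  - by apply: (P1 _ _ 3) => //; [exact: xKK|exact: xKK|rewrite distrC].
  - have := Hd3 _ _ (xKK _ kN') (ltW (dist_lt_of_le xx a33 om0 om3)).
    by rewrite dAu (addrC (x k0)) subrK.
  - apply: (@le_trans _ _ (B2 * (om + 2 * (3 * om + om)))).
      by rewrite ler_pM ?addr_ge0 ?mulr_ge0//; [exact/HB2/xKK|rewrite lerD// ler_pM2l].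
    apply: le_trans Hd4; rewrite -mulrA ler_wpM2l//.
    have -> : om + 2 * (3 * om + om) = 9 * om by ring.
    by rewrite ler_pM2l.
  rewrite lerD2l ler_wpM2r ?lyapunov_weight_le// /err.
  have D0 : 0 <= s k0.+1 - s k0 by rewrite subr_ge0.
  have hD0 : 0 <= h k0 ^+ 2 * (s k0.+1 - s k0) by rewrite mulr_ge0 ?sqr_ge0.
  have i1 : 0 <= \int[mu]_(r in `[s k0, s k0.+1]) (h k0 - z r) ^+ 2.
    by apply: fine_ge0; apply: integral_ge0 => r _; rewrite lee_fin sqr_ge0.
  have i2 : 0 <= \int[mu]_(r in `[s k0, s k0.+1]) `|gam r|.
    by apply: fine_ge0; apply: integral_ge0 => r _; rewrite lee_fin.
  have ndkap' : 0 <= kap (s k0.+1) - kap (s k0) by rewrite subr_ge0 ndkap.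
  have ndk' : 0 <= k (s k0.+1) - k (s k0) by rewrite subr_ge0 ndk.
  have t0' := ltW tau0; have t0'' := ltW tau'0; have d0' := ltW del0.
  have h0 : 0 <= tau * (Lam + C) + C * b * tau' by rewrite addr_ge0 ?mulr_ge0// addr_ge0.
  have h1 := mulr_ge0 h0 D0; have h2 := mulr_ge0 (mulr_ge0 C00 t0') hD0.
  have h3 : 0 <= D3 * _ := mulr_ge0 D30 i1.
  have h4 : 0 <= 2 * tau * _ := mulr_ge0 (mulr_ge0 (ler0n _ 2) t0') (addr_ge0 (addr_ge0 i2 ndkap') ndk').
  have h5 : 0 <= del / 2 * _ := mulr_ge0 (divr_ge0 d0' (ler0n _ 2)) hD0.
  exact: addr_ge0 (addr_ge0 (addr_ge0 (addr_ge0 h1 h2) h3) h4) h5.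
apply: (@le_trans _ _ (\sum_(k0 < sg) ((w (s k0.+1) * Phi (x k0.+1) - w (s k0) * Phi (x k0)) + w t1 * err k0))).
  by apply: ler_sum => k0 _; exact: step.
have /andP[sg0 sg1] := Hs _ sgN.
rewrite big_split /= (sum_telescope_le (fun k0 => w (s k0) * Phi (x k0))) -mulr_sumr.
have errE : \sum_(k0 < sg) err k0 <= (tau * (Lam + C) + C * b * tau') * (t1 - t0) + C * tau * K
   + C * b / tau' * eta + 2 * tau * VV + del / 2 * K.
  rewrite /err !big_split /= -!mulr_sumr.
  have t0' := ltW tau0; have t0'' := ltW tau'0; have d0' := ltW del0.
  apply: lerD; last by rewrite ler_wpM2l// divr_ge0.
  apply: lerD; first apply: lerD; first apply: lerD.
  - have h0 : 0 <= tau * (Lam + C) + C * b * tau' by rewrite addr_ge0 ?mulr_ge0// addr_ge0.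
    rewrite ler_wpM2l//.
    by rewrite (sum_telescope_le s) s0E lerD2r.
  - by rewrite ler_wpM2l ?mulr_ge0.
  - rewrite ler_wpM2l//; apply: le_trans HI.
    rewrite (big_ord_widen N (fun k0 => \int[mu]_(r in `[s k0, s k0.+1]) (h k0 - z r) ^+ 2))//.
    rewrite [leRHS](bigID (fun i : 'I_N => (i < sg)%N)) /= lerDl; apply: sumr_ge0 => i _.
    by apply: fine_ge0; apply: integral_ge0 => r _; rewrite lee_fin sqr_ge0.
  - rewrite ler_wpM2l ?mulr_ge0//.
    pose G3 r := Gam r + kap r + k r.
    rewrite (eq_bigr (fun i : 'I_sg => G3 (s i.+1) - G3 (s i))); last first.
      move=> i _; have iN := leq_trans (ltn_ord i) sgN.
      have /andP[? ?] := Hs _ (ltnW iN); have /andP[? ?] := Hs _ iN; have /andP[? ?] := Hmesh _ iN.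
      by rewrite GamE// /G3; ring.
    rewrite (sum_telescope_le (fun i => G3 (s i))) s0E.
    apply: le_trans (VV_ge _ sg0 sg1); rewrite le_eqVlt; apply/orP; left; apply/eqP.
    by rewrite /G3; ring.
have wsg : 0 <= w (s sg) <= W by rewrite lyapunov_weight_le// expR_ge0.
have [wsg0 wsg1] := andP wsg.
have xsg : Phi (x sg) <= Phi (X (s sg)) + tau.
  apply: (P1 _ _ 1) => //; [exact: xKK|exact/XKK/Hs|].
  by rewrite mul1r (le_trans (Hx _ sgN)).
have x0 : Phi (X t0) <= Phi (x 0%N) + tau.
  have := Hx _ (leq0n N); rewrite s0E distrC => h0.
  apply: (P1 _ _ 1) => //; [by apply: XKK; rewrite lexx|exact: xKK|].
  by rewrite mul1r (le_trans h0).
have w00 : w (s 0%N) = 1 by rewrite s0E /w subrr mulr0 expR0.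
rewrite w00 mul1r.
have t0' := ltW tau0.
have f1 : w (s sg) * Phi (x sg) <= w (s sg) * Phi (X (s sg)) + W * tau.
  apply: (le_trans (ler_wpM2l wsg0 xsg)); rewrite mulrDr lerD2l.
  by rewrite ler_wpM2r.
have f2 := ler_wpM2l W0 errE.
have f3 : W * (C * b / tau' * eta) <= e / 3.
  by apply: le_trans Heta1; rewrite mulrA; apply: ler_wpM2l => //; rewrite mulr_ge0.
have f4 : tau <= W * tau by rewrite ler_peMl.
have f5 : W * (D1 * tau) <= e / 3 by rewrite mulrA.
have f6 : W * (D2 * tau') <= e / 3 by rewrite mulrA.
apply: (path_error_budget f1 f2 f3 f4 _ f5 (erefl _) f6 x0 tau0).
by rewrite /D1 mulrAC mulfK// gt_eqF.
Qed.

End path_inequality.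

(** * Comparison along grids *)

Section expectation_limits.
Context d (Omega : measurableType d) (R : realType) (P : probability Omega R).
Implicit Types (f g : Omega -> R) (M : nat -> Omega -> R).

(** Fatou needs a lower bound, which [M j] lacks, so it is applied to the positive part of
    [a - M j]. Since [max (a - x) 0 <= a - x + x^2 / (4 a)], the right side being
    [(2 a - x)^2 / (4 a)], its mean is at most [a + C / (4 a)]. In the limit the mean of [a + f - g]
    has the same bound, and a tends to infinity. *)
Lemma expectation_le_of_eventually_le M f g (C : R) :
  (forall j, P.-integrable setT (EFin \o M j)) ->
  (forall j, P.-integrable setT (EFin \o (fun w => M j w ^+ 2))) ->
  (forall j, \int[P]_w M j w = 0) -> (forall j, \int[P]_w (M j w ^+ 2) <= C) ->
  P.-integrable setT (EFin \o f) -> P.-integrable setT (EFin \o g) ->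
  {ae P, forall w, exists J, forall j, (J <= j)%N -> M j w <= g w - f w} ->
  \int[P]_w f w <= \int[P]_w g w.
Proof.
move=> iM iM2 EM EM2 if_ ig H.
have C0 : 0 <= C.
  by apply: le_trans (EM2 0%N); apply: Rintegral_ge0 => w _; exact: sqr_ge0.
suff key (a : R) : 0 < a -> \int[P]_w f w <= \int[P]_w g w + C / (4 * a).
  apply/ler_addgt0Pr => e e0.
  apply: (le_trans (key ((C + 1) / (4 * e)) _)); first by rewrite divr_gt0 ?mulr_gt0// ltr_wpDl.
  rewrite lerD2l -[leRHS]mul1r.
  have -> : C / (4 * ((C + 1) / (4 * e))) = (C / (C + 1)) * e.
    by field; rewrite !gt_eqF// ltr_wpDl.
  by rewrite ler_pM2r// ler_pdivrMr ?mul1r ?lerDl// ltr_wpDl.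
move=> a0.
pose G j w : R := Num.max (a - M j w) 0.
pose Q j w : R := (cst a w - M j w) + (4 * a)^-1 * M j w ^+ 2.
pose L w : R := Num.max (cst a w + (f w - g w)) 0.
have ic r : P.-integrable setT (EFin \o cst r) by exact: finite_measure_integrable_cst.
have mM j : measurable_fun setT (M j) by have /integrableP[/measurable_EFinP] := iM j.
have mf : measurable_fun setT f by have /integrableP[/measurable_EFinP] := if_.
have mg : measurable_fun setT g by have /integrableP[/measurable_EFinP] := ig.
have mG j : measurable_fun setT (EFin \o G j).
  apply/measurable_EFinP; apply: measurable_maxr => //.
  by apply: measurable_funB.
have G0 j w : (0 <= (EFin \o G j) w)%E by rewrite /= lee_fin /G le_max lexx orbT.
have Gle j w : G j w <= a - M j w + (4 * a)^-1 * M j w ^+ 2.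
  have e1 : a - M j w + (4 * a)^-1 * M j w ^+ 2 = (2 * a - M j w) ^+ 2 / (4 * a).
    by field; rewrite gt_eqF.
  rewrite /G ge_max; apply/andP; split.
    by rewrite lerDl mulr_ge0 ?sqr_ge0// invr_ge0 mulr_ge0// ltW.
  by rewrite e1 mulr_ge0 ?sqr_ge0// invr_ge0 mulr_ge0// ltW.
have i1 j : P.-integrable setT (EFin \o (fun w => cst a w - M j w)) by exact: integrableB_EFin.
have i2 j : P.-integrable setT (EFin \o (fun w => (4 * a)^-1 * M j w ^+ 2)) by exact: integrableZ_EFin.
have EG j : (\int[P]_w (EFin \o G j) w <= (a + C / (4 * a))%:E)%E.
  apply: (@le_trans _ _ (\int[P]_w (EFin \o Q j) w)%E).
    apply: ge0_le_integral => //.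
    - by apply/measurable_EFinP; apply: measurable_funD; [apply: measurable_funB|apply: measurable_funM => //; apply: measurable_funX].
    - by move=> w _; rewrite /= lee_fin.
  have i3 := integrableD_EFin measurableT (i1 j) (i2 j).
  rewrite -[leLHS](@fineK _ (\int[P]_w _)%E); last exact: integrable_fin_num.
  rewrite lee_fin [leLHS](_ : _ = \int[P]_w ((cst a w - M j w) + (4 * a)^-1 * M j w ^+ 2))//.
  rewrite RintegralD// RintegralB// RintegralZl// EM subr0 Rintegral_cst// [X in fine X]probability_setT mulr1.
  by rewrite lerD2l mulrC ler_wpM2r// invr_ge0 mulr_ge0// ltW.
have iL : P.-integrable setT (EFin \o (fun w => cst a w + (f w - g w))).
  by apply: integrableD_EFin => //; exact: integrableB_EFin.
have F : (\int[P]_w (EFin \o L) w <= (a + C / (4 * a))%:E)%E.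
  apply: (@le_trans _ _ (\int[P]_w limn_einf ((fun j => EFin \o G j) ^~ w))%E).
    apply: ae_ge0_le_integral => //.
    - by move=> w _; rewrite /= lee_fin le_max lexx orbT.
    - apply/measurable_EFinP; apply: measurable_maxr => //.
      by apply: measurable_funD => //; apply: measurable_funB.
    - move=> w _; rewrite limn_einf_lim.
      apply: lime_ge; first exact: is_cvg_einfs.
      by apply: nearW => m; apply: le_ereal_inf_tmp => _ [k _ <-].
    - rewrite (_ : (fun w => _) = (fun w => - limn_esup (-%E \o (fun j => (EFin \o G j) w)))%E); last first.
        by apply/funext => w; rewrite limn_esupN oppeK.
      apply: measurableT_comp => //; apply: measurable_fun_limn_esup => j.
      exact: measurableT_comp.
    - apply: filterS H => w [J HJ] _; rewrite limn_einf_lim.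
      apply: lime_ge; first exact: is_cvg_einfs.
      exists J => // m /= Jm; apply: le_ereal_inf_tmp => _ [k /= mk <-].
      have := HJ _ (leq_trans Jm mk); rewrite /= lee_fin /G /cst => h.
      by rewrite /L ge_max !le_max lexx orbT andbT /=; apply/orP; left; lra.
  have FT := @fatou _ _ _ P setT measurableT (fun j => EFin \o G j) mG (fun j w _ => G0 j w).
  apply: (le_trans FT).
  rewrite limn_einf_lim; apply: lime_le; first exact: is_cvg_einfs.
  apply: nearW => m; apply: (@le_trans _ _ (\int[P]_w (EFin \o G m) w)%E) => //.
  by apply: ereal_inf_lbound; exists m => /=.
have : \int[P]_w (cst a w + (f w - g w)) <= a + C / (4 * a).
  rewrite -lee_fin; apply: le_trans F.
  rewrite /Rintegral fineK; last exact: integrable_fin_num.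
  apply: le_integral => //.
    apply: (le_integrable_EFin measurableT (g := fun w => `|cst a w + (f w - g w)|)).
    - apply: measurable_maxr => //; by apply: measurable_funD => //; apply: measurable_funB.
    - by move=> w _; rewrite ger0_norm ?le_max ?lexx ?orbT// ge_max ler_norm normr_ge0.
    - exact: integrable_norm.
  by move=> w _; rewrite /= lee_fin le_max lexx.
rewrite RintegralD//; last exact: integrableB_EFin.
rewrite RintegralB// Rintegral_cst// [X in fine X]probability_setT mulr1.
by move: (\int[P]_w f w) (\int[P]_w g w) => F1 G1; lra.
Qed.

Lemma expectation_indic_cvg0 (A : nat -> set Omega) g (c : R) : (forall k, measurable (A k)) ->
  P.-integrable setT (EFin \o g) -> (forall w, 0 <= g w) ->
  {ae P, forall w, exists J, forall j, (J <= j)%N -> ~ A j w} ->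
  (forall k, c <= \int[P]_w (\1_(A k) w * g w)) -> c <= 0.
Proof.
move=> mA ig g0 H Hc.
have mg : measurable_fun setT g by have /integrableP[/measurable_EFinP] := ig.
have mf k : measurable_fun setT (EFin \o (fun w => \1_(A k) w * g w)).
  by apply/measurable_EFinP; apply: measurable_funM.
pose f_ k := EFin \o (fun w => \1_(A k) w * g w).
have cv : {ae P, forall w, setT w -> f_ ^~ w @ \oo --> cst 0%E w}.
  apply: filterS H => w [J HJ] _ /=; apply: cvg_near_cst; exists J => // k /= Jk.
  by rewrite /f_ /= indicE memNset ?mul0r//; exact: HJ.
have dom : {ae P, forall w k, setT w -> (`|f_ k w| <= (EFin \o g) w)%E}.
  apply/aeW => w k _ /=; rewrite lee_fin normrM (ger0_norm (g0 w)) ler_piMl//.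
  by rewrite indicE ger0_norm// lern1 leq_b1.
have [_ _] := dominated_convergence measurableT mf (measurable_cst _) cv ig dom.
rewrite integral0 => h; rewrite -lee_fin.
apply: (@cvge_ge _ _ _ _ _ _ c%:E _ h); apply: nearW => k /=.
rewrite -[leRHS]fineK ?lee_fin; first exact: Hc.
apply: integrable_fin_num => //; apply: (le_integrable_EFin measurableT (g := g)) => //.
  by apply/measurable_EFinP.
by move=> w _; rewrite normrM (ger0_norm (g0 w)) indicE ler_piMl// ger0_norm// lern1 leq_b1.
Qed.

End expectation_limits.

(** Reads a stopping index off a decreasing family of events, path by path. *)
Lemma stop_index (Q : nat -> Prop) (N : nat) : (forall k, (k.+1 < N)%N -> Q k.+1 -> Q k) ->
  exists2 sg, (sg <= N)%N & forall k, (k < N)%N -> Q k <-> (k < sg)%N.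
Proof.
elim: N => [_|N IHN Qd]; first by exists 0%N.
have [|sg sgN Hsg] := IHN; first by move=> k kN; apply: Qd; exact: ltnW.
have [QN|nQN] := pselect (Q N).
  exists N.+1 => // k kN; split => // _.
  have H i : Q (N - i)%N.
    elim: i => [|i IH]; rewrite ?subn0// subnS.
    case E : (N - i)%N IH => [|l] //=; apply: Qd; rewrite ltnS -E; exact: leq_subr.
  by rewrite -(subKn (_ : k <= N)%N)//; exact: H.
exists sg; first exact: leqW.
move=> k; rewrite ltnS leq_eqVlt => /orP[/eqP ->|]; last exact: Hsg.
by split=> // Nsg; move: sgN; rewrite leqNgt Nsg.
Qed.

Lemma sum_stop (R : realType) (b : nat -> bool) (f : nat -> R) (N sg : nat) : (sg <= N)%N ->
  (forall k, (k < N)%N -> b k = (k < sg)%N) ->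
  \sum_(k < N) (b k)%:R * f k = \sum_(k < sg) f k.
Proof.
move=> sgN H; rewrite (big_ord_widen _ f sgN) [RHS]big_mkcond/=; apply: eq_bigr => k _.
by rewrite H//; case: ifP => _; rewrite ?mul1r ?mul0r.
Qed.

(* X moves by A plus a martingale; A has density gam and singular parts kap
   (pushing X up) and k (pushing X down, only while X is not positive). *)
Record drift_path (R : realType) (t0 t1 m C : R) (X A gam z kap k : R -> R) : Prop := DriftPath {
  dp_cX : {within `[t0, t1], continuous X} ;
  dp_cA : {within `[t0, t1], continuous A} ;
  dp_igam : lebesgue_measure.-integrable `[t0, t1] (EFin \o gam) ;
  dp_mz : measurable_fun `[t0, t1]%classic (z : measurableTypeR R -> R) ;
  dp_iz2 : lebesgue_measure.-integrable `[t0, t1] (EFin \o (fun r => z r ^+ 2)) ;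
  dp_ndkap : forall s s' : R, t0 <= s -> s <= s' -> s' <= t1 -> kap s <= kap s' ;
  dp_ndk : forall s s' : R, t0 <= s -> s <= s' -> s' <= t1 -> k s <= k s' ;
  dp_A : forall s s' : R, t0 <= s -> s <= s' -> s' <= t1 ->
    A s' - A s = \int[lebesgue_measure]_(r in `[s, s']) gam r + (kap s' - kap s) - (k s' - k s) ;
  dp_kflat : forall s s' : R, t0 <= s -> s <= s' -> s' <= t1 ->
    (forall r, s <= r <= s' -> 0 < X r) -> k s' = k s ;
  dp_gam : {ae lebesgue_measure, forall r : measurableTypeR R, `[t0, t1]%classic r -> 0 < X r ->
    - gam r <= m * X r + C * z r} }.

(** Bounds the bracket along the grid by the energy of z, so that a path of moderate energy is not
    stopped on a fine grid. *)
Lemma quad_sum_le (R : realType) (t0 t1 : R) (z : R -> R) (N : nat) (s h : nat -> R) :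
  measurable_fun `[t0, t1]%classic (z : measurableTypeR R -> R) ->
  lebesgue_measure.-integrable `[t0, t1] (EFin \o (fun r => z r ^+ 2)) ->
  s 0%N = t0 -> (forall k, (k <= N)%N -> t0 <= s k <= t1) ->
  (forall k, (k < N)%N -> s k <= s k.+1) ->
  \sum_(k < N) h k ^+ 2 * (s k.+1 - s k) <=
    2 * (\sum_(k < N) \int[lebesgue_measure]_(r in `[s k, s k.+1]) (h k - z r) ^+ 2)
    + 2 * \int[lebesgue_measure]_(r in `[t0, t1]) z r ^+ 2.
Proof.
move=> mz iz2 s0E Hs Hss.
pose G r := \int[lebesgue_measure]_(u in `[t0, r]) z u ^+ 2.
have GE r r' : t0 <= r -> r <= r' -> r' <= t1 ->
    G r' - G r = \int[lebesgue_measure]_(u in `[r, r']) z u ^+ 2.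
  move=> r0 rr r1; rewrite /G (@Rintegral_itv_cat _ _ t0 r r')//; first by rewrite addrC addKr.
  exact: integrable_itvS iz2.
have Gge0 r r' : 0 <= \int[lebesgue_measure]_(u in `[r, r']) z u ^+ 2.
  by apply: fine_ge0; apply: integral_ge0 => u _; rewrite lee_fin sqr_ge0.
apply: (@le_trans _ _ (2 * (\sum_(k < N) \int[lebesgue_measure]_(r in `[s k, s k.+1]) (h k - z r) ^+ 2)
   + 2 * \sum_(k < N) (G (s k.+1) - G (s k)))); last first.
  rewrite (sum_telescope_le (fun k => G (s k))) s0E lerD2l ler_wpM2l//.
  have /andP[sN0 sN1] := Hs _ (leqnn N).
  rewrite -(GE t0 t1)//; first by rewrite lerD2r -subr_ge0 (GE (s N) t1).
  exact: le_trans sN1.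
rewrite !mulr_sumr -big_split /=; apply: ler_sum => k _.
have /andP[sk0 _] := Hs _ (ltnW (ltn_ord k)); have /andP[_ sk1] := Hs _ (ltn_ord k).
have ss := Hss _ (ltn_ord k).
have mI : measurable (`[s k, s k.+1]%classic : set R) by [].
have fin : (lebesgue_measure `[s k, s k.+1]%classic < +oo)%E.
  by rewrite lebesgue_measure_itv; case: ifP => _; rewrite ?ltry.
have iq := integrable_sqrB mz iz2 (h k) sk0 ss sk1.
have iz := integrable_itvS sk0 sk1 iz2.
have ic r : lebesgue_measure.-integrable `[s k, s k.+1] (EFin \o cst r).
  by apply: measurable_bounded_integrable => //; exact: bounded_cst.
rewrite (GE (s k) (s k.+1))// -!RintegralZl// -RintegralD//; [|exact: integrableZ_EFin..].
have -> : h k ^+ 2 * (s k.+1 - s k) = \int[lebesgue_measure]_(r in `[s k, s k.+1]) (cst (h k ^+ 2) r).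
  rewrite Rintegral_cst//; congr (_ * _); transitivity (fine (lebesgue_measure `[s k, s k.+1]%classic)) => //.
  rewrite lebesgue_measure_itv/= lte_fin.
  move: ss; rewrite le_eqVlt => /orP[/eqP ->|->]; first by rewrite ltxx subrr.
  by [].
apply: le_Rintegral => //.
  by apply: integrableD_EFin => //; exact: integrableZ_EFin.
move=> r _ /=; have := sqr_ge0 (h k - 2 * z r).
have -> : 2 * (h k - z r) ^+ 2 + 2 * z r ^+ 2 = h k ^+ 2 + (h k - 2 * z r) ^+ 2 by ring.
by rewrite lerDl.
Qed.

Lemma le_add_half2 (R : realFieldType) (p1 p2 p3 p4 e : R) : p1 <= p2 -> p4 <= e / 2 ->
  p1 - p3 + p4 + e / 2 <= p2 + e - p3.
Proof. lra. Qed.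

Section grid_comparison_core.
Context (R : realType) (T : R) (n : nat) d (Omega : measurableType d).
Context (P : probability Omega R) (B : R -> Omega -> 'rV[R]_n).
Hypotheses (cP : measure_is_complete P) (hB : brownian_motion P T B).
Local Notation mu := lebesgue_measure.
Local Notation adapted t X := (adapted_at (brownian_gen P B) t X).
Variables (q t0 t1 m C : R).
Hypotheses (q1 : 1 < q) (t00 : 0 <= t0) (t01 : t0 <= t1) (t1T : t1 <= T) (m0 : 0 <= m) (C0 : 0 <= C).
Variables (X A gam z kap k : R -> Omega -> R) (S Q : Omega -> R).
Hypothesis Hpath : {ae P, forall w,
  drift_path t0 t1 m C (X ^~ w) (A ^~ w) (gam ^~ w) (z ^~ w) (kap ^~ w) (k ^~ w)}.
Hypothesis mX0 : measurable_fun setT (X t0).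
Hypothesis X1 : {ae P, forall w, X t1 w <= 0}.
Hypotheses (mS : measurable_fun setT S) (mQ : measurable_fun setT Q) (S_ge0 : forall w, 0 <= S w).
Hypothesis HS : {ae P, forall w, (forall t, t0 <= t <= t1 -> `|X t w| <= S w) /\
  \int[mu]_(r in `[t0, t1]) z r w ^+ 2 <= Q w}.
Hypothesis iS : P.-integrable setT (EFin \o (fun w => (1 + S w) `^ q)).

(** Along the j-th grid [s j], [x j] stands for X with its stochastic integral replaced by that of a
    process equal to [h j i] on the i-th cell. *)
Variables (N : nat -> nat) (s : nat -> nat -> R) (x : nat -> nat -> Omega -> R).
Variables (h : nat -> nat -> 'I_n -> Omega -> R) (ch : nat -> nat -> R).
Local Notation u j i := (dotW B (s j i) (s j i.+1) (h j i)).
Local Notation hn j i w := (Num.sqrt (\sum_(l < n) h j i l w ^+ 2)).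
Hypothesis s0 : forall j, s j 0%N = t0.
Hypothesis sN : forall j, s j (N j) = t1.
Hypothesis s_in : forall j i, (i <= N j)%N -> t0 <= s j i <= t1.
Hypothesis s_le : forall j i, (i < N j)%N -> s j i <= s j i.+1.
Hypothesis s_mesh : forall eta : R, 0 < eta -> exists J, forall j, (J <= j)%N ->
  forall i, (i < N j)%N -> s j i.+1 <= s j i + eta.
Hypothesis x_adapted : forall j i, (i <= N j)%N -> adapted (s j i) (x j i).
Hypothesis h_adapted : forall j i l, (i < N j)%N -> adapted (s j i) (h j i l).
Hypothesis h_le : forall j i, (i < N j)%N -> forall l w, `|h j i l w| <= ch j i.
Hypothesis x_step : {ae P, forall w, forall j i, (i < N j)%N ->
  x j i.+1 w = x j i w + (A (s j i.+1) w - A (s j i) w + u j i w)}.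
Hypothesis approx : {ae P, forall w, forall eta : R, 0 < eta -> exists J, forall j, (J <= j)%N ->
  (forall i, (i <= N j)%N -> `|x j i w - X (s j i) w| <= eta) /\
  \sum_(i < N j) \int[mu]_(r in `[s j i, s j i.+1]) (hn j i w - z r w) ^+ 2 <= eta}.

Lemma quadWE j i w : quadW (s j i) (s j i.+1) (h j i) w = hn j i w ^+ 2 * (s j i.+1 - s j i).
Proof. by rewrite /quadW sqr_sqrtr// sum_sqr_ge0. Qed.

Section one_level.
Variables (K : R) (j : nat).
Hypothesis K0 : 0 <= K.

(** The bracket is counted up to and including the coming step i, which is known at time [s j i]
    because [h j i] is. The event is thus adapted, and the bracket of the stopped sum never exceeds
    [K]. *)
Definition alive i : set Omega := [set w | (forall l, (l <= i)%N -> `|x j l w| <= K) /\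
  \sum_(l < i.+1) quadW (s j l) (s j l.+1) (h j l) w <= K].

Lemma quadW_j_ge0 i w : (i < N j)%N -> 0 <= quadW (s j i) (s j i.+1) (h j i) w.
Proof. by move=> iN; rewrite mulr_ge0 ?sum_sqr_ge0// subr_ge0 s_le. Qed.

Lemma s_mono i l : (i <= l)%N -> (l <= N j)%N -> s j i <= s j l.
Proof.
elim: l => [|l IH]; first by rewrite leqn0 => /eqP ->.
rewrite leq_eqVlt => /orP[/eqP ->//|il] lN.
by apply: (le_trans (IH il (ltnW lN))); exact: s_le.
Qed.

Lemma alive_adapted i : (i < N j)%N -> <<s brownian_gen P B (s j i) >> (alive i).
Proof.
move=> iN.
pose G := g_sigma_algebraType (brownian_gen P B (s j i)).
have h1 l : (l <= i)%N -> measurable ([set w | `|x j l w| <= K] : set G).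
  move=> li.
  have : adapted (s j i) (x j l).
    by apply: (adapted_le (s_mono li (ltnW iN))); apply: x_adapted; rewrite (leq_trans li)// ltnW.
  move=> ax; rewrite [X in measurable X](_ : _ = x j l @^-1` `[- K, K]); first exact: adapted_preimage.
  by apply/seteqP; split => w /=; rewrite in_itv/= ler_norml.
have h2 : measurable ([set w | \sum_(l < i.+1) quadW (s j l) (s j l.+1) (h j l) w <= K] : set G).
  have ah : measurable_fun setT (fun w : G => \sum_(l < i.+1) quadW (s j l) (s j l.+1) (h j l) w).
    apply: measurable_sum => l; apply: measurable_funM => //; apply: measurable_sum => o.
    apply: measurable_funX.
    have li : (l <= i)%N by rewrite -ltnS.
    apply: (adapted_le (s_mono li (ltnW iN))); apply: h_adapted; exact: leq_ltn_trans iN.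
  rewrite [X in measurable X](_ : _ = (fun w => \sum_(l < i.+1) quadW (s j l) (s j l.+1) (h j l) w) @^-1` `]-oo, K]).
    exact: adapted_preimage.
  by apply/seteqP; split => w /=; rewrite in_itv.
have -> : alive i = (\bigcap_(l in [set l | (l <= i)%N]) [set w | `|x j l w| <= K]) `&`
    [set w | \sum_(l < i.+1) quadW (s j l) (s j l.+1) (h j l) w <= K].
  by apply/seteqP; split.
apply: (@measurableI _ G) => //; apply: (@bigcap_measurable _ G) => //.
by exists i => /=.
Qed.

End one_level.

Section lyapunov_level.
Variables (Phi Phi1 Phi2 : R -> R) (c : R).
Hypothesis dPhi : forall x : R, is_derive x 1 Phi (Phi1 x).
Hypothesis dPhi1 : forall x : R, is_derive x 1 Phi1 (Phi2 x).
Hypothesis cPhi2 : continuous Phi2.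
Hypothesis Phi_ge0 : forall x, [/\ 0 <= Phi x, 0 <= Phi1 x & 0 <= Phi2 x].
Hypothesis Phi_neg : forall x : R, x <= 0 -> Phi x = 0 /\ Phi1 x = 0.
Hypothesis xPhi1_le : forall x, x * Phi1 x <= 3 * Phi x.
Hypothesis c_ge0 : 0 <= c.
Hypothesis Phi1_sqr : forall x, Phi1 x ^+ 2 <= c * (Phi x * Phi2 x).
Hypothesis Phi_le : forall x, Phi x <= (1 + Num.max x 0) `^ q.
Local Notation wt := (lyapunov_weight t0 c m C).

(** Outside this event no stopping occurs on fine grids: [x] is within 1 of X, and [quad_sum_le]
    bounds the bracket by [2 * Q] plus twice an error at most 1. *)
Definition large (K : R) : set Omega := [set w | K < S w + 1] `|` [set w | K < 2 * Q w + 2].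

Lemma measurable_large K : measurable (large K).
Proof.
apply: measurableU.
- rewrite [X in measurable X](_ : _ = S @^-1` `]K - 1, +oo[); first by rewrite -[X in measurable X]setTI; exact: mS.
  by apply/seteqP; split => w /=; rewrite in_itv/= andbT ltrBlDr.
- rewrite [X in measurable X](_ : _ = Q @^-1` `](K - 2) / 2, +oo[); first by rewrite -[X in measurable X]setTI; exact: mQ.
  by apply/seteqP; split => w /=; rewrite in_itv/= andbT ltr_pdivrMr// ltrBlDr mulrC.
Qed.

Lemma measurable_Phi : measurable_fun setT Phi.
Proof. by apply: continuous_measurable_fun; exact: continuous_is_derive dPhi. Qed.

Lemma Phi_X_le w t : `|X t w| <= S w -> Phi (X t w) <= (1 + S w) `^ q.
Proof.
move=> XS; apply: (le_trans (Phi_le _)); apply: ge0_ler_powR.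
- exact: le_trans ler01 (ltW q1).
- by rewrite nnegrE addr_ge0// le_max lexx orbT.
- by rewrite nnegrE addr_ge0.
- by rewrite lerD2l ge_max S_ge0 andbT (le_trans (ler_norm _)).
Qed.

Lemma integrable_Phi_X : P.-integrable setT (EFin \o (fun w => Phi (X t0 w))).
Proof.
have iS1 := iS; apply/integrableP; split.
  by apply/measurable_EFinP; apply: measurableT_comp => //; exact: measurable_Phi.
have /integrableP[_ /le_lt_trans] := iS; apply.
apply: ae_ge0_le_integral => //.
- do 2! apply: measurableT_comp => //.
  by apply: measurableT_comp => //; exact: measurable_Phi.
- by apply: measurableT_comp => //; have /integrableP[] := iS.
- move: Hpath HS; apply: filterS2 => w Hw [HX _] _ /=.
  have [p0 _ _] := Phi_ge0 (X t0 w).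
  rewrite lee_fin !ger0_norm ?powR_ge0//; apply: Phi_X_le; apply: HX.
  by rewrite lexx.
Qed.

(** The stopped transforms are centered, and eventually bounded above by the weighted value of
    [Phi (X)] at the stopping index minus the initial value, up to small terms. At the last index
    [Phi] vanishes, so only stopped paths contribute, and these lie in [large K]. *)
Lemma lyapunov_expectation_le (K kp : R) : 0 <= K -> 0 < kp ->
  \int[P]_w Phi (X t0 w) <= \int[P]_w (\1_(large K) w * (wt t1 * (1 + S w) `^ q)) + kp.
Proof.
move=> K0 kp0.
have cPhi1 := continuous_is_derive dPhi1.
have cc := c_ge0; have mm0 := m0; have CC0 := C0.
pose W := wt t1.
have W1 : 1 <= W by exact: lyapunov_weight_ge1.
have W0 : 0 < W by exact: lt_le_trans W1.
(* Chosen so that the Taylor loss [del / 2 * W * K] is at most [kp / 2]. *)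
pose del := kp / (W * (K + 1)).
have K1 : 0 < K + 1 by rewrite ltr_wpDl.
have del0 : 0 < del by rewrite divr_gt0// mulr_gt0.
have e0 : 0 < kp / 2 by rewrite divr_gt0.
have delK : del / 2 * W * K <= kp / 2.
  have -> : del / 2 * W * K = kp / 2 * (K / (K + 1)).
    by rewrite /del; field; rewrite !gt_eqF.
  by rewrite ler_piMr ?(ltW e0)// ler_pdivrMr// mul1r lerDl.
have [B1 B10 HB1] := within_continuous_bounded (continuous_within (a := - K) (b := K) cPhi1).
have [B2 B20 HB2] := within_continuous_bounded (continuous_within (a := - K) (b := K) cPhi2).
pose cst0 : R := W * (B1 + (B2 + del)).
pose chi j i w : R := \1_(alive K j i) w.
pose al j i w : R := chi j i w * (wt (s j i) * Phi1 (x j i w)).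
pose be j i w : R := chi j i w * (wt (s j i) * ((Phi2 (x j i w) - del) / 2)).
(* The integrand is cut together with the coefficients, so that the bracket is stopped as well and
   stays below [K]. *)
pose hh j i (l : 'I_n) w : R := chi j i w * h j i l w.
pose F j i w : R := wt (s j i) * (Phi1 (x j i w) * u j i w + (Phi2 (x j i w) - del) / 2 *
    (u j i w ^+ 2 - hn j i w ^+ 2 * (s j i.+1 - s j i))).
pose b j w i : bool := `[< alive K j i w >].
have chiE j i w : chi j i w = (b j w i)%:R.
  by rewrite /chi indicE /b; congr (nat_of_bool _)%:R; rewrite /in_mem/= /in_set.
have chi2 j i w : chi j i w ^+ 2 = chi j i w by rewrite chiE; case: (b _ _ _); rewrite ?expr1n ?expr0n.
have dotE j i w : dotW B (s j i) (s j i.+1) (hh j i) w = chi j i w * u j i w.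
  by rewrite /dotW mulr_sumr; apply: eq_bigr => l _; rewrite mulrA.
have quadE j i w : quadW (s j i) (s j i.+1) (hh j i) w = chi j i w * quadW (s j i) (s j i.+1) (h j i) w.
  rewrite /quadW mulrA; congr (_ * _); rewrite mulr_sumr; apply: eq_bigr => l _.
  by rewrite exprMn chi2.
have stepE j i w : mart_step B (s j i) (s j i.+1) (al j i) (be j i) (hh j i) w = (b j w i)%:R * F j i w.
  rewrite /mart_step dotE quadE quadWE /al /be /F chiE.
  by case: (b j w i); rewrite ?mul1r ?mul0r//; ring.
have aliveS j w i : (i.+1 < N j)%N -> alive K j i.+1 w -> alive K j i w.
  move=> iN [h1 h2]; split => [l li|]; first by apply: h1; exact: leqW.
  apply: le_trans h2; rewrite [leRHS]big_ord_recr/= lerDl.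
  exact: quadW_j_ge0.
have stopj j w : exists sg, [/\ (sg <= N j)%N, forall i, (i < N j)%N -> b j w i = (i < sg)%N &
    \sum_(i < sg) quadW (s j i) (s j i.+1) (h j i) w <= K].
  have [sg sgN Hsg] := stop_index (@aliveS j w).
  exists sg; split => //.
    by move=> i iN; apply/asboolP/idP => /Hsg; exact.
  case: sg sgN Hsg => [|sg] sgN Hsg; first by rewrite big_ord0.
  by have [_] : alive K j sg w by apply/Hsg.
have wt_bnd i j : (i < N j)%N -> 0 <= wt (s j i) <= W.
  move=> iN; have /andP[_ si] := s_in (ltnW iN).
  by rewrite expR_ge0 /W lyapunov_weight_le.
have HT j : transform_upto T P B (s j) (al j) (be j) (hh j) cst0 (ch j) (N j).
  have chi_adapted i : (i < N j)%N -> adapted (s j i) (chi j i).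
    by move=> iN; apply: measurable_indic; exact: alive_adapted.
  split.
  - move=> i iN; have /andP[si0 _] := s_in (ltnW iN); have /andP[_ si1] := s_in iN.
    by split; [exact: le_trans si0|exact: s_le|exact: le_trans t1T].
  - move=> i iN; have ax := x_adapted (ltnW iN); have ac := chi_adapted _ iN.
    split.
    + apply: measurable_funM => //; apply: measurable_funM => //.
      by apply: measurableT_comp => //; exact: continuous_measurable_fun.
    + apply: measurable_funM => //; apply: measurable_funM => //; apply: measurable_funM => //.
      apply: measurable_funB => //.
      by apply: measurableT_comp => //; exact: continuous_measurable_fun.
  - by move=> i iN l; apply: measurable_funM; [exact: chi_adapted|exact: h_adapted].
  - move=> i iN w; rewrite /al /be chiE /b.
    have cst00 : 0 <= cst0 by rewrite mulr_ge0 ?addr_ge0// ltW.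
    case: asboolP => [[/(_ i (leqnn i)) xK _]|_]; last by rewrite !mul0r normr0.
    have /andP[w0 wW] := wt_bnd _ _ iN.
    rewrite !mul1r !(normrM (wt _)) (ger0_norm w0); split; apply: ler_pM => //.
      by rewrite -[leLHS]addr0 lerD ?addr_ge0// ?(ltW del0)//; apply: HB1; rewrite -ler_norml.
    apply: (@le_trans _ _ (B2 + del)); last by rewrite lerDr.
    rewrite normrM (ger0_norm (_ : 0 <= 2^-1))//.
    have h1 : `|Phi2 (x j i w)| <= B2 by apply: HB2; rewrite -ler_norml.
    have h2 : `|Phi2 (x j i w) - del| <= B2 + del.
      by apply: (le_trans (ler_normB _ _)); rewrite (ger0_norm (ltW del0)) lerD2r.
    by apply: le_trans h2; rewrite ler_piMr// invf_le1// ler1n.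
  - move=> i iN l w; rewrite /hh chiE; case: (b _ _ _); rewrite ?mul1r ?mul0r; first exact: h_le.
    by rewrite normr0; apply: le_trans (h_le iN l w).
have HQ j w : \sum_(i < N j) quadW (s j i) (s j i.+1) (hh j i) w <= K.
  have [sg [sgN bsg Ksg]] := stopj j w.
  under eq_bigr do rewrite quadE chiE.
  by rewrite (sum_stop (fun i => quadW (s j i) (s j i.+1) (h j i) w) sgN).
have HM j := transform_sum_bound cP hB K0 (HT j) (HQ j).
pose g w : R := \1_(large K) w * (W * (1 + S w) `^ q).
have ig : P.-integrable setT (EFin \o g).
  have iWS : P.-integrable setT (EFin \o (fun w => W * (1 + S w) `^ q)) by exact: integrableZ_EFin.
  apply: (le_integrable_EFin measurableT (g := fun w => W * (1 + S w) `^ q)) => //.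
    apply: measurable_funM; first by apply: measurable_indic; exact: measurable_large.
    by have /integrableP[/measurable_EFinP] := iWS.
  move=> w _; rewrite normrM (ger0_norm (_ : 0 <= W * _)) ?mulr_ge0 ?powR_ge0 ?(ltW W0)//.
  rewrite ler_piMl ?mulr_ge0 ?powR_ge0 ?(ltW W0)//.
  by rewrite indicE ger0_norm// lern1 leq_b1.
have ik : P.-integrable setT (EFin \o cst kp) by exact: finite_measure_integrable_cst.
have ->: \int[P]_w g w + kp = \int[P]_w (g w + cst kp w).
  by rewrite RintegralD// Rintegral_cst// [X in fine X]probability_setT mulr1.
have iPX := integrable_Phi_X.
apply: (expectation_le_of_eventually_le (M := fun j w => \sum_(i < N j) mart_step B (s j i) (s j i.+1) (al j i) (be j i) (hh j i) w)
   (C := cst0 ^+ 2 * (2 * n%:R + mart_cst R n * K) * K)) => //.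
- by move=> j; have [] := HM j.
- by move=> j; have [] := HM j.
- by move=> j; have [] := HM j.
- by move=> j; have [] := HM j.
- exact: integrableD_EFin.
apply: filterS (filterI Hpath (filterI HS (filterI X1 (filterI x_step approx)))) => w.
move=> [Hw [[HX Hz] [X1w [Hstep Happ]]]].
have [eta eta0 PI] := path_inequality dPhi dPhi1 cPhi2 Phi_ge0 Phi_neg xPhi1_le c_ge0 Phi1_sqr
  m0 C0 t01 (dp_cX Hw) (dp_cA Hw) (dp_igam Hw) (dp_mz Hw) (dp_iz2 Hw) (dp_ndkap Hw) (dp_ndk Hw) (dp_A Hw)
  (dp_kflat Hw) (dp_gam Hw) K0 del0 e0.
have eta'0 : 0 < Num.min eta 1 by rewrite lt_min eta0 ltr01.
have [J1 HJ1] := Happ _ eta'0.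
have [J2 HJ2] := s_mesh eta0.
exists (maxn J1 J2) => j; rewrite geq_max => /andP[Jj1 Jj2].
have [xX hI] := HJ1 _ Jj1; have mesh := HJ2 _ Jj2.
have [sg [sgN bsg Ksg]] := stopj j w.
under eq_bigr do rewrite stepE.
rewrite (sum_stop (F j ^~ w) sgN)//.
have := PI (N j) (s j) (fun i => x j i w) (fun i => u j i w) (fun i => hn j i w) (s0 j) (@s_in j) _ _ _ _ _ sg sgN _.
move=> /(_ _ _ _ _ _ _) PI'.
apply: (le_trans (PI' _ _ _ _ _ _)).
- by move=> i iN; rewrite s_le// mesh.
- by move=> i iN; apply: (le_trans (xX i iN)); rewrite ge_min lexx.
- by move=> i iN; exact: Hstep.
- by move=> i iN; exact: sqrtr_ge0.
- by apply: (le_trans hI); rewrite ge_min lexx.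
- by move: Ksg; under eq_bigr do rewrite quadWE.
suff key : wt (s j sg) * Phi (X (s j sg) w) <= g w.
  exact: le_add_half2 key delK.
have /andP[sg0 sg1] := s_in sgN.
have Psg0 : 0 <= Phi (X (s j sg) w) by have [] := Phi_ge0 (X (s j sg) w).
have wsg : wt (s j sg) <= W by exact: lyapunov_weight_le.
rewrite /g indicE; case: (boolP (w \in large K)) => [_|].
  rewrite mul1r; apply: ler_pM => //; first exact: expR_ge0.
  by apply: Phi_X_le; apply: HX; rewrite sg0 sg1.
move/negP; rewrite inE => nlarge.
(* Without stopping, the sum reaches time [t1], where X is nonpositive. *)
suff -> : sg = N j by rewrite sN (Phi_neg X1w).1 mulr0 mul0r.
have SK : S w + 1 <= K by rewrite leNgt; apply/negP => h1; apply: nlarge; left.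
have QK : 2 * Q w + 2 <= K by rewrite leNgt; apply/negP => h1; apply: nlarge; right.
apply/eqP; rewrite eqn_leq sgN/= leqNgt; apply/negP => sgN'.
have : b j w sg = true.
  apply/asboolP; split => [l lsg|].
    have lN : (l <= N j)%N by exact: leq_trans lsg sgN.
    apply: le_trans SK; apply: (dist_norm_le (xX l lN) _ (HX _ (s_in lN))).
    by rewrite ge_min lexx orbT.
  apply: le_trans QK.
  apply: (@le_trans _ _ (\sum_(l < N j) hn j l w ^+ 2 * (s j l.+1 - s j l))).
    rewrite (big_ord_widen _ (fun l => quadW (s j l) (s j l.+1) (h j l) w) sgN') big_mkcond/=.
    apply: ler_sum => l _; rewrite -quadWE; case: ifP => // _; exact: quadW_j_ge0.
  apply: (le_trans (quad_sum_le (fun l => hn j l w) (dp_mz Hw) (dp_iz2 Hw) (s0 j) (@s_in j) (@s_le j))).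
  rewrite addrC lerD ?ler_wpM2l//.
  rewrite -[leRHS]mulr1 ler_wpM2l//; apply: (le_trans hI).
  by rewrite ge_min lexx orbT.
by rewrite bsg// ltnn.
Qed.

End lyapunov_level.

(** As [K] grows, the contribution of [large K] vanishes by dominated convergence. Hence
    [Phi (X t0)] has mean 0, and [Phi] is positive on the positive axis. *)
Lemma grid_comparison : {ae P, forall w, X t0 w <= 0}.
Proof.
have [Phi [Phi1 [Phi2 [c [dPhi dPhi1 cPhi2 Phi_ge0 [Phi_neg Phi_pos xPhi1_le [c_ge0 Phi1_sqr] Phi_le]]]]]] :=
  lyapunov_function q1.
pose W := lyapunov_weight t0 c m C t1.
pose g w : R := W * (1 + S w) `^ q.
have level (k0 : nat) : \int[P]_w Phi (X t0 w) <= \int[P]_w (\1_(large k0%:R) w * g w).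
  apply/ler_addgt0Pr => e e0.
  exact: (lyapunov_expectation_le dPhi dPhi1 cPhi2 Phi_ge0 Phi_neg xPhi1_le c_ge0 Phi1_sqr Phi_le).
have EP0 : \int[P]_w Phi (X t0 w) <= 0.
  apply: (expectation_indic_cvg0 (A := fun k0 : nat => large k0%:R) (g := g)) => //.
  - by move=> k0; exact: measurable_large.
  - exact: integrableZ_EFin.
  - by move=> w; rewrite mulr_ge0 ?powR_ge0 ?expR_ge0.
  - apply/aeW => w; pose r := Num.max (S w + 1) (2 * Q w + 2).
    exists (Num.truncn r).+1 => j hj.
    have rj : r < j%:R.
      by apply: lt_le_trans (truncnS_gt _) _; rewrite ler_nat.
    by move=> [] /=; apply/negP; rewrite -leNgt; apply/ltW; apply: le_lt_trans rj;
      rewrite le_max lexx ?orbT.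
have mPX : measurable_fun setT (EFin \o (fun w => Phi (X t0 w))).
  by apply/measurable_EFinP; apply: measurableT_comp => //; exact: measurable_Phi dPhi.
have P0 w : 0 <= Phi (X t0 w) by have [] := Phi_ge0 (X t0 w).
have iPX := integrable_Phi_X dPhi Phi_ge0 Phi_le.
have I0 : (\int[P]_w `|(EFin \o (fun w => Phi (X t0 w))) w| = 0)%E.
  transitivity (\int[P]_w (EFin \o (fun w => Phi (X t0 w))) w)%E.
    by apply: eq_integral => w _; rewrite gee0_abs// lee_fin.
  rewrite -[LHS](@fineK _ (\int[P]_w _)%E); last exact: integrable_fin_num iPX.
  by congr EFin; apply/eqP; rewrite eq_le EP0/=; apply: Rintegral_ge0.
have /(ae_eq_integral_abs _ measurableT mPX) h0 := I0.
apply: filterS h0 => w /(_ Logic.I)/eqP; rewrite /= eqe => /eqP Pw.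
rewrite leNgt; apply/negP => /Phi_pos.
by rewrite Pw ltxx.
Qed.

End grid_comparison_core.

(** * Measurability of path functionals *)

Lemma clip_dist (R : realType) (T t r e : R) : 0 <= t <= T -> t - e < r -> r < t + e ->
  `|t - Num.max 0 (Num.min r T)| < e.
Proof.
move=> /andP[t0 t1] r1 r2.
by rewrite ltr_norml; case: (leP r T) => rT; [case: (leP 0 r) => r0|case: (leP 0 T) => T0];
  apply/andP; split; lra.
Qed.

Section measurability.
Context (R : realType) (T : R) (n : nat) d (Omega : measurableType d).
Context (P : probability Omega R) (B : R -> Omega -> 'rV[R]_n).
Hypotheses (cP : measure_is_complete P) (hB : brownian_motion P T B) (hT : 0 < T).
Local Notation mu := lebesgue_measure.
Local Notation G := (brownian_gen P B).
Local Notation adapted t X := (adapted_at (brownian_gen P B) t X).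
Implicit Types X Y U : R -> Omega -> R.

(** Extended by 0 outside [[0, T]], the process is jointly measurable on the whole product, the form
    in which sections and Fubini apply. *)
Definition cut X : measurableTypeR R * Omega -> R :=
  fun q => if (0 <= q.1 <= T) then X q.1 q.2 else 0.

Lemma cutE X t w : 0 <= t <= T -> cut X (t, w) = X t w.
Proof. by rewrite /cut /= => ->. Qed.

Lemma progressive_measurable X : progressive T G X -> measurable_fun setT (cut X).
Proof.
move=> /(_ T); rewrite in_itv/= lexx (ltW hT) => /(_ isT) mX.
have mD : measurable (`[0, T]%classic `*` setT : set (measurableTypeR R * g_sigma_algebraType (G T))).
  exact: measurableX.
move/(measurable_restrictT _ mD) : mX => mX.
have mid : measurable_fun setT (fun q : measurableTypeR R * Omega => (q.1, q.2 : g_sigma_algebraType (G T))).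
  apply: measurable_fun_pair; first exact: measurable_fst.
  move=> _ A mA; rewrite setTI.
  have -> : (fun q : measurableTypeR R * Omega => q.2 : g_sigma_algebraType (G T)) @^-1` A = setT `*` A.
    by apply/seteqP; split => -[t w] /=; [|case].
  by apply: measurableX => //; exact: (brownian_sigma_measurable cP hB (lexx T)).
have := measurableT_comp mX mid; congr measurable_fun.
apply/funext => -[t w] /=; rewrite /cut /patch/=; case: ifPn => [|/negP h].
  by rewrite inE/= in_itv/= => -[-> _].
by case: ifP => // h'; exfalso; apply: h; rewrite inE/= in_itv/= h'.
Qed.

Lemma progressive_adapted X t : 0 <= t <= T -> progressive T G X -> adapted t (X t).
Proof.
move=> /andP[t0 tT] /(_ t); rewrite in_itv/= t0 tT => /(_ isT) mX.
have mD : measurable (`[0, t]%classic `*` setT : set (measurableTypeR R * g_sigma_algebraType (G t))).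
  exact: measurableX.
move/(measurable_restrictT _ mD) : mX => mX.
have := measurableT_comp mX (@pair1_measurable _ _ (measurableTypeR R) (g_sigma_algebraType (G t)) t).
congr measurable_fun.
by apply/funext => w /=; rewrite /patch mem_set//= in_itv/= t0 lexx.
Qed.

Lemma progressive_measurableT X t : 0 <= t <= T -> progressive T G X -> measurable_fun setT (X t).
Proof.
move=> tT pX; have /andP[_ t1] := tT.
exact: (adapted_measurable cP hB t1 (progressive_adapted tT pX)).
Qed.

Lemma measurable_section (f : measurableTypeR R * Omega -> R) w : measurable_fun setT f ->
  measurable_fun setT (fun t => f (t, w)).
Proof. by move=> mf; exact: measurable_fun_pair1. Qed.

Lemma measurable_integral_section (f : measurableTypeR R * Omega -> R) (a b : R) : measurable_fun setT f ->
  (forall q, 0 <= f q) -> measurable_fun setT (fun w => \int[mu]_(t in `[a, b]) (f (t, w))%:E)%E.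
Proof.
move=> mf f0.
pose F (q : measurableTypeR R * Omega) : \bar R := (\1_(`[a, b]%classic) q.1 * f q)%:E.
have mF : measurable_fun setT F.
  apply/measurable_EFinP; apply: measurable_funM => //.
  by apply: measurableT_comp => //; apply: measurable_indic.
have := @measurable_fun_fubini_tonelli_G _ _ _ _ _ mu F mF _.
have F0 q : (0 <= F q)%E by rewrite lee_fin mulr_ge0.
move=> /(_ F0); congr measurable_fun; apply/funext => w.
rewrite /fubini_G [RHS]integral_mkcond; apply: eq_integral => t _.
rewrite /F patchE/= indicE mem_setE; case: (t \in _); first by rewrite mul1r.
by rewrite mul0r.
Qed.

(** Sends the rationals to a countable dense set of times of [[0, T]], end points included. *)
Definition clip (r : R) := Num.max 0 (Num.min r T).

Lemma clip_in r : 0 <= clip r <= T.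
Proof. by rewrite /clip le_max lexx/= ge_max (ltW hT) ge_min lexx orbT. Qed.

Lemma clip_dense (f : R -> R) (t e : R) : {within `[0, T], continuous f} -> 0 <= t <= T -> 0 < e ->
  exists q : rat, `|f t - f (clip (ratr q))| < e.
Proof.
move=> /within_continuous_itvP cf tT e0; have [de de0 Hde] := cf t tT e e0.
have tde : t - de < t + de by rewrite ltrBlDr -addrA ltrDl addr_gt0.
have [q] := rat_in_itvoo tde.
rewrite in_itv/= => /andP[q1 q2]; exists q.
apply: Hde; first exact: clip_in.
exact: clip_dist.
Qed.

Definition sup_abs U w : \bar R := ereal_sup [set `|U t w|%:E | t in `[0, T]].

(** Almost surely the supremum is that over countably many times; completeness of [P] removes the
    exceptional set. *)
Lemma measurable_sup_abs U : (forall t, 0 <= t <= T -> measurable_fun setT (U t)) ->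
  as_continuous P T U -> measurable_fun setT (sup_abs U).
Proof.
move=> mU cU.
(* An index that codes no rational stands for the time 0. *)
pose f (k : nat) w := `|U (clip (ratr (odflt 0 (unpickle k) : rat))) w|%:E.
apply: (ae_measurable_fun cP (f := fun w => esups (f ^~ w) 0)); last first.
  apply: measurable_fun_esups => k; apply/measurable_EFinP; apply: measurableT_comp => //.
  exact/mU/clip_in.
apply: filterS cU => w cw _.
have -> : esups (f ^~ w) 0 = ereal_sup (range (f ^~ w)).
  by congr ereal_sup; apply/seteqP; split => _ [k _ <-]; exists k.
apply/eqP; rewrite eq_le; apply/andP; split.
  apply: ge_ereal_sup => _ [k _ <-]; apply: ereal_sup_ubound.
  by exists (clip (ratr (odflt 0 (unpickle k) : rat))) => //=; rewrite in_itv/= clip_in.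
apply: ge_ereal_sup => _ [t /= tT <-]; rewrite in_itv/= in tT.
apply/lee_addgt0Pr => e e0; have [q hq] := clip_dense cw tT e0.
apply: (@le_trans _ _ (`|U (clip (ratr q)) w|%:E + e%:E)%E).
  rewrite -EFinD lee_fin -lerBlDl.
  by apply: (le_trans (lerB_dist _ _)); exact: ltW.
rewrite leeD2r//; apply: ereal_sup_ubound; exists (pickle q) => //=.
by rewrite /f pickleK.
Qed.

Lemma all_times_of_rat (f : R -> R) (c : R) : {within `[0, T], continuous f} ->
  (forall q : rat, f (clip (ratr q)) <= c) -> forall t : R, 0 <= t <= T -> f t <= c.
Proof.
move=> cf H t tT; apply/ler_addgt0Pr => e e0.
have [q hq] := clip_dense cf tT e0.
by apply: (le_trans (dist_ltD hq)); rewrite lerD2r.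
Qed.

Lemma sup_abs_ge U w t : 0 <= t <= T -> (`|U t w|%:E <= sup_abs U w)%E.
Proof. by move=> tT; apply: ereal_sup_ubound; exists t => //=; rewrite in_itv. Qed.

(** Borel-Cantelli: thresholds and probabilities are both [2^-m], so the bad events are summable
    while the thresholds tend to 0. *)
Lemma fast_subsequence (X : nat -> Omega -> \bar R) : (forall j, measurable_fun setT (X j)) ->
  (forall m, P [set w | ((2^-1 ^+ m)%:E <= X m w)%E] <= (2^-1 ^+ m)%:E)%E ->
  {ae P, forall w, forall e : R, 0 < e -> exists J, forall j, (J <= j)%N -> (X j w < e%:E)%E}.
Proof.
move=> mX PX.
pose F m := [set w | ((2^-1 ^+ m)%:E <= X m w)%E].
have mF m : measurable (F m).
  by rewrite -[F m]setTI; exact: (emeasurable_fun_c_infty measurableT (mX m)).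
have L0 : P (lim_sup_set F) = 0%E.
  apply: lim_sup_set_cvg0 => //.
  apply: (@le_lt_trans _ _ (\sum_(0 <= k <oo) ((2 : R) / (2 ^ k.+1)%:R)%:E)%E).
    apply: lee_nneseries => // k _; apply: (le_trans (PX k)).
    by rewrite lee_fin exprVn expnS natrM invfM mulrA divff ?mul1r ?natrX// pnatr_eq0.
  by apply: le_lt_trans (epsilon_trick0 xpredT _) (ltry _).
exists (lim_sup_set F); split => //.
  by apply: bigcapT_measurable => k; apply: bigcup_measurable => *; exact: mF.
move=> w /= H m _; apply: contrapT => nm; apply: H => e e0.
pose J := (Num.truncn e^-1).+1.
exists (maxn m J) => j; rewrite geq_max => /andP[mj Jj].
rewrite ltNge; apply/negP => eX; apply: nm; exists j => //=.
apply: le_trans eX; rewrite lee_fin exprVn -[leRHS]invrK lef_pV2 ?posrE ?invr_gt0 ?exprn_gt0//.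
apply: (le_trans (ltW (truncnS_gt _))); rewrite -natrX ler_nat.
by apply: (leq_trans Jj); apply/ltnW/ltn_expl.
Qed.

End measurability.

(** * Simple processes *)

Lemma enorm_sqr (R : realType) n (z : 'rV[R]_n) : enorm z ^+ 2 = \sum_(i < n) z ord0 i ^+ 2.
Proof. by rewrite /enorm sqr_sqrtr// sum_sqr_ge0. Qed.

Lemma enorm_ge0 (R : realType) n (z : 'rV[R]_n) : 0 <= enorm z.
Proof. exact: sqrtr_ge0. Qed.

Lemma dist_min (R : realType) (c x y : R) : `|Num.min c x - Num.min c y| <= `|x - y|.
Proof.
have := ler_norm (x - y); have := ler_norm (y - x); rewrite [X in _ <= X -> _]distrC => h1 h2.
rewrite ler_norml; case: (leP c x) => cx; case: (leP c y) => cy; apply/andP; split; lra.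
Qed.

Lemma within_continuous_sum (R : realType) (A : set R) m (f : 'I_m -> R -> R) :
  (forall i, {within A, continuous (f i)}) -> {within A, continuous (fun t => \sum_(i < m) f i t)}.
Proof.
elim: m f => [|m IH] f cf.
  have -> : (fun t => \sum_(i < 0) f i t) = cst 0 by apply/funext => t; rewrite big_ord0.
  by apply: continuous_subspaceT => x; exact: cvg_cst.
have -> : (fun t => \sum_(i < m.+1) f i t) =
    (fun t => \sum_(i < m) f (widen_ord (leqnSn m) i) t) + f ord_max.
  by apply/funext => t; rewrite big_ord_recr.
by apply: within_continuousD => //; apply: IH.
Qed.

Section simple_processes.
Context (R : realType) (T : R) (n : nat) d (Omega : measurableType d).
Context (P : probability Omega R) (B : R -> Omega -> 'rV[R]_n).
Hypotheses (cP : measure_is_complete P) (hB : brownian_motion P T B) (hT : 0 < T).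
Local Notation mu := lebesgue_measure.
Local Notation G := (brownian_gen P B).
Local Notation adapted t X := (adapted_at (brownian_gen P B) t X).
Local Notation sp := (@simple_process d Omega R n).

Lemma measurable_sp_val (H : sp) i : sp_valid P T B H ->
  measurable_fun setT (fun q : measurableTypeR R * Omega => sp_val H q.1 q.2 ord0 i).
Proof.
move=> [Ht _ _ Ha].
have -> : (fun q : measurableTypeR R * Omega => sp_val H q.1 q.2 ord0 i) =
   fun q => \sum_(k < sp_size H) \1_(`]sp_time H k, sp_time H k.+1]%classic) q.1 * sp_coef H k q.2 ord0 i.
  apply/funext => q; rewrite /sp_val summxE; apply: eq_bigr => k _; rewrite mxE; congr (_ * _).
  by rewrite indicE mem_setE in_itv.
apply: measurable_sum => k; apply: measurable_funM.
  by apply: measurableT_comp => //; exact: measurable_indic.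
apply: (measurableT_comp (f := fun w => sp_coef H k w ord0 i)) => //.
have := Ht k (ltnW (ltn_ord k)); rewrite in_itv/= => /andP[_ kT].
exact: (adapted_measurable cP hB kT (Ha k i (ltn_ord k))).
Qed.

Definition sp_error (H : sp) (Z : R -> Omega -> 'rV[R]_n) w : \bar R :=
  (\int[mu]_(t in `[0%R, T]) (enorm (sp_val H t w - Z t w) ^+ 2)%:E)%E.

Definition sp_gap (H : sp) (I : R -> Omega -> R) : Omega -> \bar R :=
  sup_abs T (fun t w => sp_int B H t w - I t w).

Lemma measurable_sp_error (H : sp) (Z : R -> Omega -> 'rV[R]_n) :
  sp_valid P T B H -> progressive_rV T G Z ->
  measurable_fun setT (sp_error H Z).
Proof.
move=> vH pZ.
pose f (q : measurableTypeR R * Omega) : R := \sum_(i < n) (sp_val H q.1 q.2 ord0 i - cut T (fun t w => Z t w ord0 i) q) ^+ 2.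
have mf : measurable_fun setT f.
  apply: measurable_sum => i; apply: measurable_funX; apply: measurable_funB.
    exact: measurable_sp_val.
  exact: (progressive_measurable cP hB hT (pZ i)).
have f0 q : 0 <= f q by exact: sum_sqr_ge0.
have := measurable_integral_section 0 T mf f0; congr measurable_fun; apply/funext => w.
apply: eq_integral => t; rewrite inE/= in_itv/= => tT; congr EFin.
rewrite /f enorm_sqr; apply: eq_bigr => i _; rewrite cutE// !mxE//.
Qed.

Lemma sp_int_measurable (H : sp) t : sp_valid P T B H -> 0 <= t <= T ->
  measurable_fun setT (sp_int B H t).
Proof.
move=> [Ht _ _ Ha] tT; have [mB _ _ _] := hB.
apply: measurable_sum => k; apply: measurable_sum => i; apply: measurable_funM.
  have := Ht k (ltnW (ltn_ord k)); rewrite in_itv/= => /andP[_ kT].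
  exact: (adapted_measurable cP hB kT (Ha k i (ltn_ord k))).
have mBm r : (r \in `[0, T]) -> measurable_fun setT (fun w => B (Num.min r t) w ord0 i).
  rewrite in_itv/= => /andP[r0 rT]; apply: mB; have /andP[t0 t1] := tT.
  by rewrite in_itv/= le_min r0 t0 ge_min rT.
by apply: measurable_funB; apply: mBm; apply: Ht => //; exact: ltnW.
Qed.

Lemma within_continuous_min (f : R -> R) (c a b : R) : a <= c -> {within `[a, b], continuous f} ->
  {within `[a, b], continuous (fun t => f (Num.min c t))}.
Proof.
move=> ac /within_continuous_itvP cf; apply/within_continuous_itvP => x xab e e0.
have mab (y : R) : a <= y <= b -> a <= Num.min c y <= b.
  by move=> /andP[y0 y1]; rewrite le_min ac y0 ge_min y1 orbT.
have [de de0 Hde] := cf _ (mab _ xab) e e0; exists de => // y yab xy.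
by apply: Hde; [exact: mab|exact: le_lt_trans (dist_min _ _ _) xy].
Qed.

Lemma sp_int_continuous (H : sp) : sp_valid P T B H -> as_continuous P T (sp_int B H).
Proof.
move=> [Ht _ _ _]; have [_ _ cB _] := hB.
have : {ae P, forall w, forall i, {within `[0, T], continuous (fun t => B t w ord0 i)}} by exact: filter_forall.
apply: filterS => w cw.
have Ht0 k : (k <= sp_size H)%N -> 0 <= sp_time H k by move=> /Ht; rewrite in_itv/= => /andP[].
apply: within_continuous_sum => k; apply: within_continuous_sum => i.
have c1 := within_continuous_min (Ht0 k.+1 (ltn_ord k)) (cw i).
have c2 := within_continuous_min (Ht0 k (ltnW (ltn_ord k))) (cw i).
have := within_continuousB c1 c2 => c12.
move=> x; apply: cvgM; first exact: cvg_cst.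
exact: c12.
Qed.

Lemma cvg_in_prob0_near (X : nat -> Omega -> \bar R) (e : R) : 0 < e -> cvg_in_prob0 P X ->
  \forall j \near \oo, (P [set w | (e%:E <= X j w)%E] <= e%:E)%E.
Proof.
move=> e0 /(_ e e0) h.
have : \forall j \near \oo, (P [set w | (e%:E <= X j w)%E] < e%:E)%E.
  exact: (h _ (@nbhs_open_ereal_lt R 0 (fun=> e) e0)).
by apply: filterS => j /ltW.
Qed.

Lemma ito_approximation (Z : R -> Omega -> 'rV[R]_n) (I : R -> Omega -> R) :
  progressive_rV T G Z -> ito_integral P T B Z I ->
  exists H : nat -> sp, [/\ forall j, sp_valid P T B (H j),
    forall j, measurable_fun setT (sp_error (H j) Z),
    forall j, measurable_fun setT (sp_gap (H j) I) &
    forall m : nat, \forall j \near \oo,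
      (P [set w | ((2^-1 ^+ m)%:E <= sp_error (H j) Z w)%E] <= (2^-1 ^+ m)%:E)%E /\
      (P [set w | ((2^-1 ^+ m)%:E <= sp_gap (H j) I w)%E] <= (2^-1 ^+ m)%:E)%E].
Proof.
move=> pZ [[pI cI] [H [vH HZ HI]]]; exists H; split => //.
- by move=> j; exact: measurable_sp_error.
- move=> j; apply: (measurable_sup_abs cP hT).
    move=> t tT; apply: measurable_funB; first exact: sp_int_measurable.
    exact: (progressive_measurableT cP hB tT).
  apply: filterS2 (sp_int_continuous (vH j)) cI => w c1 c2.
  exact: (within_continuousB c1 c2).
- move=> m; have e0 : 0 < (2^-1 ^+ m : R) by rewrite exprn_gt0// invr_gt0.
  near=> j; split; near: j; exact: cvg_in_prob0_near.
Unshelve. all: by end_near. Qed.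

(** One extraction of indices serves both integrals, so that the four errors become small along the
    same sequence. *)
Lemma ito_approximation2 (Z1 Z2 : R -> Omega -> 'rV[R]_n) (I1 I2 : R -> Omega -> R) :
  progressive_rV T G Z1 -> ito_integral P T B Z1 I1 ->
  progressive_rV T G Z2 -> ito_integral P T B Z2 I2 ->
  exists H1 H2 : nat -> sp, [/\ forall j, sp_valid P T B (H1 j), forall j, sp_valid P T B (H2 j) &
    {ae P, forall w, forall e : R, 0 < e -> exists J, forall j, (J <= j)%N ->
      [/\ (sp_error (H1 j) Z1 w < e%:E)%E, (sp_error (H2 j) Z2 w < e%:E)%E,
          (sp_gap (H1 j) I1 w < e%:E)%E & (sp_gap (H2 j) I2 w < e%:E)%E]}].
Proof.
move=> pZ1 iI1 pZ2 iI2.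
have [H1 [v1 mZ1 mI1 c1]] := ito_approximation pZ1 iI1.
have [H2 [v2 mZ2 mI2 c2]] := ito_approximation pZ2 iI2.
have [f Hf] := choice (fun m => filter_ex (filterI (c1 m) (c2 m))).
exists (H1 \o f), (H2 \o f); split => [j|j|]; [exact: v1|exact: v2|].
have a1 := @fast_subsequence _ _ _ P _ (fun j => mZ1 (f j)) (fun m => (Hf m).1.1).
have a2 := @fast_subsequence _ _ _ P _ (fun j => mZ2 (f j)) (fun m => (Hf m).2.1).
have a3 := @fast_subsequence _ _ _ P _ (fun j => mI1 (f j)) (fun m => (Hf m).1.2).
have a4 := @fast_subsequence _ _ _ P _ (fun j => mI2 (f j)) (fun m => (Hf m).2.2).
apply: filterS (filterI (filterI a1 a2) (filterI a3 a4)) => w [[b1 b2] [b3 b4]] e e0.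
have [J1 h1] := b1 _ e0; have [J2 h2] := b2 _ e0; have [J3 h3] := b3 _ e0; have [J4 h4] := b4 _ e0.
exists (maxn (maxn J1 J2) (maxn J3 J4)) => j; rewrite !geq_max => /andP[/andP[? ?] /andP[? ?]].
by split; [exact: h1|exact: h2|exact: h3|exact: h4].
Qed.

End simple_processes.

(** A uniform mesh and the points of [pts] in [[t0, t1]] are sorted together. Consecutive entries of
    a sorted list enclose no other entry, which yields both the step bound and the last clause.
    Repetitions are kept, so empty cells occur. *)
Lemma grid_exists (R : realType) (pts : seq R) (t0 t1 eta : R) : t0 <= t1 -> 0 < eta ->
  exists (N : nat) (s : nat -> R), [/\ s 0%N = t0 /\ s N = t1,
    forall i, (i <= N)%N -> t0 <= s i <= t1,
    forall i, (i < N)%N -> s i <= s i.+1 <= s i + eta &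
    forall i p, (i < N)%N -> p \in pts -> p <= s i \/ s i.+1 <= p].
Proof.
move=> t01 eta0.
pose M := (Num.truncn ((t1 - t0) / eta)).+1.
pose mesh := [seq t0 + i%:R * eta | i <- iota 0 M.+1].
pose L := sort <=%R (t0 :: t1 :: [seq p <- pts ++ mesh | t0 <= p <= t1]).
have memL p : (p \in L) = (p \in t0 :: t1 :: [seq p <- pts ++ mesh | t0 <= p <= t1]) by rewrite mem_sort.
have Lin p : p \in L -> t0 <= p <= t1.
  rewrite memL !inE => /orP[/eqP ->|/orP[/eqP ->|]]; rewrite ?lexx ?t01//.
  by rewrite mem_filter => /andP[].
have sL : sorted <=%R L by apply: sort_sorted; exact: le_total.
have size0 : (1 < size L)%N by rewrite size_sort.
clearbody L.
pose s i := nth t1 L i.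
have sle i j : (i <= j)%N -> (j < size L)%N -> s i <= s j.
  move=> ij jL; apply: (sorted_leq_nth le_trans le_refl t1 sL) => //.
  by rewrite inE (leq_ltn_trans ij).
have idx p : p \in L -> exists2 i, (i < size L)%N & s i = p.
  by move=> pL; exists (index p L); rewrite ?index_mem// /s nth_index.
have sin i : (i < size L)%N -> t0 <= s i <= t1 by move=> iL; apply/Lin/mem_nth.
have gap i p : (i < (size L).-1)%N -> p \in L -> p <= s i \/ s i.+1 <= p.
  move=> iN /idx[l lL <-]; have [li|il] := leqP l i.
    by left; apply: sle => //; rewrite (ltn_trans iN)// ltn_predL (ltn_trans _ size0).
  by right; exact: sle.
have Npos : (size L).-1.+1 = size L by rewrite prednK// (ltn_trans _ size0).
exists (size L).-1, s; split.
- split.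
    have /idx[i iL si] : t0 \in L by rewrite memL inE eqxx.
    apply/eqP; rewrite eq_le; have /andP[-> _] := sin 0%N (ltn_trans (ltnSn _) size0).
    by rewrite andbT; have := sle _ _ (leq0n i) iL; rewrite si.
  have /idx[i iL si] : t1 \in L by rewrite memL !inE eqxx orbT.
  have lL : ((size L).-1 < size L)%N by rewrite -Npos.
  apply/eqP; rewrite eq_le; have /andP[_ ->] := sin _ lL.
  have il : (i <= (size L).-1)%N by rewrite -ltnS Npos.
  by rewrite /=; have := sle _ _ il lL; rewrite si.
- by move=> i iN; apply: sin; rewrite -Npos ltnS.
- move=> i iN; have iL : (i.+1 < size L)%N by rewrite -Npos ltnS.
  rewrite sle//=; have /andP[si0 _] := sin i (ltnW iL); have /andP[_ si1] := sin _ iL.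
  (* [t0 + r * eta] is the first point of the uniform mesh beyond [s i]; either it is in the list or
     it exceeds [t1]. *)
  pose r := (Num.truncn ((s i - t0) / eta)).+1.
  pose p := t0 + r%:R * eta.
  have d0 : 0 <= (s i - t0) / eta by rewrite divr_ge0 ?subr_ge0// ltW.
  have /andP[r1 r2] := truncn_itv d0.
  have p1 : s i < p.
    by rewrite /p -ltrBlDl -ltr_pdivrMr.
  have p2 : p <= s i + eta.
    rewrite /p /r -addn1 natrD mulrDl mul1r addrA lerD2r -lerBrDl -ler_pdivlMr//.
  have [pt|pt] := leP p t1; last by rewrite (le_trans si1)// (le_trans (ltW pt)).
  have pL : p \in L.
    rewrite memL !inE mem_filter pt /p lerDl mulr_ge0 ?(ltW eta0)//= mem_cat; apply/orP; right; apply/orP; right.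
    apply/orP; right; apply/mapP; exists r => //; rewrite mem_iota /= add0n ltnS.
    rewrite /M ltnS; apply: le_truncn; rewrite ler_pM2r ?invr_gt0// lerD2r.
    by have /andP[] := sin i (ltnW iL).
  by case: (gap _ _ iN pL) => h; [move: p1; rewrite ltNge h|exact: le_trans p2].
- move=> i p iN pp; have [pt|/negP pt] := boolP (t0 <= p <= t1).
    by apply: gap => //; rewrite memL !inE mem_filter pt mem_cat pp !orbT.
  have iL : (i.+1 < size L)%N by rewrite -Npos ltnS.
  have /andP[si0 _] := sin i (ltnW iL); have /andP[_ si1] := sin _ iL.
  have [p0|p0] := leP t0 p; last by left; apply: le_trans si0; exact: ltW.
  right; apply: (le_trans si1); rewrite leNgt; apply/negP => p1; apply: pt.
  by rewrite p0 ltW.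
Qed.

Lemma coord_le_enorm (R : realType) n (z : 'rV[R]_n) i : `|z ord0 i| <= enorm z.
Proof.
rewrite -(ler_sqr (normr_ge0 _ : _ \is Num.nneg)) ?nnegrE ?enorm_ge0// enorm_sqr real_normK ?num_real//.
by rewrite (bigD1 i)//= lerDl sumr_ge0// => j _; exact: sqr_ge0.
Qed.

Section simple_step.
Context (R : realType) (T : R) (n : nat) d (Omega : measurableType d).
Context (P : probability Omega R) (B : R -> Omega -> 'rV[R]_n).
Hypotheses (cP : measure_is_complete P) (hB : brownian_motion P T B).
Variables (H : @simple_process d Omega R n) (s s' : R).
Hypotheses (vH : sp_valid P T B H) (ss : s <= s').
Hypothesis gap : forall k, (k <= sp_size H)%N -> sp_time H k <= s \/ s' <= sp_time H k.

(** The value of [H] on the cell. When [s = s'] two neighbouring pieces may be added, harmlessly, as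
    the increment over the cell is then 0. *)
Definition sp_step w : 'rV[R]_n :=
  \sum_(k < sp_size H) ((sp_time H k <= s) && (s' <= sp_time H k.+1))%:R *: sp_coef H k w.

Lemma sp_val_step t w : s < t -> t <= s' -> sp_val H t w = sp_step w.
Proof.
move=> st ts; apply: eq_bigr => k _; congr (_ %:R *: _); congr (nat_of_bool _).
apply/andP/andP => -[h1].
  move=> h2; split => //.
    have [//|h] := gap (ltnW (ltn_ord k)); move: (lt_le_trans h1 ts).
    by rewrite ltNge h.
  have [h|//] := gap (ltn_ord k); move: (le_lt_trans (le_trans h2 h) st).
  by rewrite ltxx.
by move=> h2; split; [exact: le_lt_trans st|exact: le_trans h2].
Qed.

Lemma sp_int_step w :
  sp_int B H s' w - sp_int B H s w = \sum_(i < n) sp_step w ord0 i * increment B s s' i w.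
Proof.
have [_ Hle _ _] := vH.
rewrite -sumrB.
rewrite (eq_bigr (fun k : 'I_(sp_size H) => \sum_(i < n)
   (((sp_time H k <= s) && (s' <= sp_time H k.+1))%:R *: sp_coef H k w) ord0 i * increment B s s' i w)).
  rewrite exchange_big /=; apply: eq_bigr => i _.
  by rewrite /sp_step summxE mulr_suml.
move=> k _; rewrite -sumrB; apply: eq_bigr => i _; rewrite mxE -mulrBr.
rewrite [RHS]mulrAC [RHS]mulrC; congr (_ * _); rewrite /increment.
have kk := Hle _ (ltn_ord k).
have [ks|sk] := gap (ltnW (ltn_ord k)); last first.
  have e1 : Num.min (sp_time H k) s = s by apply/min_idPr; exact: le_trans sk.
  have e2 : Num.min (sp_time H k.+1) s = s by apply/min_idPr; apply: le_trans kk; exact: le_trans sk.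
  have e3 : Num.min (sp_time H k) s' = s' by apply/min_idPr.
  have e4 : Num.min (sp_time H k.+1) s' = s' by apply/min_idPr; exact: le_trans kk.
  rewrite e1 e2 e3 e4 !subrr.
  move: ss; rewrite le_eqVlt => /orP[/eqP ->|s1]; first by rewrite subrr mulr0.
  by rewrite leNgt (lt_le_trans s1 sk) mul0r.
have e1 : Num.min (sp_time H k) s = sp_time H k by apply/min_idPl.
have e2 : Num.min (sp_time H k) s' = sp_time H k by apply/min_idPl; exact: le_trans ss.
rewrite e1 e2 ks/=.
have [ks'|sk'] := gap (ltn_ord k).
  have e3 : Num.min (sp_time H k.+1) s = sp_time H k.+1 by apply/min_idPl.
  have e4 : Num.min (sp_time H k.+1) s' = sp_time H k.+1 by apply/min_idPl; exact: le_trans ss.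
  rewrite e3 e4 subrr.
  move: ss; rewrite le_eqVlt => /orP[/eqP ->|s1]; first by rewrite subrr mulr0.
  by rewrite leNgt (le_lt_trans ks' s1) mul0r.
have e3 : Num.min (sp_time H k.+1) s = s by apply/min_idPr; exact: le_trans sk'.
have e4 : Num.min (sp_time H k.+1) s' = s' by apply/min_idPr.
by rewrite e3 e4 sk' mul1r; ring.
Qed.

Lemma sp_step_adapted i : adapted_at (brownian_gen P B) s (fun w => sp_step w ord0 i).
Proof.
have [_ _ _ Ha] := vH.
have -> : (fun w => sp_step w ord0 i) =
    fun w => \sum_(k < sp_size H) (((sp_time H k <= s) && (s' <= sp_time H k.+1))%:R * sp_coef H k w ord0 i).
  by apply/funext => w; rewrite /sp_step summxE; apply: eq_bigr => k _; rewrite mxE.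
apply: measurable_sum => k; have [ks|_] := leP (sp_time H k) s.
  by apply: measurable_funM => //; exact: (adapted_le ks (Ha _ _ (ltn_ord k))).
under eq_fun do rewrite /= mul0r.
exact: measurable_cst.
Qed.

Lemma sp_step_bounded : exists c : R, forall i w, `|sp_step w ord0 i| <= c.
Proof.
have [_ _ Hc _] := vH.
have [c Hc'] := choice (fun k : 'I_(sp_size H) => Hc _ (ltn_ord k)).
exists (\sum_k c k) => i w; rewrite /sp_step summxE; apply: (le_trans (ler_norm_sum _ _ _)).
apply: ler_sum => k _; rewrite mxE normrM; apply: le_trans (Hc' k w); apply: le_trans (coord_le_enorm _ i).
by rewrite ler_piMl// ger0_norm// lern1 leq_b1.
Qed.

End simple_step.

Lemma enorm_triangle (R : realType) n (a b : 'rV[R]_n) : enorm a <= enorm b + enorm (a - b).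
Proof.
rewrite -ler_sqr ?nnegrE ?addr_ge0 ?enorm_ge0//.
have -> : (enorm b + enorm (a - b)) ^+ 2 = enorm b ^+ 2 + enorm (a - b) ^+ 2 + 2 * (enorm b * enorm (a - b)) by ring.
have h : \sum_(i < n) b ord0 i * (a - b) ord0 i <= enorm b * enorm (a - b).
  apply: (le_trans (ler_norm _)).
  rewrite -ler_sqr ?nnegrE ?mulr_ge0 ?enorm_ge0// real_normK ?num_real// exprMn !enorm_sqr.
  exact: cauchy_schwarz.
have -> : enorm a ^+ 2 = enorm b ^+ 2 + enorm (a - b) ^+ 2 + 2 * \sum_(i < n) b ord0 i * (a - b) ord0 i.
  rewrite !enorm_sqr mulr_sumr -!big_split /=; apply: eq_bigr => i _; rewrite !mxE; ring.
by rewrite lerD2l ler_pM2l.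
Qed.

Lemma enormN (R : realType) n (a : 'rV[R]_n) : enorm (- a) = enorm a.
Proof. by rewrite /enorm; congr Num.sqrt; apply: eq_bigr => i _; rewrite mxE sqrrN. Qed.

(** Transfers the separate errors on [Z1] and [Z2] to the norm of the difference, the only quantity
    that the drift involves. *)
Lemma enormB_sqr_le (R : realType) n (a b u v : 'rV[R]_n) :
  (enorm (u - v) - enorm (a - b)) ^+ 2 <= 2 * enorm (u - a) ^+ 2 + 2 * enorm (v - b) ^+ 2.
Proof.
have h1 := enorm_triangle (u - v) (a - b); have h2 := enorm_triangle (a - b) (u - v).
have e1 : enorm (a - b - (u - v)) = enorm (u - v - (a - b)) by rewrite -enormN opprB.
rewrite e1 in h2.
apply: (@le_trans _ _ (enorm (u - v - (a - b)) ^+ 2)).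
  rewrite -[leLHS]real_normK ?num_real// ler_sqr ?nnegrE ?enorm_ge0//.
  by rewrite ler_norml; apply/andP; split; lra.
rewrite !enorm_sqr !mulr_sumr -big_split /=; apply: ler_sum => i _; rewrite !mxE.
have -> : u ord0 i - v ord0 i - (a ord0 i - b ord0 i) = (u ord0 i - a ord0 i) - (v ord0 i - b ord0 i) by ring.
have := sqr_ge0 ((u ord0 i - a ord0 i) + (v ord0 i - b ord0 i)).
move: (u ord0 i - a ord0 i) (v ord0 i - b ord0 i) => p1 p2; lra.
Qed.

(** The bound is asked only on left-open cells, since simple processes are constant there and may
    jump at the left end. *)
Lemma grid_integral_le (R : realType) (f : nat -> R -> R) (D : R -> R) (N : nat) (s : nat -> R) (a b : R) :
  lebesgue_measure.-integrable `[a, b] (EFin \o D) -> (forall r, a <= r <= b -> 0 <= D r) ->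
  (forall i, (i <= N)%N -> a <= s i <= b) -> (forall i, (i < N)%N -> s i <= s i.+1) ->
  (forall i, (i < N)%N -> lebesgue_measure.-integrable `[s i, s i.+1] (EFin \o f i)) ->
  (forall i r, (i < N)%N -> s i < r <= s i.+1 -> f i r <= D r) ->
  \sum_(i < N) \int[lebesgue_measure]_(r in `[s i, s i.+1]) f i r <=
    \int[lebesgue_measure]_(r in `[a, b]) D r.
Proof.
move=> iD D0 Hs Hss fi fD.
pose G r := \int[lebesgue_measure]_(u in `[a, r]) D u.
have GE r r' : a <= r -> r <= r' -> r' <= b ->
    G r' - G r = \int[lebesgue_measure]_(u in `[r, r']) D u.
  move=> r0 rr r1; rewrite /G (@Rintegral_itv_cat _ _ a r r')//; first by rewrite addrC addKr.
  exact: integrable_itvS iD.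
have Gge0 r r' : a <= r -> r <= r' -> r' <= b -> 0 <= G r' - G r.
  move=> r0 rr r1; rewrite GE//; apply: Rintegral_ge0 => u /=; rewrite in_itv/= => /andP[u0 u1].
  by apply: D0; rewrite (le_trans r0 u0) (le_trans u1).
have [s00 s01] := andP (Hs _ (leq0n N)); have [sN0 sN1] := andP (Hs _ (leqnn N)).
have ab : a <= b := le_trans s00 s01.
have s0N : s 0%N <= s N.
  have H i : (i <= N)%N -> s 0%N <= s i.
    by elim: i => // i IH iN; apply: (le_trans (IH (ltnW iN))); exact: Hss.
  exact: H.
apply: (@le_trans _ _ (\sum_(i < N) (G (s i.+1) - G (s i)))).
  apply: ler_sum => i _; have iN := ltn_ord i.
  have [i0 _] := andP (Hs _ (ltnW iN)); have [_ i1] := andP (Hs _ iN).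
  rewrite GE ?Hss//.
  have iDi := integrable_itvS i0 i1 iD.
  have sub : `]s i, s i.+1]%classic `<=` `[s i, s i.+1]%classic.
    by move=> r /=; rewrite !in_itv/= => /andP[/ltW -> ->].
  have iD' : lebesgue_measure.-integrable `]s i, s i.+1] (EFin \o D) by apply: integrableS iDi.
  have if' : lebesgue_measure.-integrable `]s i, s i.+1] (EFin \o f i).
    by apply: integrableS (fi _ iN).
  rewrite -!Rintegral_itv_obnd_cbnd//; apply: le_Rintegral => //.
  by move=> r /=; rewrite in_itv/= => rs; exact: fD.
rewrite (sum_telescope_le (fun i => G (s i))).
have g1 := Gge0 _ _ (lexx a) s00 s01; have g2 := Gge0 _ _ sN0 sN1 (lexx b).
have Ga : G a = 0 by rewrite /G set_itv1 Rintegral_set1.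
rewrite -/(G b); rewrite Ga in g1; lra.
Qed.

Lemma dist4_le (R : realFieldType) (a1 a2 a3 a4 i1 i2 i3 i4 X e : R) :
  `|a1 - i1| <= e / 4 -> `|a2 - i2| <= e / 4 -> `|a3 - i3| <= e / 4 -> `|a4 - i4| <= e / 4 ->
  `|X - (i1 - i2 - (i3 - i4)) + (a1 - a2 - (a3 - a4)) - X| <= e.
Proof.
rewrite !ler_norml => /andP[? ?] /andP[? ?] /andP[? ?] /andP[? ?]; apply/andP; split; lra.
Qed.

(** * Linear comparison for a difference of two Ito integrals *)

Section ito_comparison.
Context (R : realType) (T : R) (n : nat) d (Omega : measurableType d).
Context (P : probability Omega R) (B : R -> Omega -> 'rV[R]_n).
Hypotheses (cP : measure_is_complete P) (hB : brownian_motion P T B) (hT : 0 < T).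
Local Notation mu := lebesgue_measure.
Local Notation G := (brownian_gen P B).
Local Notation adapted t X := (adapted_at (brownian_gen P B) t X).

Lemma measurable_dist (Z1 Z2 : R -> Omega -> 'rV[R]_n) : progressive_rV T G Z1 -> progressive_rV T G Z2 ->
  exists2 f : measurableTypeR R * Omega -> R, measurable_fun setT f &
    forall (t : R) w, 0 <= t <= T -> f (t, w) = enorm (Z1 t w - Z2 t w).
Proof.
move=> p1 p2.
exists (fun q => Num.sqrt (\sum_(i < n) (cut T (fun t w => Z1 t w ord0 i) q - cut T (fun t w => Z2 t w ord0 i) q) ^+ 2)).
  apply: measurableT_comp; first by apply: continuous_measurable_fun; exact: sqrt_continuous.
  apply: measurable_sum => i; apply: measurable_funX; apply: measurable_funB.
    exact: (progressive_measurable cP hB hT (p1 i)).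
  exact: (progressive_measurable cP hB hT (p2 i)).
by move=> t w tT; rewrite /enorm; congr Num.sqrt; apply: eq_bigr => i _; rewrite !cutE// !mxE.
Qed.

Lemma integrable_sp_dist (H : @simple_process d Omega R n) (Z : R -> Omega -> 'rV[R]_n) w :
  sp_valid P T B H -> progressive_rV T G Z -> (sp_error T H Z w < +oo)%E ->
  mu.-integrable `[0, T] (EFin \o (fun t => enorm (sp_val H t w - Z t w) ^+ 2)).
Proof.
move=> vH pZ fin; apply/integrableP; split.
  apply/measurable_EFinP.
  apply: (eq_measurable_fun (fun t : measurableTypeR R => \sum_(i < n) (sp_val H t w ord0 i - cut T (fun t w => Z t w ord0 i) (t, w)) ^+ 2)).
    move=> t; rewrite inE/= in_itv/= => tT; rewrite enorm_sqr; apply: eq_bigr => i _.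
    by rewrite cutE// !mxE.
  apply: measurable_funTS; apply: measurable_sum => i; apply: measurable_funX; apply: measurable_funB.
    exact: (measurable_section w (measurable_sp_val cP hB i vH)).
  exact: (measurable_section w (progressive_measurable cP hB hT (pZ i))).
apply: le_lt_trans fin; rewrite le_eqVlt; apply/orP; left; apply/eqP.
by apply: eq_integral => t _; rewrite gee0_abs// lee_fin sqr_ge0.
Qed.

Section process_comparison.
Variables (q t0 t1 m C : R).
Hypotheses (q1 : 1 < q) (t00 : 0 <= t0) (t01 : t0 <= t1) (t1T : t1 <= T) (m0 : 0 <= m) (C0 : 0 <= C).
Variables (Z1 Z2 : R -> Omega -> 'rV[R]_n) (I1 I2 : R -> Omega -> R).
Hypotheses (pZ1 : progressive_rV T G Z1) (iI1 : ito_integral P T B Z1 I1).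
Hypotheses (pZ2 : progressive_rV T G Z2) (iI2 : ito_integral P T B Z2 I2).
Variables (X A gam kap k : R -> Omega -> R) (S : Omega -> R).
Hypothesis Hpath : {ae P, forall w,
  drift_path t0 t1 m C (X ^~ w) (A ^~ w) (gam ^~ w) (fun t => enorm (Z1 t w - Z2 t w)) (kap ^~ w) (k ^~ w)}.
Hypothesis aX : forall t, t0 <= t <= t1 -> adapted t (X t).
Hypothesis XE : {ae P, forall w, forall t, t0 <= t <= t1 ->
  X t w = X t0 w + (A t w - A t0 w) + ((I1 t w - I2 t w) - (I1 t0 w - I2 t0 w))}.
Hypothesis X1 : {ae P, forall w, X t1 w <= 0}.
Hypotheses (mS : measurable_fun setT S) (S_ge0 : forall w, 0 <= S w).
Hypothesis HS : {ae P, forall w, forall t, t0 <= t <= t1 -> `|X t w| <= S w}.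
Hypothesis iS : P.-integrable setT (EFin \o (fun w => (1 + S w) `^ q)).

Lemma process_comparison : {ae P, forall w, X t0 w <= 0}.
Proof.
have [H1 [H2 [v1 v2 Happ]]] := ito_approximation2 cP hB hT pZ1 iI1 pZ2 iI2.
have tT (t : R) : t0 <= t <= t1 -> 0 <= t <= T.
  by move=> /andP[h1 h2]; rewrite (le_trans t00 h1) (le_trans h2 t1T).
pose times (H : @simple_process d Omega R n) := [seq sp_time H k | k <- iota 0 (sp_size H).+1].
have inv_gt0 j : 0 < (j.+1%:R : R)^-1 by rewrite invr_gt0.
have [N HN] := choice (fun j => grid_exists (times (H1 j) ++ times (H2 j)) t01 (inv_gt0 j)).
have [s Hs] := choice HN.
have s0 j : s j 0%N = t0 by have [[]] := Hs j.
have sN j : s j (N j) = t1 by have [[]] := Hs j.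
have s_in j i : (i <= N j)%N -> t0 <= s j i <= t1 by have [_ h _ _] := Hs j; exact: h.
have s_le j i : (i < N j)%N -> s j i <= s j i.+1.
  by have [_ _ h _] := Hs j => /h /andP[].
have gap1 j i k0 : (i < N j)%N -> (k0 <= sp_size (H1 j))%N -> sp_time (H1 j) k0 <= s j i \/ s j i.+1 <= sp_time (H1 j) k0.
  move=> iN kN; have [_ _ _ h] := Hs j; apply: h => //; rewrite mem_cat; apply/orP; left.
  by apply: map_f; rewrite mem_iota.
have gap2 j i k0 : (i < N j)%N -> (k0 <= sp_size (H2 j))%N -> sp_time (H2 j) k0 <= s j i \/ s j i.+1 <= sp_time (H2 j) k0.
  move=> iN kN; have [_ _ _ h] := Hs j; apply: h => //; rewrite mem_cat; apply/orP; right.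
  by apply: map_f; rewrite mem_iota.
pose st1 j i w := sp_step (H1 j) (s j i) (s j i.+1) w.
pose st2 j i w := sp_step (H2 j) (s j i) (s j i.+1) w.
pose h j i (l : 'I_n) w := st1 j i w ord0 l - st2 j i w ord0 l.
pose I t w := I1 t w - I2 t w.
pose u j i w := dotW B (s j i) (s j i.+1) (h j i) w.
(* The stochastic integral is taken out exactly and the simple one put in, so the step relation of
   the grid comparison is an identity and only the gap between the two integrals is an error. *)
pose x j i w := X (s j i) w - (I (s j i) w - I t0 w) + \sum_(l < i) u j l w.
have h_adapted j i l : (i < N j)%N -> adapted (s j i) (h j i l).
  move=> iN; apply: measurable_funB.
    exact: (@sp_step_adapted R T n d Omega P B (H1 j) (s j i) (s j i.+1) (v1 j) l).
  exact: (@sp_step_adapted R T n d Omega P B (H2 j) (s j i) (s j i.+1) (v2 j) l).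
have [ch h_le] : exists ch : nat -> nat -> R, forall j i, (i < N j)%N -> forall l w, `|h j i l w| <= ch j i.
  have [c1 Hc1] := choice (fun ji : nat * nat => sp_step_bounded (s ji.1 ji.2) (s ji.1 ji.2.+1) (v1 ji.1)).
  have [c2 Hc2] := choice (fun ji : nat * nat => sp_step_bounded (s ji.1 ji.2) (s ji.1 ji.2.+1) (v2 ji.1)).
  exists (fun j i => c1 (j, i) + c2 (j, i)) => j i _ l w; apply: (le_trans (ler_normB _ _)).
  by apply: lerD; [exact: (Hc1 (j, i))|exact: (Hc2 (j, i))].
have s_mono j i l : (i <= l)%N -> (l <= N j)%N -> s j i <= s j l.
  elim: l => [|l IH]; first by rewrite leqn0 => /eqP ->.
  rewrite leq_eqVlt => /orP[/eqP ->//|il] lN.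
  by apply: (le_trans (IH il (ltnW lN))); exact: s_le.
have pI1 : progressive T G I1 by have [[]] := iI1.
have pI2 : progressive T G I2 by have [[]] := iI2.
have aI t : t0 <= t <= t1 -> adapted t (I t).
  move=> /tT tt; apply: measurable_funB; [exact: (progressive_adapted tt pI1)|exact: (progressive_adapted tt pI2)].
have u_adapted j i : (i < N j)%N -> adapted (s j i.+1) (u j i).
  move=> iN; apply: measurable_sum => l; apply: measurable_funM.
    exact: (adapted_le (s_le _ _ iN) (h_adapted _ _ _ iN)).
  have [i0 _] := andP (tT _ (s_in _ _ (ltnW iN))).
  have [i1 _] := andP (tT _ (s_in _ _ iN)).
  apply: measurable_funB; first exact: (adapted_brownian l i1 (lexx _)).
  exact: (adapted_brownian l i0 (s_le _ _ iN)).
have x_adapted j i : (i <= N j)%N -> adapted (s j i) (x j i).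
  move=> iN; have si := s_in _ _ iN.
  apply: measurable_funD; first apply: measurable_funB; first exact: aX.
    apply: measurable_funB; first exact: aI.
    have [si0 _] := andP si; apply: (adapted_le si0); apply: aI; by rewrite lexx.
  apply: measurable_sum => l; apply: adapted_le (u_adapted _ _ (leq_trans (ltn_ord l) iN)).
  exact: s_mono.
have u_sum j w i : (i <= N j)%N -> \sum_(l < i) u j l w =
    (sp_int B (H1 j) (s j i) w - sp_int B (H2 j) (s j i) w) - (sp_int B (H1 j) t0 w - sp_int B (H2 j) t0 w).
  elim: i => [_|i IH iN]; first by rewrite big_ord0 s0 subrr.
  rewrite big_ord_recr/= IH; last exact: ltnW.
  have e1 := sp_int_step (v1 j) (s_le _ _ iN) (fun k0 => @gap1 j i k0 iN) w.
  have e2 := sp_int_step (v2 j) (s_le _ _ iN) (fun k0 => @gap2 j i k0 iN) w.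
  have -> : u j i w = (sp_int B (H1 j) (s j i.+1) w - sp_int B (H1 j) (s j i) w)
                    - (sp_int B (H2 j) (s j i.+1) w - sp_int B (H2 j) (s j i) w).
    rewrite e1 e2 -sumrB; apply: eq_bigr => l _; rewrite /h /st1 /st2; ring.
  ring.
have [f mf fE] := measurable_dist pZ1 pZ2.
pose Q w := \int[mu]_(r in `[t0, t1]) (enorm (Z1 r w - Z2 r w)) ^+ 2.
have mQ : measurable_fun setT Q.
  have mf2 : measurable_fun setT (fun q => f q ^+ 2) by exact: measurable_funX.
  have := measurable_integral_section t0 t1 mf2 (fun q => sqr_ge0 _) => mI.
  have : measurable_fun setT (fine \o (fun w => \int[mu]_(t in `[t0, t1]) (f (t, w) ^+ 2)%:E)%E) by exact: measurableT_comp.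
  congr measurable_fun.
  apply/funext => w /=; rewrite /Q /Rintegral; congr fine; apply: eq_integral => r.
  by rewrite inE/= in_itv/= => /tT rT; rewrite fE.
apply: (grid_comparison (N := N) (s := s) (x := x) (h := h) (ch := ch) cP hB q1 t00 t01 t1T m0 C0 Hpath _ X1 mS mQ S_ge0 _ iS) => //.
- have t0in : t0 <= t0 <= t1 by rewrite lexx.
  exact: (adapted_measurable cP hB (le_trans t01 t1T) (aX t0in)).
- by apply: filterS HS => w HSw; split.
- move=> eta eta0; exists (Num.truncn eta^-1) => j Jj i iN.
  have [_ _ hm _] := Hs j; have /andP[_ ] := hm _ iN; move/le_trans; apply.
  rewrite lerD2l -[leRHS]invrK lef_pV2 ?posrE ?invr_gt0 ?ltr0n//.
  by apply: (le_trans (ltW (truncnS_gt _))); rewrite ler_nat ltnS.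
- apply: filterS XE => w Xw j i iN.
  rewrite /x big_ord_recr/= -/(u j i w) (Xw _ (s_in _ _ iN)) (Xw _ (s_in _ _ (ltnW iN))) /I; ring.
apply: filterS (filterI Hpath Happ) => w [Hw Ha] eta eta0.
(* Four gaps add up in the path error: two integrals, each at [t0] and at [s j i]. In the quadratic
   error there are two terms, each with a factor 2. *)
have e0 : 0 < eta / 4 by rewrite divr_gt0.
have [J HJ] := Ha _ e0; exists J => j /HJ[E1 E2 G1 G2]; split.
- move=> i iN.
  have gle (U : R -> Omega -> R) (t e : R) : 0 <= t <= T -> (sup_abs T U w < e%:E)%E -> `|U t w| <= e.
    by move=> tt /ltW /(le_trans (sup_abs_ge U w tt)); rewrite lee_fin.
  have si := tT _ (s_in _ _ iN); have t0in : 0 <= t0 <= T by apply: tT; rewrite lexx.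
  have a1 := gle _ _ _ si G1; have a2 := gle _ _ _ si G2.
  have a3 := gle _ _ _ t0in G1; have a4 := gle _ _ _ t0in G2.
  rewrite /x u_sum// /I.
  move: a1 a2 a3 a4; rewrite /=; exact: dist4_le.
have iD1 := integrable_sp_dist (v1 j) pZ1 (lt_trans E1 (ltry _)).
have iD2 := integrable_sp_dist (v2 j) pZ2 (lt_trans E2 (ltry _)).
pose D r := 2 * enorm (sp_val (H1 j) r w - Z1 r w) ^+ 2 + 2 * enorm (sp_val (H2 j) r w - Z2 r w) ^+ 2.
have iD : mu.-integrable `[0, T] (EFin \o D).
  by apply: integrableD_EFin => //; exact: integrableZ_EFin.
apply: (@le_trans _ _ (\int[mu]_(r in `[0, T]) D r)).
  apply: (grid_integral_le (f := fun i r => (Num.sqrt (\sum_(l < n) h j i l w ^+ 2) - enorm (Z1 r w - Z2 r w)) ^+ 2) iD).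
  - by move=> r _; apply: addr_ge0; apply: mulr_ge0 => //; exact: sqr_ge0.
  - by move=> i iN; apply/tT/s_in.
  - exact: s_le.
  - move=> i iN; have /andP[i0 _] := s_in _ _ (ltnW iN); have /andP[_ i1] := s_in _ _ iN.
    apply: (integrable_sqrB (dp_mz Hw) (dp_iz2 Hw)) => //; exact: s_le.
  - move=> i r iN /andP[r0 r1].
    have -> : Num.sqrt (\sum_(l < n) h j i l w ^+ 2) = enorm (sp_val (H1 j) r w - sp_val (H2 j) r w).
      rewrite (sp_val_step (fun k0 => @gap1 j i k0 iN) w r0 r1) (sp_val_step (fun k0 => @gap2 j i k0 iN) w r0 r1).
      by rewrite /enorm; congr Num.sqrt; apply: eq_bigr => l _; rewrite !mxE.
    exact: enormB_sqr_le.
rewrite RintegralD//; [|exact: integrableZ_EFin..].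
rewrite !RintegralZl//.
have f1 : \int[mu]_(r in `[0, T]) (enorm (sp_val (H1 j) r w - Z1 r w) ^+ 2) <= eta / 4.
  rewrite -lee_fin /Rintegral fineK; first exact: ltW.
  exact: (integrable_fin_num _ iD1).
have f2 : \int[mu]_(r in `[0, T]) (enorm (sp_val (H2 j) r w - Z2 r w) ^+ 2) <= eta / 4.
  rewrite -lee_fin /Rintegral fineK; first exact: ltW.
  exact: (integrable_fin_num _ iD2).
by apply: (le_trans (lerD (ler_wpM2l (ler0n _ 2) f1) (ler_wpM2l (ler0n _ 2) f2))); rewrite le_eqVlt; apply/orP; left; apply/eqP; field.
Qed.

End process_comparison.

End ito_comparison.

(** * Reflected equations *)

(** On [[s, s']] the path has a positive minimum, and the vanishing integral is at least this
    minimum times the mass [F s' - F s]. *)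
Lemma skorokhod_flat (R : realType) (T : R) (Y k : R -> R) (s s' : R) :
  {within `[0, T], continuous Y} -> (forall t, 0 <= t <= T -> 0 <= Y t) ->
  stieltjes_int_eq0 T Y k -> 0 <= s -> s <= s' -> s' <= T ->
  (forall r, s <= r <= s' -> 0 < Y r) -> k s' = k s.
Proof.
move=> cY Y0 [F [Fk I0]] s0 ss sT Ypos.
move: (ss); rewrite le_eqVlt => /orP[/eqP -> //|s1].
have inT r : s <= r <= s' -> 0 <= r <= T.
  by move=> /andP[r0 r1]; rewrite (le_trans s0 r0) (le_trans r1 sT).
have cY' : {within `[s, s'], continuous Y}.
  apply: continuous_subspaceW cY => r /=; rewrite !in_itv/=; exact: inT.
have [c cin Hc] := EVT_min ss cY'.
have Yc : 0 < Y c by apply: Ypos; move: cin; rewrite in_itv.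
pose L := lebesgue_stieltjes_measure F.
have mY : measurable_fun `]0, T]%classic (EFin \o Y).
  apply/measurable_EFinP.
  apply: (@measurable_funS _ _ _ _ `[0, T]%classic) => //.
    by move=> r /=; rewrite !in_itv/= => /andP[/ltW -> ->].
  exact: subspace_continuous_measurable_fun.
have sub : `]s, s']%classic `<=` `]0, T]%classic.
  by move=> r /=; rewrite !in_itv/= => /andP[r0 r1]; rewrite (le_lt_trans s0 r0) (le_trans r1 sT).
have LE : L `]s, s']%classic = (F s' - F s)%:E.
  rewrite /L /lebesgue_stieltjes_measure /measure_extension measurable_mu_extE/=; last exact: is_ocitv.
  by rewrite wlength_itv_bnd.
have h1 : ((Y c)%:E * (F s' - F s)%:E <= 0)%E.
  rewrite -LE -integral_cst// -I0.
  apply: (@le_trans _ _ (\int[L]_(x in `]s, s']) (Y x)%:E)%E).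
    apply: ge0_le_integral => //.
    - by move=> r _; rewrite lee_fin ltW.
    - exact: measurable_funS mY.
    - move=> r /=; rewrite in_itv/= => /andP[r0 r1]; rewrite lee_fin.
      by apply: Hc; rewrite in_itv/= (ltW r0).
  apply: ge0_subset_integral => //.
  move=> r /=; rewrite in_itv/= => /andP[r0 r1]; rewrite lee_fin; apply: Y0.
  by rewrite (ltW r0).
have Fss : F s <= F s' by exact: (cumulative_is_nondecreasing F).
move: h1; rewrite -EFinM lee_fin pmulr_rle0// subr_le0 => Fss'.
rewrite -!Fk; first by apply/eqP; rewrite eq_le Fss Fss'.
  by rewrite in_itv/=; apply: inT; rewrite lexx ss.
by rewrite in_itv/=; apply: inT; rewrite lexx ss.
Qed.

(** Almost every section of a null set of the product is null; this brings the conditions on the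
    generators to a fixed path. *)
Lemma ae_section (R : realType) d (Omega : measurableType d) (P : probability Omega R)
    (Q : Omega * R -> Prop) :
  {ae (P \x lebesgue_measure)%E, forall q : Omega * R, Q q} ->
  {ae P, forall w, {ae lebesgue_measure, forall t : measurableTypeR R, Q (w, t)}}.
Proof.
move=> [N [mN N0 QN]].
have mX : measurable_fun setT (fun w => lebesgue_measure (xsection N w)).
  exact: (measurable_fun_xsection lebesgue_measure mN).
have /(ae_eq_integral_abs _ measurableT mX) : (\int[P]_w `|lebesgue_measure (xsection N w)| = 0)%E.
  rewrite -[RHS]N0; apply: eq_integral => w _; rewrite gee0_abs//.
apply: filterS => w /(_ Logic.I) /= h; exists (xsection N w); split => //.
  exact: measurable_xsection.
by move=> t /= nQ; rewrite /xsection/= inE; exact: QN.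
Qed.

Lemma enormZ (R : realType) n (c : R) (a : 'rV[R]_n) : enorm (c *: a) = `|c| * enorm a.
Proof.
rewrite /enorm -sqrtr_sqr -sqrtrM ?sqr_ge0//; congr Num.sqrt; rewrite mulr_sumr.
by apply: eq_bigr => i _; rewrite mxE exprMn.
Qed.

(* Split the segment from z2 to z1 into pieces of length at most del. *)
Lemma chaining (R : realType) n (g : 'rV[R]_n -> R) (phi : R -> R) (eps del : R) :
  (forall z1 z2, `|g z1 - g z2| <= phi (enorm (z1 - z2))) -> 0 <= eps -> 0 < del ->
  (forall u, 0 <= u <= del -> phi u <= eps) ->
  forall z1 z2, `|g z1 - g z2| <= eps + eps / del * enorm (z1 - z2).
Proof.
move=> Hg eps0 del0 Hphi z1 z2.
set r := enorm (z1 - z2).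
have r0 : 0 <= r by exact: enorm_ge0.
have rd0 : 0 <= r / del by rewrite divr_ge0// ltW.
pose N := (Num.truncn (r / del)).+1.
have N0 : 0 < (N%:R : R) by [].
have rN : r / N%:R <= del.
  by rewrite ler_pdivrMr// mulrC -ler_pdivrMr// ltW// truncnS_gt.
pose z k := z2 + (k%:R / N%:R) *: (z1 - z2).
have zz k : enorm (z k.+1 - z k) = r / N%:R.
  rewrite /z opprD addrACA subrr add0r -scalerBl -mulrBl -natrB// subSnn enormZ.
  by rewrite ger0_norm ?divr_ge0// mul1r mulrC.
have z0 : z 0%N = z2 by rewrite /z mul0r scale0r addr0.
have zN : z N = z1 by rewrite /z divff ?gt_eqF// scale1r addrC subrK.
rewrite -z0 -zN -(sum_telescope_le (fun k => g (z k))).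
apply: (le_trans (ler_norm_sum _ _ _)).
apply: (@le_trans _ _ (\sum_(k < N) eps)).
  apply: ler_sum => k _; apply: (le_trans (Hg _ _)); rewrite zz; apply: Hphi.
  by rewrite divr_ge0.
rewrite sumr_const card_ord -mulr_natr.
have : N%:R <= 1 + r / del.
  by rewrite /N -addn1 natrD addrC lerD2l; have /andP[] := truncn_itv rd0.
move=> /(ler_wpM2l eps0); move/le_trans; apply.
by rewrite mulrDr mulr1 lerD2l mulrAC mulrA.
Qed.

Lemma modulus_linear (R : realType) (T : R) (n : nat) d (Omega : measurableType d) (P : probability Omega R)
    (g : R -> Omega -> R -> 'rV[R]_n -> R) (eps : R) :
  unif_continuous_z P T g -> 0 < eps -> exists2 C : R, 0 <= C &
  {ae P, forall w, {ae lebesgue_measure, forall t : measurableTypeR R, t \in `[0, T] ->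
    forall y z1 z2, `|g t w y z1 - g t w y z2| <= eps + C * enorm (z1 - z2)}}.
Proof.
move=> [phi [phi_nd phi_c phi0 H]] eps0.
have c01 : {within `[0, 1], continuous phi}.
  by apply: continuous_subspaceW phi_c => r /=; rewrite !in_itv/= => /andP[->].
have z01 : 0 <= (0 : R) <= 1 by rewrite lexx ler01.
have [de de0 Hde] := (within_continuous_itvP phi 0 1).1 c01 0 z01 eps eps0.
(* The half turns the strict modulus into a closed range, and the cap keeps that range inside
   [[0, 1]]. *)
pose del := Num.min (de / 2) 1.
have del0 : 0 < del by rewrite lt_min divr_gt0/=.
exists (eps / del); first by rewrite divr_ge0// ltW.
have /ae_section := H.
apply: filterS => w; apply: filterS => t /= Hq qT y z1 z2.
apply: (chaining (phi := phi)) => //; [exact: (Hq qT)|exact: ltW|].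
move=> u /andP[u0 ud].
have u1 : u <= 1 by apply: (le_trans ud); rewrite ge_min lexx orbT.
have ud2 : u <= de / 2 by apply: (le_trans ud); rewrite ge_min lexx.
have : `|phi 0 - phi u| < eps.
  apply: Hde; first by rewrite u0.
  by rewrite sub0r normrN ger0_norm//; lra.
by rewrite phi0 sub0r normrN => /ltW; apply: le_trans; exact: ler_norm.
Qed.

(** For [x > b], b is the convex combination of x and 0 with weight [b / x], so concavity and
    [rho 0 = 0] give [rho x <= (x / b) rho b]. *)
Lemma concave_le (R : realType) (rho : R -> R) (b x : R) :
  {in `[0, +oo[ &, nondecreasing rho} ->
  convex_function (`[0, +oo[%classic : set R^o) (fun u => - rho u) -> rho 0 = 0 -> 0 < b -> 0 <= x ->
  rho x <= rho b + rho b / b * Num.max (x - b) 0.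
Proof.
move=> nd cv rho0 b0 x0.
have [xb|bx] := leP x b.
  rewrite max_r ?subr_le0// mulr0 addr0; apply: nd => //; rewrite in_itv/= andbT//.
  exact: ltW.
have x1 : 0 < x := lt_trans b0 bx.
rewrite max_l ?subr_ge0 ?(ltW bx)//.
have p0 : 0 <= b / x by rewrite divr_ge0 ?ltW.
have p1 : b / x <= 1 by rewrite ler_pdivrMr// mul1r ltW.
have := cv (Itv01 p0 p1) x 0; rewrite !inE/= !in_itv/= lexx x0 => /(_ isT isT).
rewrite /conv/= rho0 oppr0 !scaler0 !addr0.
rewrite [X in - rho X <= _](_ : _ = b) => [h|]; last first.
  exact: (divfK (lt0r_neq0 x1)).
have {}h : - rho b <= b / x * (- rho x) + (1 - b / x) * 0 by exact: h.
have {}h : b / x * rho x <= rho b by rewrite -lerN2 -mulrN -[leRHS]addr0 -(mulr0 (1 - b / x)).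
have -> : rho b + rho b / b * (x - b) = x / b * rho b by field; rewrite gt_eqF.
have : x / b * (b / x * rho x) <= x / b * rho b by rewrite ler_wpM2l// divr_ge0 ?ltW.
by rewrite (_ : x / b * (b / x * rho x) = rho x)//; field; rewrite !gt_eqF.
Qed.

(** * Divergence of the time steps under the Osgood condition *)

Section osgood.
Context (R : realType) (rho : R -> R) (d0 : R).
Hypothesis nd : {in `[0, +oo[ &, nondecreasing rho}.
Hypothesis rho_gt0 : forall u : R, 0 < u -> 0 < rho u.
Hypothesis rho_int : forall e : R, 0 < e ->
  (\int[lebesgue_measure]_(u in `]0%R, e]) ((rho u)^-1)%:E = +oo)%E.
Hypothesis d0_gt0 : 0 < d0.

Definition level (i : nat) : R := d0 * 2^-1 ^+ i.

(** The time in which a slope [2 rho (level i)] climbs from [level i.+1] to [level i]. *)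
Definition time_step (i : nat) : R := level i / (4 * rho (level i)).

Lemma level_gt0 i : 0 < level i.
Proof. by rewrite mulr_gt0// exprn_gt0// invr_gt0. Qed.

Lemma levelS i : level i.+1 = level i / 2.
Proof. by rewrite /level exprSr mulrA. Qed.

Lemma level_le i j : (i <= j)%N -> level j <= level i.
Proof.
move=> ij; rewrite ler_pM2l// ler_wiXn2l// ?invr_ge0//.
by rewrite invf_le1// ler1n.
Qed.

Lemma level_small (x : R) : 0 < x -> exists i, level i < x.
Proof.
move=> x0; exists (Num.truncn (d0 / x)).+1; set i := _.+1.
rewrite /level exprVn ltr_pdivrMr ?exprn_gt0// mulrC -ltr_pdivrMr//.
by apply: (lt_trans (truncnS_gt _)); rewrite -natrX ltr_nat ltn_expl.
Qed.

Lemma time_step_gt0 i : 0 < time_step i.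
Proof. by rewrite divr_gt0 ?level_gt0// mulr_gt0// rho_gt0// level_gt0. Qed.

(** On []level i.+1, level i]], of length [level i.+1], the integrand is at most its value at the
    left end, so the integral there is at most [4 * time_step i.+1]. A bounded sum would make the
    Osgood integral finite. *)
Lemma time_steps_diverge (M : R) : exists N, M <= \sum_(i < N) time_step i.
Proof.
apply: contrapT => noN.
have bnd N : \sum_(i < N) time_step i <= M.
  by rewrite leNgt; apply/negP => h; apply: noN; exists N; exact: ltW.
pose F i := `]level i.+1, level i]%classic : set (measurableTypeR R).
have FU : \bigcup_i F i = `]0, d0]%classic.
  apply/seteqP; split => x.
    move=> [i _]; rewrite /F/= !in_itv/= => /andP[h1 h2].
    rewrite (lt_trans (level_gt0 _) h1) (le_trans h2)//.
    by rewrite -[leRHS]mulr1 -(expr0 2^-1) -/(level 0) level_le.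
  rewrite /= in_itv/= => /andP[x0 xd].
  have ex : exists i, level i < x by exact: level_small.
  have [[|i] lx mi] := ex_minnP ex.
    by move: lx; rewrite /level expr0 mulr1 ltNge xd.
  exists i => //; rewrite /F/= in_itv/= lx/= leNgt; apply/negP => h.
  by have := mi _ h; rewrite ltnn.
have mrho : measurable_fun (`]0, d0]%classic : set (measurableTypeR R)) (fun u => ((rho u)^-1)%:E).
  apply/measurable_EFinP.
  (* Nothing is known of [rho] on the negative axis; composed with the maximum it is monotone on the
     whole line, hence measurable. *)
  apply: (eq_measurable_fun (fun u : measurableTypeR R => rho (Num.max u 0) `^ (-1))).
    move=> u; rewrite inE/= in_itv/= => /andP[u0 _]; rewrite max_l ?(ltW u0)//.
    by rewrite powR_inv1// ltW// rho_gt0.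
  apply: (measurableT_comp (measurable_powR _)); apply: nondecreasing_measurable => //.
  move=> u v uv; apply: nd; rewrite ?in_itv/= ?andbT ?le_max ?lexx ?orbT//.
  rewrite !ge_max uv lexx andbT/=; case: (leP 0 v) => //= v0.
  exact: ltW (le_lt_trans uv v0).
have inv_ge0 u : `]0, d0]%classic u -> (0 <= ((rho u)^-1)%:E)%E.
  by rewrite /= in_itv/= => /andP[u0 _]; rewrite lee_fin invr_ge0 ltW// rho_gt0.
have mF i : measurable (F i) by exact: measurable_itv.
have tF : trivIset [set: nat] F.
  apply: ltn_trivIset => j i ij; apply/seteqP; split => // x [].
  rewrite /F/= !in_itv/= => /andP[h2 _] /andP[_ h1].
  by have := lt_le_trans h2 (le_trans h1 (level_le ij)); rewrite ltxx.
have sub i : F i `<=` `]0, d0] by rewrite -FU; exact: bigcup_sup.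
have := rho_int d0_gt0; rewrite -FU ge0_integral_bigcup//; [|by rewrite FU|by rewrite FU].
move=> I1.
suff : (+oo <= (4 * M)%:E :> \bar R)%E by [].
rewrite -I1; apply: lime_le.
  apply: is_cvg_nneseries => i _ _; apply: integral_ge0 => u /sub; exact: inv_ge0.
apply: nearW => m.
apply: (@le_trans _ _ (\sum_(0 <= i < m) (4 * time_step i.+1)%:E)%E).
  apply: lee_sum => i _.
  have li := level_gt0 i.+1.
  apply: (@le_trans _ _ (\int[lebesgue_measure]_(u in F i) (cst (rho (level i.+1))^-1%:E u))%E).
    apply: ge0_le_integral => //.
    - by move=> u /sub; exact: inv_ge0.
    - exact: measurable_funS (sub i) mrho.
    - move=> u; rewrite /F/= in_itv/= => /andP[u0 _]; rewrite lee_fin lef_pV2 ?posrE ?rho_gt0//.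
        by apply: nd; rewrite ?in_itv/= ?andbT ?ltW// (lt_trans li).
      exact: lt_trans u0.
  rewrite integral_cst//.
  have lli : level i.+1 < level i by rewrite levelS ltr_pdivrMr// ltr_pMr ?level_gt0// ltr1n.
  have mFi : lebesgue_measure (F i) = (level i - level i.+1)%:E.
    by rewrite /F lebesgue_measure_itv/= lte_fin lli.
  rewrite [X in (_ * X)%E](_ : _ = (level i - level i.+1)%:E); last exact: mFi.
  rewrite -EFinM lee_fin /time_step.
  have -> : level i - level i.+1 = level i.+1 by rewrite levelS; field.
  have r0 : rho (level i.+1) != 0 by rewrite gt_eqF ?rho_gt0.
  by rewrite le_eqVlt; apply/orP; left; apply/eqP; field.
rewrite sumEFin lee_fin -mulr_sumr ler_wpM2l//.
apply: le_trans (bnd m.+1); rewrite big_mkord big_ord_recl/= lerDr.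
exact/ltW/time_step_gt0.
Qed.

End osgood.

(** * Moments of the running supremum *)

Section sup_moment.
Context (R : realType) (T : R) (n : nat) d (Omega : measurableType d).
Context (P : probability Omega R) (B : R -> Omega -> 'rV[R]_n).
Hypotheses (cP : measure_is_complete P) (hB : brownian_motion P T B) (hT : 0 < T).
Local Notation G := (brownian_gen P B).
Variables (p : R) (Y : R -> Omega -> R).
Hypotheses (p1 : 1 < p) (hY : Sp_space P T G p Y).

(** [fine] returns 0 where the supremum is infinite, which happens only on a negligible set since
    almost every path is continuous. *)
Definition path_sup w : R := fine (sup_abs T Y w).

Lemma path_sup_ge0 w : 0 <= path_sup w.
Proof.
apply: fine_ge0; apply: le_trans (sup_abs_ge Y w (_ : 0 <= 0 <= T)); first by rewrite lee_fin.
by rewrite lexx ltW.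
Qed.

Lemma measurable_path_sup : measurable_fun setT path_sup.
Proof.
have [[pY cY] _] := hY; apply: measurableT_comp => //.
apply: (measurable_sup_abs cP hT) => // t tT.
exact: (progressive_measurableT cP hB tT pY).
Qed.

(** The maximum being attained, the power p passes through the supremum. *)
Lemma path_sup_attained w : {within `[0, T], continuous (Y ^~ w)} ->
  exists2 c, 0 <= c <= T & path_sup w = `|Y c w| /\ forall t, 0 <= t <= T -> `|Y t w| <= `|Y c w|.
Proof.
move=> cw.
have caw : {within `[0, T], continuous (fun t => `|Y t w|)}.
  apply/within_continuous_itvP => t tT e e0.
  have [de de0 Hde] := (within_continuous_itvP _ _ _).1 cw t tT e e0; exists de => // r rT tr.
  by apply: le_lt_trans (Hde _ rT tr); exact: ler_dist_dist.
have [c cin Hc] := EVT_max (ltW hT) caw.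
rewrite in_itv/= in cin; exists c => //.
have {}Hc t : 0 <= t <= T -> `|Y t w| <= `|Y c w| by move=> tT; apply: Hc; rewrite in_itv.
split=> //; rewrite /path_sup; have -> // : sup_abs T Y w = `|Y c w|%:E.
apply/eqP; rewrite eq_le sup_abs_ge// andbT; apply: ge_ereal_sup => _ [t /= tT <-].
by rewrite lee_fin; apply: Hc; rewrite in_itv/= in tT.
Qed.

Lemma path_sup_ge : {ae P, forall w, forall t, 0 <= t <= T -> `|Y t w| <= path_sup w}.
Proof.
have [[_ cY] _] := hY; apply: filterS cY => w /path_sup_attained[c _ [-> ?]]; exact.
Qed.

Lemma integrable_path_sup : P.-integrable setT (EFin \o (fun w => path_sup w `^ p)).
Proof.
have [[_ cY] fY] := hY.
have p0 : 0 <= p by exact: ltW (lt_trans ltr01 p1).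
have mS : measurable_fun setT (fun w => path_sup w `^ p).
  exact: (measurableT_comp (measurable_powR p) measurable_path_sup).
apply/integrableP; split; first exact/measurable_EFinP.
have E : ae_eq P setT (EFin \o (fun w => path_sup w `^ p))
    (fun w => ereal_sup [set (`|Y t w| `^ p)%:E | t in `[0%R, T]]).
  apply: filterS cY => w /path_sup_attained[c cT [SE Hc]] _ /=; rewrite SE.
  apply/eqP; rewrite eq_le; apply/andP; split.
    by apply: ereal_sup_ubound; exists c => //=; rewrite in_itv.
  apply: ge_ereal_sup => _ [t /= tT <-]; rewrite lee_fin; apply: ge0_ler_powR => //; rewrite ?nnegrE//.
  by apply: Hc; rewrite in_itv/= in tT.
have mE : measurable_fun setT (EFin \o (fun w => path_sup w `^ p)) by exact/measurable_EFinP.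
have mR := ae_measurable_fun cP E mE.
apply: le_lt_trans fY.
rewrite (eq_integral (EFin \o (fun w => path_sup w `^ p))).
  rewrite le_eqVlt; apply/orP; left; apply/eqP.
  by apply: ae_eq_integral => //; exact: mR.
by move=> w _; rewrite gee0_abs// lee_fin powR_ge0.
Qed.

End sup_moment.

Lemma powR_add3_le (R : realType) (p a b c : R) : 0 < p -> 0 <= a -> 0 <= b -> 0 <= c ->
  (a + (b + c)) `^ p <= 3 `^ p * (a `^ p + (b `^ p + c `^ p)).
Proof.
move=> p0 a0 b0 c0.
pose m := Num.max a (Num.max b c).
have [am bm cm] : [/\ a <= m, b <= m & c <= m] by rewrite /m !le_max !lexx !orbT.
have m0 : 0 <= m := le_trans a0 am.
apply: (@le_trans _ _ ((3 * m) `^ p)).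
  apply: ge0_ler_powR; rewrite ?nnegrE ?addr_ge0 ?mulr_ge0//; [exact: ltW|lra].
rewrite powRM// ler_wpM2l ?powR_ge0//.
have [pa pb pc] : [/\ 0 <= a `^ p, 0 <= b `^ p & 0 <= c `^ p] by rewrite !powR_ge0.
have : m = a \/ (m = b \/ m = c).
  by rewrite /m; case: (leP b c) => _; case: leP => _; [right; right|left|right; left|left].
by move=> [->|[->|->]]; lra.
Qed.

Lemma itv_length (R : realType) (s s' : R) : s <= s' ->
  fine (lebesgue_measure (`[s, s']%classic : set (measurableTypeR R))) = s' - s.
Proof.
rewrite lebesgue_measure_itv/= lte_fin le_eqVlt => /orP[/eqP ->|->]; first by rewrite ltxx subrr.
by [].
Qed.

Lemma shifted_increment (R : realFieldType) (i1 i2 y1 y1' y2 y2' v1 v1' v2 v2' k1 k1' k2 k2' j1 j1' j2 j2' a c t s s' : R) :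
  y1' - y1 = - i1 - (v1' - v1) - (k1' - k1) + (j1' - j1) ->
  y2' - y2 = - i2 - (v2' - v2) - (k2' - k2) + (j2' - j2) ->
  y1' - y2' - (a + c * (t - s')) - (j1' - j2') - (y1 - y2 - (a + c * (t - s)) - (j1 - j2)) =
  c * (s' - s) - (i1 - i2) + ((v2' - v1') + k2' - ((v2 - v1) + k2)) - (k1' - k1).
Proof. move=> e1 e2; lra. Qed.

Lemma barrier_gap_gt0 (R : realFieldType) (y1 y2 l1 l2 f : R) :
  0 <= f -> l2 <= y2 -> l1 <= l2 -> 0 < y1 - y2 - f -> 0 < y1 - l1.
Proof. lra. Qed.

Lemma shifted_drift_ge (R : realFieldType) (D r0 rx m1 m2 z e : R) :
  m1 <= m2 -> rx <= r0 + m1 -> D <= rx + e + z -> - (r0 + e - D) <= m2 + z.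
Proof. lra. Qed.

Lemma rbsde_increment (R : realType) (T x : R) (f v y k i : R -> R) (s s' : R) :
  lebesgue_measure.-integrable `[0, T] (EFin \o f) ->
  (forall t : R, t \in `[0, T] -> y t = x + \int[lebesgue_measure]_(r in `[t, T]) f r
        + (v T - v t) + (k T - k t) - (i T - i t)) ->
  0 <= s -> s <= s' -> s' <= T ->
  y s' - y s = - (\int[lebesgue_measure]_(r in `[s, s']) f r) - (v s' - v s) - (k s' - k s) + (i s' - i s).
Proof.
move=> iF Hy s0 ss sT.
rewrite (Hy s') ?(Hy s) ?in_itv/= ?s0 ?sT ?(le_trans s0 ss) ?(le_trans ss sT)//.
rewrite (Rintegral_itv_cat ss sT (integrable_itvS s0 (lexx T) iF)); ring.
Qed.

Lemma Rintegral_cstBB (R : realType) (c s s' : R) (f g : R -> R) : s <= s' ->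
  lebesgue_measure.-integrable `[s, s'] (EFin \o f) -> lebesgue_measure.-integrable `[s, s'] (EFin \o g) ->
  \int[lebesgue_measure]_(r in `[s, s']) (c - (f r - g r)) = c * (s' - s)
    - (\int[lebesgue_measure]_(r in `[s, s']) f r - \int[lebesgue_measure]_(r in `[s, s']) g r).
Proof.
move=> ss iF iG.
have mI : measurable (`[s, s']%classic : set R) by [].
have fin : (lebesgue_measure `[s, s']%classic < +oo)%E.
  by rewrite lebesgue_measure_itv; case: ifP => _; rewrite ?ltry.
have ic : lebesgue_measure.-integrable `[s, s'] (EFin \o cst c).
  by apply: measurable_bounded_integrable => //; exact: bounded_cst.
have -> : \int[lebesgue_measure]_(r in `[s, s']) (c - (f r - g r)) =
    \int[lebesgue_measure]_(r in `[s, s']) (cst c r - (f r - g r)) by [].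
rewrite RintegralB//; last exact: integrableB_EFin.
rewrite RintegralB//; congr (_ - _).
rewrite Rintegral_cst//; congr (_ * _); exact: itv_length.
Qed.

Lemma path_split (R : realFieldType) (x x0 i i0 : R) : x = x0 + ((x - i) - (x0 - i0)) + (i - i0).
Proof. by ring. Qed.

(** * Comparison of two reflected equations *)

Section comparison.
Context (R : realType) (T : R) (n : nat) d (Omega : measurableType d).
Context (P : probability Omega R) (B : R -> Omega -> 'rV[R]_n).
Hypotheses (cP : measure_is_complete P) (hB : brownian_motion P T B) (hT : 0 < T).
Local Notation G := (brownian_gen P B).
Local Notation mu := lebesgue_measure.
Variables (p : R) (xi1 xi2 : Omega -> R) (g1 g2 : R -> Omega -> R -> 'rV[R]_n -> R).
Variables (V1 V2 L1 L2 Y1 Y2 : R -> Omega -> R) (Z1 Z2 : R -> Omega -> 'rV[R]_n).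
Variables (K1 K2 : R -> Omega -> R).
Hypotheses (p1 : 1 < p) (hL1 : S_space P T G L1).
Hypotheses (hY1 : Sp_space P T G p Y1) (hY2 : Sp_space P T G p Y2).
Hypothesis hsol1 : rbsde_solution P T B xi1 g1 V1 L1 Y1 Z1 K1.
Hypothesis hsol2 : rbsde_solution P T B xi2 g2 V2 L2 Y2 Z2 K2.
Hypothesis hV : as_nondecreasing P T (fun t w => V2 t w - V1 t w).
Hypothesis hL : {ae P, forall w, forall t, t \in `[0, T] -> L1 t w <= L2 t w}.
Variable rho : R -> R.
Hypothesis rho_nd : {in `[0, +oo[ &, nondecreasing rho}.
Hypothesis rho_cv : convex_function (`[0, +oo[%classic : set R^o) (fun u => - rho u).
Hypotheses (rho0 : rho 0 = 0) (rho_gt0 : forall u : R, 0 < u -> 0 < rho u).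
Local Notation drift t w := (g1 t w (Y1 t w) (Z1 t w) - g2 t w (Y2 t w) (Z2 t w)).
Hypothesis drift_le : forall eps : R, 0 < eps -> exists2 C : R, 0 <= C &
  {ae P, forall w, {ae mu, forall t : measurableTypeR R, t \in `[0, T] -> Y2 t w < Y1 t w ->
    drift t w <= rho (Y1 t w - Y2 t w) + eps + C * enorm (Z1 t w - Z2 t w)}}.

Lemma measurable_enorm_sqr (Z : R -> Omega -> 'rV[R]_n) w : progressive_rV T G Z ->
  measurable_fun `[0, T]%classic (fun t : measurableTypeR R => enorm (Z t w) ^+ 2).
Proof.
move=> pZ.
apply: (eq_measurable_fun (fun t : measurableTypeR R => \sum_(i < n) cut T (fun t w => Z t w ord0 i) (t, w) ^+ 2)).
  move=> t; rewrite inE/= in_itv/= => tT; rewrite enorm_sqr; apply: eq_bigr => i _.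
  by rewrite cutE.
apply: measurable_funTS; apply: measurable_sum => i; apply: measurable_funX.
exact: (measurable_section w (progressive_measurable cP hB hT (pZ i))).
Qed.

Lemma integrable_enorm_sqr (Z : R -> Omega -> 'rV[R]_n) w : progressive_rV T G Z ->
  (\int[mu]_(t in `[0%R, T]) (enorm (Z t w) ^+ 2)%:E < +oo)%E ->
  mu.-integrable `[0, T] (EFin \o (fun t => enorm (Z t w) ^+ 2)).
Proof.
move=> pZ fin; apply/integrableP; split; first by apply/measurable_EFinP; exact: measurable_enorm_sqr.
apply: le_lt_trans fin; rewrite le_eqVlt; apply/orP; left; apply/eqP.
by apply: eq_integral => t _; rewrite gee0_abs// lee_fin sqr_ge0.
Qed.

Section step.
Variables (t0 t1 a b eps : R).
Hypotheses (t00 : 0 <= t0) (t01 : t0 <= t1) (t1T : t1 <= T).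
Hypotheses (a_ge0 : 0 <= a) (b_gt0 : 0 < b) (eps_gt0 : 0 < eps).
Local Notation c0 := (rho b + eps).
Hypothesis abT : a + c0 * (t1 - t0) <= b.
Hypothesis X1 : {ae P, forall w, Y1 t1 w - Y2 t1 w <= a}.

Definition ramp (t : R) : R := a + c0 * (t1 - t).
Local Notation shifted t w := (Y1 t w - Y2 t w - ramp t).

Let c0_gt0 : 0 < c0. Proof. by rewrite addr_gt0// rho_gt0. Qed.

Lemma ramp_bounds t : t0 <= t <= t1 -> 0 <= ramp t <= b.
Proof.
move=> /andP[tt0 tt1]; rewrite addr_ge0 ?mulr_ge0 ?subr_ge0 ?(ltW c0_gt0)//=.
by apply: le_trans abT; rewrite lerD2l ler_pM2l// lerD2l lerN2.
Qed.

Lemma ramp_continuous : continuous ramp.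
Proof.
move=> t; apply: cvgD; first exact: cvg_cst.
by apply: cvgM; [exact: cvg_cst|apply: cvgB; [exact: cvg_cst|exact: cvg_id]].
Qed.

(** The bounded variation part is defined as the shifted difference minus its stochastic integral.
    [V2 - V1] and [K2] push the difference up, whatever its sign; only [K1] pushes it down. *)
Lemma step_drift_path (C : R) (I1 I2 : R -> Omega -> R) : 0 <= C ->
  {ae P, forall w, {ae mu, forall t : measurableTypeR R, t \in `[0, T] -> Y2 t w < Y1 t w ->
    drift t w <= rho (Y1 t w - Y2 t w) + eps + C * enorm (Z1 t w - Z2 t w)}} ->
  as_continuous P T I1 -> as_continuous P T I2 ->
  {ae P, forall w, forall t, t \in `[0, T] -> Y1 t w = xi1 w
        + \int[lebesgue_measure]_(s in `[t, T]) g1 s w (Y1 s w) (Z1 s w)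
        + (V1 T w - V1 t w) + (K1 T w - K1 t w) - (I1 T w - I1 t w)} ->
  {ae P, forall w, forall t, t \in `[0, T] -> Y2 t w = xi2 w
        + \int[lebesgue_measure]_(s in `[t, T]) g2 s w (Y2 s w) (Z2 s w)
        + (V2 T w - V2 t w) + (K2 T w - K2 t w) - (I2 T w - I2 t w)} ->
  {ae P, forall w, drift_path t0 t1 (rho b / b) C (fun t => shifted t w) (fun t => shifted t w - (I1 t w - I2 t w))
    (fun t => c0 - drift t w) (fun t => enorm (Z1 t w - Z2 t w))
    (fun t => (V2 t w - V1 t w) + K2 t w) (K1 ^~ w)}.
Proof.
move=> C0 Hgap cI1 cI2 E1 E2.
have [[_ cY1] _] := hY1; have [[_ cY2] _] := hY2; have [_ cL1] := hL1.
have [pY1 pZ1 _ gi1 zi1 _ bar1 nK1 _ _ sk1] := hsol1.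
have [pY2 pZ2 _ gi2 zi2 _ bar2 nK2 _ _ _] := hsol2.
apply: filterS (filterI (filterI (filterI (filterI Hgap cI1) (filterI cI2 E1)) (filterI (filterI E2 cY1) (filterI cY2 cL1)))
  (filterI (filterI (filterI gi1 zi1) (filterI bar1 nK1)) (filterI (filterI (filterI sk1 gi2) (filterI zi2 bar2))
   (filterI nK2 (filterI hV hL))))) => w.
move=> [[[[{}Hgap {}cI1] [{}cI2 {}E1]] [[{}E2 {}cY1] [{}cY2 {}cL1]]]
  [[[{}gi1 {}zi1] [{}bar1 {}nK1]] [[[{}sk1 {}gi2] [{}zi2 {}bar2]] [{}nK2 [hVw hLw]]]]].
have sub : `[t0, t1]%classic `<=` `[0, T]%classic.
  by move=> r /=; rewrite !in_itv/= => /andP[r0 r1]; rewrite (le_trans t00 r0) (le_trans r1 t1T).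
have inT r : t0 <= r <= t1 -> r \in `[0, T].
  by move=> h; have := sub r; rewrite /= !in_itv/=; apply.
have cX : {within `[0, T], continuous (fun t => shifted t w)}.
  have h := within_continuousB (within_continuousB cY1 cY2) (continuous_subspaceT ramp_continuous).
  exact: h.
have cA : {within `[0, T], continuous (fun t => shifted t w - (I1 t w - I2 t w))}.
  exact: (within_continuousB cX (within_continuousB cI1 cI2)).
have ib : mu.-integrable `[t0, t1] (EFin \o cst c0).
  have fin : (mu `[t0, t1]%classic < +oo)%E.
    by rewrite lebesgue_measure_itv; case: ifP => _; rewrite ?ltry.
  by apply: measurable_bounded_integrable => //; exact: bounded_cst.
have igd : mu.-integrable `[0, T] (EFin \o (fun t => drift t w)) by exact: integrableB_EFin.
have iZ1 := integrable_enorm_sqr pZ1 zi1; have iZ2 := integrable_enorm_sqr pZ2 zi2.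
have [f mf fE] := measurable_dist cP hB hT pZ1 pZ2.
have mz : measurable_fun `[t0, t1]%classic ((fun t => enorm (Z1 t w - Z2 t w)) : measurableTypeR R -> R).
  apply: (eq_measurable_fun (fun t : measurableTypeR R => f (t, w))).
    by move=> t; rewrite inE/= in_itv/= => /inT; rewrite in_itv/= => tT; rewrite fE.
  by apply: measurable_funTS; exact: measurable_section.
split.
- exact: continuous_subspaceW sub cX.
- exact: continuous_subspaceW sub cA.
- by apply: integrableB_EFin => //; exact: integrable_itvS t00 t1T igd.
- exact: mz.
- apply: (le_integrable_EFin (mu := mu) _ _ (g := fun t => 2 * enorm (Z1 t w) ^+ 2 + 2 * enorm (Z2 t w) ^+ 2)) => //.
  + exact: measurable_funX.
  + move=> t _ /=; rewrite ger0_norm ?sqr_ge0//.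
    have := enormB_sqr_le (Z1 t w) (Z2 t w) 0 0.
    have -> : enorm (0 - 0 : 'rV[R]_n) = 0.
      by rewrite /enorm big1 ?sqrtr0// => i _; rewrite !mxE subrr expr0n.
    by rewrite sub0r sqrrN !sub0r !enormN.
  + apply: integrableD_EFin => //; apply: integrableZ_EFin => //.
      exact: integrable_itvS t00 t1T iZ1.
    exact: integrable_itvS t00 t1T iZ2.
- move=> s s' s0 ss s1.
  have h0 : 0 <= s <= T by rewrite (le_trans t00 s0) (le_trans (le_trans ss s1) t1T).
  have h1 : 0 <= s' <= T by rewrite (le_trans (le_trans t00 s0) ss) (le_trans s1 t1T).
  by rewrite lerD//; [apply: hVw|apply: nK2]; rewrite ?in_itv.
- move=> s s' s0 ss s1.
  have h0 : 0 <= s <= T by rewrite (le_trans t00 s0) (le_trans (le_trans ss s1) t1T).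
  have h1 : 0 <= s' <= T by rewrite (le_trans (le_trans t00 s0) ss) (le_trans s1 t1T).
  by apply: nK1; rewrite ?in_itv.
- move=> s s' s0 ss s1.
  have s00 := le_trans t00 s0; have s1T := le_trans s1 t1T.
  have e1 := rbsde_increment (f := fun t => g1 t w (Y1 t w) (Z1 t w)) (v := V1 ^~ w) (y := Y1 ^~ w) (k := K1 ^~ w) (i := I1 ^~ w) gi1 E1 s00 ss s1T.
  have e2 := rbsde_increment (f := fun t => g2 t w (Y2 t w) (Z2 t w)) (v := V2 ^~ w) (y := Y2 ^~ w) (k := K2 ^~ w) (i := I2 ^~ w) gi2 E2 s00 ss s1T.
  have igs1 := integrable_itvS (f := fun t => g1 t w (Y1 t w) (Z1 t w)) s00 s1T gi1.
  have igs2 := integrable_itvS (f := fun t => g2 t w (Y2 t w) (Z2 t w)) s00 s1T gi2.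
  have ics := integrable_itvS (f := cst c0) s0 s1 ib.
  have igs : mu.-integrable `[s, s'] (EFin \o (fun t => drift t w)) by exact: integrableB_EFin.
  have -> : \int[mu]_(r in `[s, s']) (c0 - drift r w) = c0 * (s' - s)
     - (\int[mu]_(r in `[s, s']) g1 r w (Y1 r w) (Z1 r w) - \int[mu]_(r in `[s, s']) g2 r w (Y2 r w) (Z2 r w)).
    exact: Rintegral_cstBB.
  rewrite /ramp; move: e1 e2; move: (\int[mu]_(r in _) g1 _ _ _ _) (\int[mu]_(r in _) g2 _ _ _ _).
  by move=> i1 i2 e1 e2; apply: shifted_increment; [exact: e1|exact: e2].
(* Where the shifted difference is positive, [Y1 > Y2 >= L2 >= L1] because the ramp is nonnegative,
   so [K1] is flat by the Skorokhod condition. *)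
- move=> s s' s0 ss s1 Xpos.
  have s00 := le_trans t00 s0; have s1T := le_trans s1 t1T.
  apply: (skorokhod_flat (k := K1 ^~ w) (Y := fun t => Y1 t w - L1 t w) (T := T)) => //.
  + exact: (within_continuousB cY1 cL1).
  + by move=> t tT; rewrite subr_ge0 bar1// in_itv.
  + move=> r rss; have rt : t0 <= r <= t1.
      by move: rss => /andP[r0 r1]; rewrite (le_trans s0 r0) (le_trans r1 s1).
    have := Xpos r rss; have /andP[f0 _] := ramp_bounds rt.
    have := hLw r (inT r rt); have := bar2 r (inT r rt).
    by move=> h1 h2 h3; exact: barrier_gap_gt0 f0 h1 h2 h3.
(* The slope of the ramp cancels [rho b + eps]; as the ramp stays below [b], the excess over [b] in
   [concave_le] is at most the shifted difference. *)
- apply: filterS Hgap => r Hr rt Xpos.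
  have rt' : t0 <= r <= t1 by move: rt; rewrite /= in_itv.
  have /andP[f0 fb] := ramp_bounds rt'.
  have X0 : Y2 r w < Y1 r w.
    by rewrite -subr_gt0; apply: lt_le_trans Xpos _; rewrite lerBlDr lerDl.
  have := Hr (inT r rt') X0.
  have Xge : 0 <= Y1 r w - Y2 r w by rewrite subr_ge0 ltW.
  have := concave_le rho_nd rho_cv rho0 b_gt0 Xge.
  have k0 : 0 <= rho b / b by rewrite divr_ge0 ?ltW// rho_gt0.
  have mx : Num.max (Y1 r w - Y2 r w - b) 0 <= shifted r w.
    by rewrite ge_max (ltW Xpos) andbT lerD2l lerN2.
  have := ler_wpM2l k0 mx.
  move: (drift r w) (rho (Y1 r w - Y2 r w)) (rho b / b * Num.max _ _) (rho b / b * shifted r w) (C * enorm _).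
  by move=> *; apply: shifted_drift_ge; eassumption.
Qed.

Lemma step_claim : {ae P, forall w, Y1 t0 w - Y2 t0 w <= ramp t0}.
Proof.
have [C C0 Hgap] := drift_le eps_gt0.
have [pY1 pZ1 _ _ _ [I1 iI1 E1] _ _ _ _ _] := hsol1.
have [pY2 pZ2 _ _ _ [I2 iI2 E2] _ _ _ _ _] := hsol2.
have cI1 : as_continuous P T I1 by have [[]] := iI1.
have cI2 : as_continuous P T I2 by have [[]] := iI2.
have Hpath := step_drift_path C0 Hgap cI1 cI2 E1 E2.
have m0 : 0 <= rho b / b by rewrite divr_ge0 ?ltW// rho_gt0.
(* The ramp is at most [b], so this dominates the shifted difference at all times; its moment of
   order p matches the growth of the Lyapunov function. *)
pose S w := b + (path_sup T Y1 w + path_sup T Y2 w).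
have s10 := path_sup_ge0 hT Y1; have s20 := path_sup_ge0 hT Y2.
have b0 : 0 <= b by exact: ltW.
have S0 w : 0 <= S w by rewrite !addr_ge0.
have mS1 := measurable_path_sup cP hB hT hY1; have mS2 := measurable_path_sup cP hB hT hY2.
have mS : measurable_fun setT S by apply: measurable_funD => //; exact: measurable_funD.
have aX t : t0 <= t <= t1 -> adapted_at G t (fun w => shifted t w).
  move=> /andP[h0 h1]; have tT : 0 <= t <= T by rewrite (le_trans t00 h0) (le_trans h1 t1T).
  apply: measurable_funB; last exact: measurable_cst.
  by apply: measurable_funB; [exact: (progressive_adapted tT pY1)|exact: (progressive_adapted tT pY2)].
have XE : {ae P, forall w, forall t, t0 <= t <= t1 ->
   shifted t w = shifted t0 w + ((shifted t w - (I1 t w - I2 t w)) - (shifted t0 w - (I1 t0 w - I2 t0 w)))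
     + ((I1 t w - I2 t w) - (I1 t0 w - I2 t0 w))}.
  by apply/aeW => w t _; exact: path_split.
have X1' : {ae P, forall w, shifted t1 w <= 0}.
  by apply: filterS X1 => w; rewrite /ramp subrr mulr0 addr0 subr_le0.
have HS : {ae P, forall w, forall t, t0 <= t <= t1 -> `|shifted t w| <= S w}.
  apply: filterS (filterI (path_sup_ge hT hY1) (path_sup_ge hT hY2)) => w [h1 h2] t tt.
  have tT : 0 <= t <= T.
    by move: tt => /andP[u0 u1]; rewrite (le_trans t00 u0) (le_trans u1 t1T).
  have /andP[f0 fb] := ramp_bounds tt.
  apply: (le_trans (ler_normB _ _)); rewrite addrC; apply: lerD; first by rewrite ger0_norm.
  by apply: (le_trans (ler_normB _ _)); apply: lerD; [exact: h1|exact: h2].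
have p0 : 0 < p by exact: lt_trans p1.
have iS : P.-integrable setT (EFin \o (fun w => (1 + S w) `^ p)).
  apply: (le_integrable_EFin measurableT
    (g := fun w => 3 `^ p * (cst ((1 + b) `^ p) w + (path_sup T Y1 w `^ p + path_sup T Y2 w `^ p)))).
  - by apply: (measurableT_comp (measurable_powR p)); exact: measurable_funD.
  - move=> w _; rewrite ger0_norm ?powR_ge0// /S addrA; apply: powR_add3_le => //.
    by rewrite addr_ge0.
  - apply: integrableZ_EFin => //; apply: integrableD_EFin => //.
      exact: finite_measure_integrable_cst.
    by apply: integrableD_EFin => //; [exact: (integrable_path_sup cP hB hT p1 hY1)|exact: (integrable_path_sup cP hB hT p1 hY2)].
have := process_comparison cP hB hT p1 t00 t01 t1T m0 C0 pZ1 iI1 pZ2 iI2 Hpath aX XE X1' mS S0 HS iS.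
by apply: filterS => w; rewrite subr_le0.
Qed.

End step.

Hypothesis hxi : {ae P, forall w, xi1 w <= xi2 w}.
Hypothesis rho_int : forall e : R, 0 < e ->
  (\int[lebesgue_measure]_(u in `]0%R, e]) ((rho u)^-1)%:E = +oo)%E.

Lemma terminal_le : {ae P, forall w, Y1 T w <= Y2 T w}.
Proof.
have [_ _ _ _ _ [I1 _ E1] _ _ _ _ _] := hsol1.
have [_ _ _ _ _ [I2 _ E2] _ _ _ _ _] := hsol2.
apply: filterS (filterI hxi (filterI E1 E2)) => w [h [e1 e2]].
have TT : T \in `[0, T] by rewrite in_itv/= lexx (ltW hT).
by rewrite e1// e2// !set_itv1 !Rintegral_set1 !subrr !addr0 !subr0.
Qed.

(** Induction on the number k of steps with the level i free: each step back in time doubles the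
    bound, so the finest level sits at T, where the difference is nonpositive. *)
Lemma level_claim (d0 : R) : 0 < d0 -> forall k i t, 0 <= t -> t <= T ->
  T - t <= \sum_(l < k) time_step rho d0 (i + l)%N -> {ae P, forall w, Y1 t w - Y2 t w <= level d0 i}.
Proof.
move=> d0_gt0; elim=> [|k IH] i t t0 tT.
  rewrite big_ord0 subr_le0 => Tt; have -> : t = T by apply/eqP; rewrite eq_le tT.
  apply: filterS terminal_le => w h; apply: (@le_trans _ _ 0); first by rewrite subr_le0.
  exact: ltW (level_gt0 d0_gt0 i).
rewrite big_ord_recl/= addn0 => Hsum.
have ts0 := time_step_gt0 rho_gt0 d0_gt0.
pose t1 := Num.min T (t + time_step rho d0 i).
have tt1 : t <= t1 by rewrite le_min tT lerDl ltW.
have t1T : t1 <= T by rewrite ge_min lexx.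
have t10 : 0 <= t1 := le_trans t0 tt1.
have h1 : {ae P, forall w, Y1 t1 w - Y2 t1 w <= level d0 i.+1}.
  apply: IH => //; rewrite /t1; case: (leP T (t + time_step rho d0 i)) => _.
    by rewrite subrr sumr_ge0// => l _; exact: ltW (ts0 _).
  rewrite opprD addrA lerBlDl; apply: (le_trans Hsum); rewrite lerD2l.
  by apply: ler_sum => l _; rewrite /bump/= add1n addnS addSn.
have bi := level_gt0 d0_gt0 i; have rb := rho_gt0 bi.
have dt : t1 - t <= time_step rho d0 i by rewrite lerBlDl ge_min lexx orbT.
have key : level d0 i.+1 + (rho (level d0 i) + rho (level d0 i)) * (t1 - t) <= level d0 i.
  have e : (rho (level d0 i) + rho (level d0 i)) * time_step rho d0 i = level d0 i / 2.
    by rewrite /time_step; field; rewrite gt_eqF.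
  rewrite levelS; apply: (@le_trans _ _ (level d0 i / 2 + level d0 i / 2)); last by rewrite -splitr.
  by rewrite lerD2l -e ler_wpM2l// addr_ge0// ltW.
(* Through [rb], eps is taken equal to [rho (level d0 i)]: the constant C attached to it does not
   enter the conclusion. *)
have := step_claim t0 tt1 t1T (ltW (level_gt0 d0_gt0 i.+1)) bi rb key h1.
by apply: filterS => w /le_trans; apply.
Qed.

Lemma comparison_of_drift : {ae P, forall w, forall t, t \in `[0, T] -> Y1 t w <= Y2 t w}.
Proof.
have [[_ cY1] _] := hY1; have [[_ cY2] _] := hY2.
have each (d0 t : R) : 0 < d0 -> 0 <= t <= T -> {ae P, forall w, Y1 t w - Y2 t w <= d0}.
  move=> d0_gt0 /andP[t0 tT].
  have [N HN] := time_steps_diverge rho_nd rho_gt0 rho_int d0_gt0 T.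
  have := level_claim d0_gt0 (k := N) (i := 0%N) t0 tT.
  rewrite /level expr0 mulr1; apply.
  by apply: (le_trans _ HN); rewrite gerBl.
(* Pairs of a rational time and a tolerance are coded by one integer, so that the exceptional sets
   form a countable family; continuity then reaches all times. *)
have all_n : {ae P, forall w, forall m : nat,
    let qm := odflt (0, 0%N) (unpickle m : option (rat * nat)) in
    Y1 (clip T (ratr qm.1)) w - Y2 (clip T (ratr qm.1)) w <= qm.2.+1%:R^-1}.
  by apply/ae_foralln => m /=; apply: each; [rewrite invr_gt0|exact: clip_in].
apply: filterS (filterI all_n (filterI cY1 cY2)) => w [H [c1 c2]] t; rewrite in_itv/= => tT.
rewrite -subr_le0; move: t tT.
apply: (all_times_of_rat hT (within_continuousB c1 c2)) => qq.
rewrite leNgt; apply/negP => pos.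
have {}pos : 0 < Y1 (clip T (ratr qq)) w - Y2 (clip T (ratr qq)) w by exact: pos.
set x := Y1 _ w - Y2 _ w in pos.
have := H (pickle (qq, Num.truncn x^-1)); rewrite pickleK/= -/x leNgt => /negP; apply.
rewrite -[ltRHS]invrK ltf_pV2 ?posrE ?invr_gt0//.
exact: truncnS_gt.
Qed.

End comparison.

Lemma drift_bound_case_a (R : realFieldType) (g11 g21 g22 k r e z : R) :
  g11 - g21 <= r -> g21 - g22 <= e + z -> g22 - k <= 0 -> g11 - k <= r + e + z.
Proof. lra. Qed.

Lemma drift_bound_case_b (R : realFieldType) (g k11 k21 k22 r e z : R) :
  k11 - k21 <= r -> k21 - k22 <= e + z -> g - k11 <= 0 -> g - k22 <= r + e + z.
Proof. lra. Qed.

(** The difference is split at intermediate points. Under the first alternative g1 goes from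
    [(Y1, Z1)] to [(Y2, Z1)] to [(Y2, Z2)], where it is compared with g2. Under the second the
    comparison takes place at [(Y1, Z1)] and g2 follows the same route. *)
Lemma drift_le_of_conditions (R : realType) (T : R) (n : nat) d (Omega : measurableType d)
    (P : probability Omega R) (g1 g2 : R -> Omega -> R -> 'rV[R]_n -> R)
    (Y1 Y2 : R -> Omega -> R) (Z1 Z2 : R -> Omega -> 'rV[R]_n) (rho : R -> R) :
  ({ae (P \x lebesgue_measure)%E, forall q : Omega * R, q.2 \in `[0, T] -> forall y1 y2 z,
      (g1 q.2 q.1 y1 z - g1 q.2 q.1 y2 z) * Num.sg (y1 - y2) <= rho `|y1 - y2|} /\
    unif_continuous_z P T g1 /\
    {ae (P \x lebesgue_measure)%E, forall q : Omega * R, q.2 \in `[0, T] ->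
      let t := q.2 in let w := q.1 in
      (Y2 t w < Y1 t w)%R%:R * (g1 t w (Y2 t w) (Z2 t w) - g2 t w (Y2 t w) (Z2 t w)) <= 0}) \/
  ({ae (P \x lebesgue_measure)%E, forall q : Omega * R, q.2 \in `[0, T] -> forall y1 y2 z,
      (g2 q.2 q.1 y1 z - g2 q.2 q.1 y2 z) * Num.sg (y1 - y2) <= rho `|y1 - y2|} /\
    unif_continuous_z P T g2 /\
    {ae (P \x lebesgue_measure)%E, forall q : Omega * R, q.2 \in `[0, T] ->
      let t := q.2 in let w := q.1 in
      (Y2 t w < Y1 t w)%R%:R * (g1 t w (Y1 t w) (Z1 t w) - g2 t w (Y1 t w) (Z1 t w)) <= 0}) ->
  forall eps : R, 0 < eps -> exists2 C : R, 0 <= C &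
  {ae P, forall w, {ae lebesgue_measure, forall t : measurableTypeR R, t \in `[0, T] -> Y2 t w < Y1 t w ->
    g1 t w (Y1 t w) (Z1 t w) - g2 t w (Y2 t w) (Z2 t w) <=
      rho (Y1 t w - Y2 t w) + eps + C * enorm (Z1 t w - Z2 t w)}}.
Proof.
move=> H eps eps0.
case: H => -[Hrho [Hphi Hcmp]]; have [C C0 Hz] := modulus_linear Hphi eps0; exists C => //;
  have /ae_section Hr := Hrho; have /ae_section Hc := Hcmp;
  apply: filterS (filterI Hr (filterI Hc Hz)) => w [{}Hr [{}Hc {}Hz]];
  apply: filterS (filterI Hr (filterI Hc Hz)) => t /= [{}Hr [{}Hc {}Hz]] tT Y21;
  have Y0 : 0 < Y1 t w - Y2 t w by rewrite subr_gt0.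
- have := Hr tT (Y1 t w) (Y2 t w) (Z1 t w); rewrite gtr0_sg// mulr1 gtr0_norm// => h1.
  have := Hz tT (Y2 t w) (Z1 t w) (Z2 t w); rewrite ler_norml => /andP[_ h2].
  have := Hc tT; rewrite Y21 mul1r => h3; exact: drift_bound_case_a h1 h2 h3.
- have := Hr tT (Y1 t w) (Y2 t w) (Z1 t w); rewrite gtr0_sg// mulr1 gtr0_norm// => h1.
  have := Hz tT (Y2 t w) (Z1 t w) (Z2 t w); rewrite ler_norml => /andP[_ h2].
  have := Hc tT; rewrite Y21 mul1r => h3; exact: drift_bound_case_b h1 h2 h3.
Qed.

Theorem proposition5 (R : realType) (T : R) (hT : 0 < T)
  (n : nat) (hn : (0 < n)%N)
  (d : measure_display) (Omega : measurableType d) (P : probability Omega R)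
  (hP : measure_is_complete P)
  (B : R -> Omega -> 'rV[R]_n) (hB : brownian_motion P T B)
  (hF : (measurable : set (set Omega)) = <<s brownian_gen P B T >>)
  (p : R) (hp : 1 < p)
  (xi1 xi2 : Omega -> R) (g1 g2 : R -> Omega -> R -> 'rV[R]_n -> R)
  (V1 V2 L1 L2 Y1 Y2 : R -> Omega -> R) (Z1 Z2 : R -> Omega -> 'rV[R]_n)
  (K1 K2 : R -> Omega -> R)
  (hV1 : Vp_space P T (brownian_gen P B) p V1)
  (hV2 : Vp_space P T (brownian_gen P B) p V2)
  (hg1 : generator T (brownian_gen P B) g1)
  (hg2 : generator T (brownian_gen P B) g2)
  (hxi1 : Lp_rv P T (brownian_gen P B) p xi1)
  (hxi2 : Lp_rv P T (brownian_gen P B) p xi2)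
  (hL1 : S_space P T (brownian_gen P B) L1)
  (hL2 : S_space P T (brownian_gen P B) L2)
  (hLxi1 : {ae P, forall w, L1 T w <= xi1 w})
  (hLxi2 : {ae P, forall w, L2 T w <= xi2 w})
  (hY1 : Sp_space P T (brownian_gen P B) p Y1)
  (hY2 : Sp_space P T (brownian_gen P B) p Y2)
  (hZ1 : Mp_space P T (brownian_gen P B) p Z1)
  (hZ2 : Mp_space P T (brownian_gen P B) p Z2)
  (hK1 : Vplusp_space P T (brownian_gen P B) p K1)
  (hK2 : Vplusp_space P T (brownian_gen P B) p K2)
  (hsol1 : rbsde_solution P T B xi1 g1 V1 L1 Y1 Z1 K1)
  (hsol2 : rbsde_solution P T B xi2 g2 V2 L2 Y2 Z2 K2)
  (hxi : {ae P, forall w, xi1 w <= xi2 w})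
  (hV : as_nondecreasing P T (fun t w => V2 t w - V1 t w))
  (hL : {ae P, forall w, forall t, t \in `[0, T] -> L1 t w <= L2 t w})
  (hab :
    [/\ osgood_y P T g1, unif_continuous_z P T g1 &
        {ae (P \x lebesgue_measure)%E, forall q : Omega * R,
          q.2 \in `[0, T] ->
          let t := q.2 in let w := q.1 in
          (Y2 t w < Y1 t w)%R%:R *
            (g1 t w (Y2 t w) (Z2 t w) - g2 t w (Y2 t w) (Z2 t w)) <= 0}]
    \/
    [/\ osgood_y P T g2, unif_continuous_z P T g2 &
        {ae (P \x lebesgue_measure)%E, forall q : Omega * R,
          q.2 \in `[0, T] ->
          let t := q.2 in let w := q.1 in
          (Y2 t w < Y1 t w)%R%:R *
            (g1 t w (Y1 t w) (Z1 t w) - g2 t w (Y1 t w) (Z1 t w)) <= 0}]) :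
  {ae P, forall w, forall t, t \in `[0, T] -> Y1 t w <= Y2 t w}.
Proof.
have key (rho : R -> R) : {in `[0, +oo[ &, nondecreasing rho} ->
    convex_function (`[0, +oo[%classic : set R^o) (fun u => - rho u) -> rho 0 = 0 ->
    (forall u, 0 < u -> 0 < rho u) ->
    (forall e, 0 < e -> (\int[lebesgue_measure]_(u in `]0%R, e]) ((rho u)^-1)%:E = +oo)%E) -> _ ->
    {ae P, forall w, forall t, t \in `[0, T] -> Y1 t w <= Y2 t w} :=
  fun nd cv r0 rpos rint gap => comparison_of_drift hP hB hT hp hL1 hY1 hY2 hsol1 hsol2 hV hL
    nd cv r0 rpos (drift_le_of_conditions gap) hxi rint.
case: hab => -[[rho [nd cv [r0 rpos] rint Hrho]] Hphi Hcmp];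
  apply: (key rho nd cv r0 rpos rint); [left|right]; split=> //; split=> //.
Qed.
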